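(* Let $C$ be an irreducible and reduced projective Gorenstein rational curve over $\mathbb{C}$ of arithmetic genus $g$ with a unique singular point $P_\infty$, which is unibranch with value semigroup $\mathbb{H}$ and gaps $w_1^\infty<\dots<w_g^\infty$. Fix a smooth point $P_0\in C$ and an affine coordinate $u$ on the normalization $\mathbb{P}^1$ such that $P_0$ corresponds to $u=0$ and $P_\infty$ to $u=\infty$. Let $L=\omega_C(-(g-1)P_0)$ and let $\tau(\mathbf x)$ be the tau function of $\iota(H^0(C,L(\infty P_0)))$. Then there is a basis of canonical differentials $\omega_1,\dots,\omega_g$ of $H^0(C,\omega_C)$ such that the corresponding theta function (with base point $P_0$) satisfies $$\exp(c_0)\cdot\tau(\mathbf x)\big|_{x_h=0\text{ for all }h\in\mathbb{H}}=\theta(x_{w_1^\infty},\dots,x_{w_g^\infty})$$ for some nonzero constant $c_0$.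
   Context: Semigroup. $\nu:\mathbb P^1\to C$ is the normalization; unibranch means that $P_\infty$ has a single preimage. $\mathbb H\subseteq\mathbb N$ is the set of orders of vanishing at $u=\infty$ of $\nu^*f$, $0\neq f\in\mathcal O_{C,P_\infty}$; the gaps are the $g$ elements of $\mathbb N\setminus\mathbb H$. Setting $x_h=0$ concerns only $h\ge1$ in $\mathbb H$. Theta function. Sections of the dualizing sheaf $\omega_C$ are the meromorphic differentials $\omega$ on $\mathbb P^1$ with $\sum_{Q\in\nu^{-1}(P)}\operatorname{Res}_Q(\nu^*(f)\omega)=0$ for all $P\in C$, $f\in\mathcal O_{C,P}$. Let $C_0$ be the smooth locus. For these curves the period group is zero and $\operatorname{Jac}(C)=H^0(C,\omega_C)^*\cong\mathbb C^g$ via the chosen basis. The theta divisor is the Zariski closure in $\mathbb C^g$ of the image of $C_0^{g-1}$ under $(P_1,\dots,P_{g-1})\mapsto\big(\sum_{k}\int_{P_0}^{P_k}\omega_j\big)_{j=1,\dots,g}$, and a theta function $\theta(z_1,\dots,z_g)$ is a reduced polynomial whose zero divisor is the theta divisor (unique up to a nonzero scalar). Tau functions. Let $V=\mathbb C(\!(u)\!)$ and $\pi:V\to\mathbb C[u^{-1}]$ the projection. A subspace $U\subset V$ is a point of the Sato Grassmannian if $\dim\ker\pi|_U=\dim\operatorname{coker}\pi|_U<\infty$. Such $U$ has a frame: a basis $f_j=\sum_i\xi_{i,j}u^{i+1}$ ($j\ge1$) for which there is $\ell$ with $\xi_{-j,j}=1$, $\xi_{i,j}=0$ for $i<-j$ whenever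 $j>\ell$, and $\xi_{i,j}=0$ for $i<-\ell$ whenever $j\le\ell$. For a partition $\lambda$ put $m_i=\lambda_i-i$ and $\xi_\lambda=\det(\xi_{m_i,j})_{i,j\ge1}$ (the stable value of the $N\times N$ truncations, $N\gg0$). Define $\sigma_i(\mathbf x)$ by $\exp(\sum_{i\ge1}x_it^i)=\sum_{i\ge0}\sigma_i(\mathbf x)t^i$ (and $\sigma_i=0$ for $i<0$), and the Schur–Weierstrass polynomial $\sigma_\lambda(\mathbf x)=\det(\sigma_{\lambda_i+j-i}(\mathbf x))_{1\le i,j\le m}$ for $\lambda=(\lambda_1,\dots,\lambda_m)$. The tau function of $U$ is $\tau(\mathbf x)=\sum_\lambda\xi_\lambda\sigma_\lambda(\mathbf x)$ (sum over all partitions), well defined up to a nonzero scalar. Point $U$. $H^0(C,L(\infty P_0))=\bigcup_{n\ge0}H^0(C,L(nP_0))$, a space of differentials $f(u)du$, and $\iota(f(u)du)=u^{2-g}f(u)\in V$; the image is a point of the Sato Grassmannian, with frame $\iota(\omega_1),\iota(\omega_2),\dots$ where $\omega_1,\dots,\omega_g$ is a basis of $H^0(C,\omega_C)$ and $\omega_{g+i}=u^{-i-1}du$ for $i\ge1$. *)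

(* Defs.v *)
From mathcomp Require Import all_boot all_order all_algebra.
From mathcomp Require Import all_classical all_reals all_analysis.
From mathcomp Require Import complex.
From mathcomp Require mpoly.
Import (canonicals, coercions) mpoly.

Set Implicit Arguments.
Unset Strict Implicit.
Unset Printing Implicit Defensive.

Import Order.TTheory GRing.Theory Num.Theory.
Local Open Scope classical_set_scope.
Local Open Scope ring_scope.
Local Open Scope complex_scope.

(* The notations of multinomials clash with those of MathComp-Analysis. *)
Notation mpoly_ring C n := (mpoly.mpoly n C).
Notation monomial n := (mpoly.multinom n).

Definition ratfun (R : realType) := {fraction {poly R[i]}}.

Definition ratC (R : realType) (c : R[i]) : ratfun R := tofrac c%:P.

Definition ratX (R : realType) : ratfun R := tofrac 'X.

(* [Some a] is the point u = a, [None] is the point u = oo. *)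
Definition P1 (R : realType) := option R[i].

(* f \o g, for g not constant *)
Definition rcomp (R : realType) (f g : ratfun R) : ratfun R :=
  (map_poly (@ratC R) (repr f).1).[g] / (map_poly (@ratC R) (repr f).2).[g].

(* The coordinate u in terms of the local parameter t at Q: u = a + t at the
   point u = a, and u = 1/t at infinity. *)
Definition chart (R : realType) (Q : P1 R) : ratfun R :=
  if Q is Some a then ratX R + ratC a else (ratX R)^-1.

(* Coefficient of t^n in the Laurent expansion of p/q at t = 0. With
   q = t^v q', q'(0) <> 0 and r = 1 - q'/q'(0), one has t | r and
   p/q = t^(-v) q'(0)^(-1) p (1 + r + r^2 + ...). *)
Definition laurent_frac (R : realType) (p q : {poly R[i]}) (n : int) : R[i] :=
  let v := mup 0 q in
  let q' := q %/ 'X^v in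
  let c := (q'.[0])^-1 in
  match n + v%:Z with
  | Posz N => c * (p * \sum_(k < N.+1) (1 - c *: q') ^+ k)`_N
  | Negz _ => 0
  end.

(* Coefficient of t^n in the expansion of f at Q in the local parameter t. *)
Definition lcoef (R : realType) (Q : P1 R) (f : ratfun R) (n : int) : R[i] :=
  let h := repr (rcomp f (chart Q)) in laurent_frac h.1 h.2 n.

Definition ord_ge (R : realType) (Q : P1 R) (f : ratfun R) (n : int) : Prop :=
  forall k : int, k < n -> lcoef Q f k = 0.

Definition ord_eq (R : realType) (Q : P1 R) (f : ratfun R) (n : int) : Prop :=
  ord_ge Q f n /\ lcoef Q f n <> 0.

Definition regular_at (R : realType) (Q : P1 R) (f : ratfun R) : Prop :=
  ord_ge Q f 0.

(* This is f(Q) when f is regular at Q. *)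
Definition rval (R : realType) (Q : P1 R) (f : ratfun R) : R[i] := lcoef Q f 0.

(* A meromorphic differential on P^1 is f(u)du with f a rational function; it
   is represented by f. At infinity, f(u)du = - f(1/t) t^(-2) dt. *)
Definition residue (R : realType) (Q : P1 R) (f : ratfun R) : R[i] :=
  if Q is Some _ then lcoef Q f (-1) else - lcoef Q f 1.

(* An irreducible reduced projective curve C with normalization
   nu : P^1 -> C, given as in Serre, Groupes algebriques et corps de classes,
   chap. IV, no. 1-3: [stalk P] is the local ring of C at P, as a subring of the
   function field C(u). *)
Record rational_curve (R : realType) := RationalCurve {
  curve_point : Type;
  nu : P1 R -> curve_point;
  stalk : curve_point -> set (ratfun R);
  nu_surj : forall P, exists Q, nu Q = P;
  nu_finite : forall P, finite_set [set Q | nu Q = P];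
  stalkC : forall P c, stalk P (ratC c);
  stalkB : forall P f h, stalk P f -> stalk P h -> stalk P (f - h);
  stalkM : forall P f h, stalk P f -> stalk P h -> stalk P (f * h);
  stalk_regular : forall P f Q, stalk P f -> nu Q = P -> regular_at Q f;
  stalk_local : forall P f Q Q', stalk P f -> nu Q = P -> nu Q' = P ->
    rval Q f = rval Q' f;
  stalk_conductor : forall P, exists n : nat, forall f,
    (forall Q, nu Q = P -> ord_ge Q f n%:Z) -> stalk P f;
  stalk_normal_ae : finite_set [set Q | exists f,
    (forall Q', nu Q' = nu Q -> regular_at Q' f) /\ ~ stalk (nu Q) f]
}.

Section Curve.
Context {R : realType}.
Variable C : rational_curve R.
Implicit Types (P : curve_point C) (Q : P1 R) (f h : ratfun R) (g : nat).

(* A point of a curve is smooth if and only if its local ring is normal, i.e.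
   equal to the ring of the functions regular at all the points over P. *)
Definition smooth P : Prop :=
  forall f, (forall Q, nu C Q = P -> regular_at Q f) -> stalk P f.

Definition unibranch P : Prop :=
  forall Q Q', nu C Q = P -> nu C Q' = P -> Q = Q'.

(* Stalk at P of the dualizing sheaf, in Rosenlicht's description. *)
Definition omega_stalk P : set (ratfun R) :=
  [set f | forall h, stalk P h ->
     \sum_(Q \in [set Q | nu C Q = P]) residue Q (h * f) = 0].

Definition H0omega : set (ratfun R) := [set f | forall P, omega_stalk P f].

(* The dualizing sheaf is invertible. *)
Definition gorenstein : Prop :=
  forall P, exists2 eta, omega_stalk P eta &
    forall f, omega_stalk P f -> exists2 h, stalk P h & f = h * eta.

Definition repartition (r : curve_point C -> ratfun R) : Prop :=
  finite_set [set Q | ~ stalk (nu C Q) (r (nu C Q))].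

(* dim H^1(C, O_C) = g, where H^1(C, O_C) is the quotient of the space of
   repartitions by the sum of the product of the local rings and of the constant
   repartitions (resolution of O_C by C(u) and C(u)/O_C). *)
Definition arithmetic_genus g : Prop :=
  exists2 a : 'I_g -> curve_point C -> ratfun R,
    (forall j, repartition (a j)) &
    forall r, repartition r -> exists! c : {ffun 'I_g -> R[i]},
      exists f, forall P, stalk P (r P - \sum_j ratC (c j) * a j P - f).

Definition value_semigroup Q : set nat :=
  [set n | exists2 f, stalk (nu C Q) f & ord_eq Q f n%:Z].

Definition canonical_basis g (omega : 'I_g -> ratfun R) : Prop :=
  (forall j, H0omega (omega j)) /\
  forall f, H0omega f ->
    exists! c : {ffun 'I_g -> R[i]}, f = \sum_j ratC (c j) * omega j.

(* Sections of omega_C(k P0); here P0 is a smooth point at which u is a local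
   parameter. *)
Definition H0omega_twist P0 (k : int) : set (ratfun R) :=
  [set f | omega_stalk P0 (ratX R ^ k * f) /\
           forall P, P <> P0 -> omega_stalk P f].

(* H^0(C, L(oo P0)) with L = omega_C(-(g-1)P0). *)
Definition H0L_infty P0 g : set (ratfun R) :=
  [set f | exists n : nat, H0omega_twist P0 (n%:Z - (g%:Z - 1)) f].

(* Integral of f(u)du along the segment from 0 to a. *)
Definition abel_integral f (a : R[i]) : R[i] :=
  let F (s : R) := rval (Some (s%:C * a)) f * a in
  Rintegral lebesgue_measure `[0, 1] (fun s => complex.Re (F s)) +i*
  Rintegral lebesgue_measure `[0, 1] (fun s => complex.Im (F s)).

(* Image of C_0^(g-1), C_0 being the smooth locus of C. It is written for the
   base point u = 0 and a curve singular at u = oo, so that all the points of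
   C_0 are at finite distance. *)
Definition abel_image g (omega : 'I_g -> ratfun R) : set ('I_g -> R[i]) :=
  [set z | exists2 a : 'I_(g - 1) -> R[i],
     forall k, smooth (nu C (Some (a k))) &
     forall j, z j = \sum_k abel_integral (omega j) (a k)].

Definition zariski_closure n (S : set ('I_n -> R[i])) : set ('I_n -> R[i]) :=
  [set z | forall p : mpoly_ring R[i] n,
     (forall y, S y -> mpoly.meval y p = 0) -> mpoly.meval z p = 0].

Definition theta_divisor g (omega : 'I_g -> ratfun R) : set ('I_g -> R[i]) :=
  zariski_closure (abel_image omega).

(* This excludes the zero polynomial. *)
Definition reduced n (p : mpoly_ring R[i] n) : Prop :=
  forall q r : mpoly_ring R[i] n, p = q * q * r -> exists c, q = mpoly.mpolyC n c.

Definition theta_function g (omega : 'I_g -> ratfun R)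
    (theta : mpoly_ring R[i] g) : Prop :=
  reduced theta /\
  [set z | mpoly.meval z theta = 0] = theta_divisor omega.

End Curve.

(* Elements of C((u)) are given by their coefficients, as functions int -> C. *)

Definition iota_diff (R : realType) (g : nat) (f : ratfun R) : int -> R[i] :=
  lcoef (Some 0) (ratX R ^ (2%:Z - g%:Z) * f).

(* xi i j is meaningful for j >= 1 only; f_j = sum_i xi_(i,j) u^(i+1). *)
Definition frame_vector (R : realType) (xi : int -> nat -> R[i]) (j : nat) :
  int -> R[i] := fun n => xi (n - 1) j.

Definition frame_comb (R : realType) (xi : int -> nat -> R[i]) (N : nat)
  (c : nat -> R[i]) : int -> R[i] :=
  fun n => \sum_(1 <= j < N) c j * frame_vector xi j n.

Definition is_frame (R : realType) (U : set (int -> R[i]))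
    (xi : int -> nat -> R[i]) : Prop :=
  [/\ U = [set s | exists N c, s = frame_comb xi N c],
      forall N c, (forall n, frame_comb xi N c n = 0) ->
        forall j, (1 <= j < N)%N -> c j = 0 &
      exists l : nat, forall j : nat, (1 <= j)%N ->
        if (l < j)%N
        then xi (- j%:Z) j = 1 /\ (forall i : int, i < - j%:Z -> xi i j = 0)
        else forall i : int, i < - l%:Z -> xi i j = 0].

Definition is_partition (la : seq nat) : Prop := sorted geq la /\ 0%N \notin la.

(* The stable value of det(xi_(m_i, j))_(1 <= i,j <= N) for large N. *)
Definition xi_part (R : realType) (xi : int -> nat -> R[i]) (la : seq nat) :
  R[i] :=
  xget 0 [set v | exists N0 : nat, forall N : nat, (N0 <= N)%N ->
    \det (\matrix_(i < N, j < N) xi ((nth 0%N la i)%:Z - i.+1%:Z) j.+1) = v].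

(* sigma_k(x): coefficient of t^k in exp(sum_(i >= 1) x_i t^i), to which only
   the x_i with i <= k and the powers of exponent <= k contribute. *)
Definition sigma (R : realType) (n : nat) (x : nat -> mpoly_ring R[i] n)
    (k : int) : mpoly_ring R[i] n :=
  match k with
  | Posz k => \sum_(e < k.+1) (e`!%:R^-1 : R[i]) *:
                ((\sum_(1 <= i < k.+1) x i *: 'X^i) ^+ e)`_k
  | Negz _ => 0
  end.

Definition schur_weierstrass (R : realType) (n : nat)
    (x : nat -> mpoly_ring R[i] n) (la : seq nat) : mpoly_ring R[i] n :=
  \det (\matrix_(i < size la, j < size la)
          sigma x ((nth 0%N la i)%:Z + j%:Z - i%:Z)).

(* tau(x) = sum_la xi_la sigma_la(x), as a formal power series: its coefficient
   at each monomial. It is meant for x_i which are distinct variables or 0, so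
   that only finitely many partitions contribute to a coefficient. *)
Definition tau (R : realType) (xi : int -> nat -> R[i]) (n : nat)
    (x : nat -> mpoly_ring R[i] n) (m : monomial n) : R[i] :=
  \sum_(la \in [set la | is_partition la])
     xi_part xi la * mpoly.mcoeff m (schur_weierstrass x la).

Definition gap_vars (R : realType) (g : nat) (w : 'I_g -> nat) (h : nat) :
  mpoly_ring R[i] g :=
  \sum_(j < g | w j == h) mpoly.mpolyX R[i] (mpoly.mnm1 j).

Arguments gap_vars {R g} w h.

Definition cexp (R : realType) (z : R[i]) : R[i] :=
  (expR (complex.Re z) * cos (complex.Im z)) +i*
  (expR (complex.Re z) * sin (complex.Im z)).

(* Main.v *)
(* Put t = 1/u. The local ring at P_oo consists of the series h in t that are
   killed by g functionals W_j(h) = sum_n a_j(n) h_n, where a_j(w_k) = delta_jk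
   and a_j(n) = 0 for n > w_j; dually, omega_j = sum_n a_j(n) u^(n-1) du is a
   basis of the canonical differentials. Let E = exp(sum_j z_j t^(w_j)) and let
   T(z) be the determinant of the g x g matrix W_j(E t^i), 0 <= i < g.

   T is the tau function: passing to another frame multiplies all the xi_la by
   the same nonzero constant; for the frame given by omega_1, ..., omega_g and
   the u^(-k) du, xi_la is a maximal minor of the matrix (a_j(n)), and the
   Cauchy-Binet formula gives sum_la xi_la sigma_la = T up to sign.

   T is the theta function: T(z) = 0 if and only if W(E p) = 0 for a nonzero
   polynomial p(t) of degree < g. If p = prod_k (1 - c_k t), this says that
   the logarithm of E p lies in the completed local ring (closed under exp
   and log), that is, that z is the image of (c_1, ..., c_(g-1)) under the
   Abel map. Hence T vanishes on that image. If z is a zero of T outside of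
   the image, then p_0 = 0, and the minor m without the last row and the
   column i = 0 vanishes at z too. T and m are coprime: at a generic point of
   a common factor Q, let p be in the kernel; as dE/dz_k = t^(w_k) E,
   differentiating W(E p) = 0 yields a nonzero functional omega . W that
   kills all the y E p and all the E t^i with i >= 1; but these elements span
   modulo the common kernel of the W_j, which is a contradiction. So the
   polynomials that vanish on the image are the multiples of T, and as the
   image is parametrized by an affine space, T is reduced. *)

Require Import Defs.
From mathcomp Require Import all_boot all_order all_algebra.
From mathcomp Require Import all_classical all_reals all_analysis.
From mathcomp Require Import complex.
From mathcomp Require mpoly.
Import (canonicals, coercions) mpoly.
From HB Require Import structures.
From mathcomp Require Import perm qfpoly zify ring.

Import Order.TTheory GRing.Theory Num.Theory.
Local Open Scope classical_set_scope.
Local Open Scope ring_scope.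
Local Open Scope complex_scope.

Set Implicit Arguments.
Unset Strict Implicit.
Unset Printing Implicit Defensive.

(** * Functionals defining the local ring *)

(** Divisibility in C[z_1, ..., z_g] is handled one variable at a time, without unique factorization
    or the Nullstellensatz. Two variables serve. The first gap is 1, so z_1 has weight 1 and T has a
    nonzero constant as leading coefficient in z_1: divisibility by T over a fraction field then
    descends to polynomials. In z_g, T is z_g m + r with m and r free of z_g: its zeros with m
    nonzero form a graph, and a polynomial p vanishing there satisfies m^d p = T q; coprimality
    removes m^d. The generic point of a common factor Q is a residue field K[z_1]/Q. Derivations do
    not act on it, since the derivative of Q need not vanish there. This creates an error term, and
    the coprimality argument splits into two cases, which cancel it in two ways. Power series in t
    are replaced by polynomials truncated at t^(w_g), the last coefficient that a functional reads;
    exponentials and logarithms are compared through t e' = t x' e. *)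

Section GapFunctionals.
Variables (F : fieldType) (n : nat) (w : 'I_n.+1 -> nat) (a : 'I_n.+1 -> nat -> F).

(** The functional W_j after extension of scalars along [io]: it is needed over the base field, over
    polynomials in z and over residue fields. *)
Definition gapf (S : comNzRingType) (io : {rmorphism F -> S}) (j : 'I_n.+1)
  (y : {poly S}) : S := \sum_(k < (w j).+1) io (a j k) * y`_k.

(** All that the algebra retains of the local ring: the functionals are in echelon form at the gaps,
    and by [gap_0] and [gap_mul] their common kernel is a ring with unit. *)
Record gap_system : Prop := GapSystem {
  gap_ltn : forall i j : 'I_n.+1, (i < j)%N -> (w i < w j)%N;
  gap_top : forall j k, (w j < k)%N -> a j k = 0;
  gap_delta : forall j k, a j (w k) = (j == k)%:R;
  gap_0 : forall j, a j 0%N = 0;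
  gap_mul : forall y v : {poly F}, (forall j, gapf idfun j y = 0) ->
    (forall j, gapf idfun j v = 0) -> forall j, gapf idfun j (y * v) = 0
}.

Hypothesis gapS : gap_system.

Section Ext.
Variables (S : comNzRingType) (io : {rmorphism F -> S}).
Local Notation W := (gapf io).

Lemma gapfD j : {morph W j : x y / x + y}.
Proof.
by move=> x y; rewrite -big_split; apply: eq_bigr => k _; rewrite coefD mulrDr.
Qed.

Lemma gapfZ j c y : W j (c *: y) = c * W j y.
Proof.
by rewrite mulr_sumr; apply: eq_bigr => k _; rewrite coefZ mulrCA.
Qed.

Lemma gapf0 j : W j 0 = 0.
Proof. by rewrite -(scale0r 0) gapfZ mul0r. Qed.

Lemma gapfN j y : W j (- y) = - W j y.
Proof. by rewrite -scaleN1r gapfZ mulN1r. Qed.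

Lemma gapfB j : {morph W j : x y / x - y}.
Proof. by move=> x y; rewrite gapfD gapfN. Qed.

Lemma gapf_sum j I (r : seq I) (P : pred I) (f : I -> {poly S}) :
  W j (\sum_(i <- r | P i) f i) = \sum_(i <- r | P i) W j (f i).
Proof. exact: (big_morph _ (gapfD j) (gapf0 j)). Qed.

Lemma gapfXn j m : W j 'X^m = io (a j m).
Proof.
rewrite /gapf; have [lt|le] := ltnP (w j) m.
  rewrite (gap_top gapS) // rmorph0 big1 // => k _.
  by rewrite coefXn ltn_eqF ?mulr0 //; have := ltn_ord k; lia.
have lt : (m < (w j).+1)%N by [].
rewrite (bigD1 (Ordinal lt)) //= coefXn eqxx mulr1 big1 ?addr0 // => k /eqP kn.
rewrite coefXn; case: eqP => [e|]; last by rewrite mulr0.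
by case: kn; apply: val_inj.
Qed.

Lemma gapf_eq j (y y' : {poly S}) :
  (forall k, (k <= w j)%N -> y`_k = y'`_k) -> W j y = W j y'.
Proof. by move=> e; apply: eq_bigr => k _; rewrite e // -ltnS. Qed.

Lemma gapf_order j (y : {poly S}) :
  (forall k, (k <= w j)%N -> y`_k = 0) -> W j y = 0.
Proof. by move=> e; rewrite -(gapf0 j); apply: gapf_eq => k /e ->; rewrite coef0. Qed.

Lemma gapf_coef j (y : {poly S}) : W j y = \sum_(m < size y) y`_m * io (a j m).
Proof.
rewrite -[in LHS](coefK y) poly_def gapf_sum; apply: eq_bigr => m _.
by rewrite gapfZ gapfXn.
Qed.

(** Projection of t^m to the common kernel along the span of the t^(w_i). *)
Definition gapproj m : {poly F} := 'X^m - \sum_i a i m *: 'X^(w i).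

End Ext.

Lemma gapf_gapproj j m : gapf idfun j (gapproj m) = 0.
Proof.
rewrite gapfB gapfXn gapf_sum (bigD1 j) //= gapfZ gapfXn (gap_delta gapS) eqxx.
rewrite mulr1 big1 ?addr0 ?subrr // => i ij; rewrite gapfZ gapfXn.
by rewrite (gap_delta gapS) eq_sym (negPf ij) /= mulr0.
Qed.

Lemma gapf_map (S S' : comNzRingType) (io : {rmorphism F -> S})
    (f : {rmorphism S -> S'}) j y :
  f (gapf io j y) = gapf (f \o io) j (map_poly f y).
Proof.
by rewrite rmorph_sum; apply: eq_bigr => k _; rewrite rmorphM coef_map.
Qed.

Section Ext2.
Variables (S : comNzRingType) (io : {rmorphism F -> S}).
Local Notation W := (gapf io).

Lemma gapf_mapF j (y : {poly F}) : W j (map_poly io y) = io (gapf idfun j y).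
Proof. by rewrite rmorph_sum; apply: eq_bigr => k _; rewrite rmorphM coef_map. Qed.

(** The kernel over S is spanned by elements defined over F, so that closure under products passes
    from F to S by bilinearity. *)
Lemma gap_kerE (y : {poly S}) : (forall j, W j y = 0) ->
  y = \sum_(m < size y) y`_m *: map_poly io (gapproj m).
Proof.
move=> y0; transitivity (y - \sum_i W i y *: 'X^(w i)).
  by rewrite big1 ?subr0 // => i _; rewrite y0 scale0r.
rewrite [in LHS](eq_bigr (fun i => \sum_(m < size y)
  y`_m *: (io (a i m) *: 'X^(w i)))); last first.
  move=> i _; rewrite gapf_coef scaler_suml; apply: eq_bigr => m _.
  by rewrite scalerA.
rewrite exchange_big /= -[in X in X - _](coefK y) poly_def -sumrB.
apply: eq_bigr => m _; rewrite -scaler_sumr -scalerBr rmorphB /= map_polyXn.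
rewrite rmorph_sum; congr (_ *: (_ - _)); apply: eq_bigr => i _.
by rewrite /= map_polyZ map_polyXn.
Qed.

Lemma gapf_mul (y v : {poly S}) : (forall j, W j y = 0) ->
  (forall j, W j v = 0) -> forall j, W j (y * v) = 0.
Proof.
move=> /gap_kerE -> /gap_kerE -> j; rewrite mulr_suml gapf_sum big1 // => m _.
rewrite mulr_sumr gapf_sum big1 // => l _.
rewrite -scalerAl -scalerAr !gapfZ -rmorphM gapf_mapF.
rewrite (gap_mul gapS) ?rmorph0 ?mulr0 // => i; exact: gapf_gapproj.
Qed.

Definition gapres (y : {poly S}) : {poly S} := y - \sum_i W i y *: 'X^(w i).

Lemma gapf_gapres y j : W j (gapres y) = 0.
Proof.
rewrite gapfB gapf_sum (bigD1 j) //= gapfZ gapfXn (gap_delta gapS) eqxx.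
rewrite rmorph1 mulr1 big1 ?addr0 ?subrr // => i ij; rewrite gapfZ gapfXn.
by rewrite (gap_delta gapS) eq_sym (negPf ij) /= rmorph0 mulr0.
Qed.

(** Modulo the kernel, v is the combination of the t^(w_i) with coefficients W_i(v), and y times the
    kernel stays in the kernel. *)
Lemma gapf_mull (y v : {poly S}) j : (forall i, W i y = 0) ->
  W j (y * v) = \sum_i W i v * W j (y * 'X^(w i)).
Proof.
move=> y0; transitivity (W j (y * (gapres v + \sum_i W i v *: 'X^(w i)))).
  by rewrite subrK.
rewrite mulrDr gapfD gapf_mul ?add0r //; last exact: gapf_gapres.
rewrite mulr_sumr gapf_sum; apply: eq_bigr => i _.
by rewrite -scalerAr gapfZ.
Qed.

Lemma gapf_Xgt (y : {poly S}) (i j : 'I_n.+1) : (j < i)%N -> W j (y * 'X^(w i)) = 0.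
Proof.
move=> /(gap_ltn gapS) ji; apply: gapf_order => k kj.
by rewrite coefMXn (leq_ltn_trans kj ji).
Qed.

End Ext2.

Section Key.
Variables (L : fieldType) (io : {rmorphism F -> L}).
Local Notation W := (gapf io).
Variables (E p : {poly L}) (r : nat) (om : 'I_n.+1 -> L).
Hypotheses (E0 : E`_0 = 1) (p_neq0 : p != 0) (p_size : (size p <= n.+1)%N).
Hypothesis Wv : forall j : 'I_n.+1, (j < r)%N -> W j (E * p) = 0.
Hypothesis om_hi : forall j : 'I_n.+1, (r <= j)%N -> om j = 0.
Hypothesis omE : forall i, (1 <= i < n.+1)%N -> \sum_j om j * W j (E * 'X^i) = 0.
Hypothesis omv : forall k, \sum_j om j * W j ('X^(w k) * (E * p)) = 0.

Let Phi (y : {poly L}) := \sum_j om j * W j y.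

Let PhiD y z : Phi (y + z) = Phi y + Phi z.
Proof.
by rewrite -big_split; apply: eq_bigr => j _; rewrite gapfD mulrDr.
Qed.

Let PhiZ c y : Phi (c *: y) = c * Phi y.
Proof.
by rewrite mulr_sumr; apply: eq_bigr => j _; rewrite gapfZ mulrCA.
Qed.

Let Phi_sum (I : finType) (f : I -> {poly L}) :
  Phi (\sum_i f i) = \sum_i Phi (f i).
Proof.
apply: (big_morph Phi PhiD); by rewrite -(scale0r 0) PhiZ mul0r.
Qed.

(** Split y into a kernel element and a combination of the t^(w_k), on which [omv] applies. For the
    kernel element, [gapf_mull] leaves terms with W_i(E p), zero for i < r, and terms with t^(w_i),
    i >= r, which W_j does not see for j < r. *)
Lemma gap_functional_mul y : Phi (y * (E * p)) = 0.
Proof.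
rewrite -[y](subrK (\sum_i W i y *: 'X^(w i))) mulrDl PhiD.
rewrite [X in _ + Phi X]mulr_suml Phi_sum [X in _ + X]big1 ?addr0; last first.
  by move=> i _; rewrite -scalerAl PhiZ [Phi _]omv mulr0.
rewrite /Phi big1 // => j _; have [/om_hi->|jr] := leqP r j; first by rewrite mul0r.
rewrite gapf_mull; last exact: gapf_gapres.
rewrite big1 ?mulr0 // => i _; have [ir|ri] := ltnP i r.
  by rewrite Wv // mul0r.
by rewrite gapf_Xgt ?mulr0 // (leq_trans jr ri).
Qed.

(** For every order k, some element with leading term t^k is killed by [Phi]: with m the order of p,
    it is 1 for k = 0 < m, E t^k for 0 < k < m, and a multiple of t^(k-m) E p for k >= m. Hence
    [Phi] vanishes everywhere, in particular on t^(w_j), where it is [om j]. *)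
Lemma gap_functional_eq0 j : om j = 0.
Proof.
have [m [pm0 pm]] : exists m, p`_m != 0 /\ forall i, (i < m)%N -> p`_i = 0.
  have ex : exists m, p`_m != 0 by exists (size p).-1; rewrite -lead_coefE lead_coef_eq0.
  exists (ex_minn ex); case: ex_minnP => m pm mn; split=> // i im.
  by apply/eqP; apply/negP => /negP /mn; rewrite leqNgt im.
have mn : (m < n.+1)%N.
  by rewrite (leq_trans _ p_size) // ltnNge; apply: contra pm0 => /leq_sizeP ->.
have vm i : (i < m)%N -> (E * p)`_i = 0.
  move=> im; rewrite coefM big1 // => k _; rewrite pm ?mulr0 //.
  by rewrite (leq_ltn_trans _ im) // leq_subr.
have vmm : (E * p)`_m = p`_m.
  rewrite coefM big_ord_recl /= subn0 E0 mul1r big1 ?addr0 // => k _.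
  by rewrite pm ?mulr0 // /bump; have := ltn_ord k; lia.
(* Descending induction on the order k, starting just above the largest gap, where every functional
   is zero. *)
have main c : forall k, (k + c = (w ord_max).+1)%N ->
    forall y : {poly L}, (forall i, (i < k)%N -> y`_i = 0) -> Phi y = 0.
  elim: c => [k kN y y0|c IH k kc y y0].
    rewrite /Phi big1 // => i _; rewrite gapf_order ?mulr0 // => l li.
    rewrite y0 //; have [ei|ni] := eqVneq i ord_max; first by rewrite ei in li; lia.
    have im : (i < (ord_max : 'I_n.+1))%N.
      by rewrite ltn_neqAle ni /= -ltnS ltn_ord.
    by have := gap_ltn gapS im; lia.
  suff [b b0 [bk bL]] : exists2 b : {poly L}, Phi b = 0 &
      b`_k = 1 /\ forall i, (i < k)%N -> b`_i = 0.
    rewrite -[y](subrK (y`_k *: b)) PhiD PhiZ b0 mulr0 addr0.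
    apply: (IH k.+1) => [|i]; first by lia.
    rewrite ltnS leq_eqVlt coefB coefZ => /orP[/eqP->|ik].
      by rewrite bk mulr1 subrr.
    by rewrite (y0 i) // (bL i) // mulr0 subr0.
  have [km|mk] := ltnP k m.
    case: k km {kc y0} => [|k] km.
      exists 1; first by rewrite /Phi big1 // => i _;
        rewrite -(expr0 'X) gapfXn (gap_0 gapS) rmorph0 mulr0.
      by split=> //; rewrite coef1.
    exists (E * 'X^(k.+1)); first by rewrite [Phi _]omE //; lia.
    split=> [|i ik]; rewrite coefMXn ?ltnn ?subnn ?E0 //.
    by rewrite ik.
  exists ((p`_m)^-1 *: ('X^(k - m) * (E * p))).
    by rewrite PhiZ gap_functional_mul mulr0.
  split=> [|i ik]; rewrite coefZ coefXnM.
    by rewrite ltnNge leq_subr /= subKn // vmm mulVf.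
  case: ltnP => [|le]; first by rewrite mulr0.
  by rewrite vm ?mulr0 //; lia.
have : Phi 'X^(w j) = 0 by apply: (main _ 0%N (add0n _)).
rewrite /Phi (bigD1 j) //= gapfXn (gap_delta gapS) eqxx rmorph1 mulr1.
rewrite big1 ?addr0 // => i ij.
by rewrite gapfXn (gap_delta gapS) (negPf ij) /= rmorph0 mulr0.
Qed.

End Key.
End GapFunctionals.

Lemma coefM_eq_low (S : nzSemiRingType) (x x' y : {poly S}) N :
  (forall i, (i <= N)%N -> x`_i = x'`_i) ->
  forall i, (i <= N)%N -> (x * y)`_i = (x' * y)`_i.
Proof.
move=> e i iN; rewrite !coefM; apply: eq_bigr => k _; rewrite e //.
by rewrite (leq_trans _ iN) // -ltnS.
Qed.

Lemma coef_shift (S : nzRingType) (s : nat -> S) N m i : (i < N)%N ->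
  ('X^m * \poly_(k < N) s k)`_i = if (m <= i)%N then s (i - m)%N else 0.
Proof.
move=> iN; rewrite coefXnM coef_poly; case: ltnP => // mi.
by rewrite (leq_ltn_trans (leq_subr _ _)).
Qed.

(** * The determinant of the functionals modulo a common factor with its minor *)

Section GapDeterminant.
Variables (F : fieldType) (n : nat) (w : 'I_n.+1 -> nat) (a : 'I_n.+1 -> nat -> F).

Definition gexp (S : nzRingType) (s : nat -> S) : {poly S} :=
  \poly_(k < (w ord_max).+1) s k.

Definition gapmx (S : comNzRingType) (io : {rmorphism F -> S}) (E : {poly S}) :
  'M[S]_n.+1 := \matrix_(j, i) gapf w a io j (E * 'X^i).

Lemma gapmx_map (S S' : comNzRingType) (io : {rmorphism F -> S})
    (f : {rmorphism S -> S'}) (E : {poly S}) :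
  map_mx f (gapmx io E) = gapmx (f \o io) (map_poly f E).
Proof.
by apply/matrixP => j i; rewrite !mxE gapf_map rmorphM /= map_polyXn.
Qed.

Lemma gexp_map (S S' : comNzRingType) (f : {rmorphism S -> S'}) (s : nat -> S) :
  map_poly f (gexp s) = gexp (f \o s).
Proof.
apply/polyP => i; rewrite coef_map !coef_poly /=; case: ifP => // _.
exact: rmorph0.
Qed.

Lemma det_gapmx_map (S S' : comNzRingType) (io : {rmorphism F -> S})
    (f : {rmorphism S -> S'}) (s : nat -> S) :
  f (\det (gapmx io (gexp s))) = \det (gapmx (f \o io) (gexp (f \o s))).
Proof. by rewrite -det_map_mx gapmx_map gexp_map. Qed.

Lemma cofactor_gapmx_map (S S' : comNzRingType) (io : {rmorphism F -> S})
    (f : {rmorphism S -> S'}) (s : nat -> S) i j :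
  f (cofactor (gapmx io (gexp s)) i j) =
  cofactor (gapmx (f \o io) (gexp (f \o s))) i j.
Proof. by rewrite -cofactor_map_mx gapmx_map gexp_map. Qed.

Lemma gapf_rVpoly (S : comNzRingType) (io : {rmorphism F -> S}) (E : {poly S})
    j (p : {poly S}) : (size p <= n.+1)%N ->
  gapf w a io j (E * p) = \sum_(i < n.+1) p`_i * gapmx io E j i.
Proof.
move=> sp; rewrite -[in LHS](coefK p) (poly_def (size p)) mulr_sumr gapf_sum.
rewrite (big_ord_widen _ (fun i => gapf w a io j (E * (p`_i *: 'X^i))) sp).
rewrite [LHS]big_mkcond; apply: eq_bigr => i _ /=; rewrite mxE.
case: ifP => [_|/negbT]; first by rewrite -scalerAr gapfZ.
by rewrite -leqNgt => /leq_sizeP ->; rewrite // mul0r.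
Qed.

Hypothesis gapS : gap_system w a.

Lemma gap_ltn_max (j : 'I_n.+1) : (w j <= w ord_max)%N.
Proof.
have [->//|ni] := eqVneq j ord_max.
by apply/ltnW/(gap_ltn gapS); rewrite ltn_neqAle ni /= -ltnS ltn_ord.
Qed.

Section Coprime.
Variables (S : comNzRingType) (L : fieldType).
Variables (io : {rmorphism F -> S}) (f : {rmorphism S -> L}) (Q : S).
Variables (D : 'I_n.+1 -> {additive S -> S}) (s : nat -> S).
Hypothesis f_frac : forall l : L, exists x c, f c != 0 /\ f x = f c * l.
Hypothesis fQ : f Q = 0.
Hypothesis f_ker : forall x, f x = 0 -> exists c h, f c != 0 /\ c * x = Q * h.
Hypothesis DM : forall k x y, D k (x * y) = D k x * y + x * D k y.
Hypothesis DC : forall k c, D k (io c) = 0.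
Hypothesis s0 : s 0%N = 1.
Hypothesis Ds : forall k i, D k (s i) = if (w k <= i)%N then s (i - w k)%N else 0.

Let E := gexp s.
Let io' : {rmorphism F -> L} := f \o io.
Let E' := map_poly f E.
Local Notation W := (gapf w a io).
Local Notation W' := (gapf w a io').

Let E'0 : E'`_0 = 1.
Proof. by rewrite coef_map coef_poly /= s0 rmorph1. Qed.

(** By [f_frac] and [f_ker], L behaves as the residue field of S at Q. Derivations act on S only,
    hence the lift; zero coefficients must stay zero because the condition p_0 = 0 is used after
    differentiation. *)
Lemma poly_lift (p : {poly L}) m : (size p <= m)%N -> exists (pt : {poly S}) c,
  [/\ f c != 0, map_poly f pt = f c *: p, (size pt <= m)%N &
      forall i, p`_i = 0 -> pt`_i = 0].
Proof.
have [c [gt [fc gtP]]] : exists c (gt : nat -> S), f c != 0 /\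
    forall i, (i < m)%N -> f (gt i) = f c * p`_i /\ (p`_i = 0 -> gt i = 0).
  elim: m => [|m [c [gt [fc gtP]]]].
    by exists 1, (fun=> 0); rewrite rmorph1 oner_neq0.
  have [x [d [fd xE]]] := f_frac p`_m.
  exists (c * d), (fun i => if i == m then (if p`_m == 0 then 0 else c * x) else d * gt i).
  split=> [|i]; first by rewrite rmorphM mulf_neq0.
  rewrite ltnS leq_eqVlt; case: eqP => [-> _|_ /= /gtP[e e0]].
    case: eqP => [->|//]; first by rewrite rmorph0 mulr0.
    by rewrite !rmorphM xE mulrA.
  rewrite !rmorphM e; split=> [|/e0 ->]; last by rewrite mulr0.
  by rewrite mulrA [f d * _]mulrC.
move=> sp; exists (\poly_(i < m) gt i), c; split=> [//|||i pi].
- apply/polyP => i; rewrite coef_map coef_poly coefZ /=.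
  by case: ltnP => [/gtP[]//|mi]; rewrite rmorph0 (leq_sizeP p m sp) ?mulr0.
- exact: size_poly.
by rewrite coef_poly; case: ltnP => // /gtP[_ ->].
Qed.

Lemma deriv_gapf k j (y : {poly S}) : D k (W j y) = W j (map_poly (D k) y).
Proof.
rewrite raddf_sum; apply: eq_bigr => i _; rewrite DM DC mul0r add0r.
by rewrite coef_map_id0 ?raddf0.
Qed.

Lemma deriv_polyM k (x y : {poly S}) :
  map_poly (D k) (x * y) = map_poly (D k) x * y + x * map_poly (D k) y.
Proof.
apply/polyP => i; rewrite coefD coef_map_id0 ?raddf0 // !coefM raddf_sum.
rewrite -big_split; apply: eq_bigr => l _ /=.
by rewrite DM !coef_map_id0 ?raddf0.
Qed.

(** [D k] multiplies E by t^(w_k) only up to the truncation degree, but W_j reads no further. *)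
Lemma deriv_gapf_exp k j (y : {poly S}) :
  D k (W j (E * y)) = W j ('X^(w k) * (E * y)) + W j (E * map_poly (D k) y).
Proof.
rewrite deriv_gapf deriv_polyM gapfD; congr (_ + _); rewrite mulrA.
apply: gapf_eq => i ij; apply: (coefM_eq_low _ (N := w ord_max)); last first.
  exact: leq_trans ij (gap_ltn_max _).
move=> {ij}i ij; rewrite coef_shift // coef_map_id0 ?raddf0 // coef_poly.
by rewrite ltnS ij Ds.
Qed.

(* Differentiating W(E p) = 0 modulo Q: the right-hand side is a multiple, by
   the derivative of Q, of a vector that does not depend on the derivation. *)
Lemma kernel_derivative (p : {poly L}) r : (size p <= n.+1)%N ->
    (forall j : 'I_n.+1, (j < r)%N -> W' j (E' * p) = 0) ->
  exists (h : 'I_n.+1 -> L) (d : 'I_n.+1 -> {poly L}),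
    (forall k, (size (d k) <= n.+1)%N /\ forall i, p`_i = 0 -> (d k)`_i = 0) /\
    forall k (j : 'I_n.+1), (j < r)%N ->
      W' j ('X^(w k) * (E' * p)) = f (D k Q) * h j - W' j (E' * d k).
Proof.
move=> sp Wp; have [pt [c [fc ptE spt pt0]]] := poly_lift sp.
have fW j y : f (W j y) = W' j (map_poly f y) by rewrite gapf_map.
have ex (j : 'I_n.+1) : exists chj : S * S, (j < r)%N ->
    f chj.1 != 0 /\ chj.1 * W j (E * pt) = Q * chj.2.
  have [jr|_] := boolP (j < r)%N; last by exists (0, 0).
  have [|c' [h' [h1 h2]]] := f_ker (x := W j (E * pt)).
    rewrite fW rmorphM /= ptE -scalerAr gapfZ Wp //; exact: mulr0.
  by exists (c', h').
have /choice[ch chP] := ex.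
exists (fun j => f (ch j).2 / f (ch j).1 / f c).
exists (fun k => (f c)^-1 *: map_poly f (map_poly (D k) pt)); split=> [k|k j jr].
  split=> [|i pi]; last first.
    by rewrite coefZ coef_map coef_map_id0 ?raddf0 //= pt0 // raddf0 rmorph0 mulr0.
  rewrite (leq_trans (size_scale_leq _ _)) //.
  exact: leq_trans (size_poly _ _) (leq_trans (size_poly _ _) spt).
have [c0 cE] := chP j jr.
(* In L both Q and W_j(E pt) are zero, so each side keeps a single term of the product rule. *)
have := congr1 (f \o D k) cE; rewrite /= !DM !rmorphD !rmorphM /= fQ mul0r addr0.
rewrite fW rmorphM /= ptE -scalerAr gapfZ Wp // mulr0 mulr0 add0r.
rewrite deriv_gapf_exp rmorphD !fW !rmorphM /= ptE map_polyXn -/E'.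
rewrite -2!scalerAr gapfZ -/io' => e.
rewrite -scalerAr [X in _ - X]gapfZ; apply: (mulfI fc).
apply: (mulfI c0); rewrite !mulrBr [X in _ - _ * X]mulrA mulfV // mul1r.
apply/eqP; rewrite eq_sym subr_eq -mulrDr; apply/eqP.
by rewrite e; field; rewrite fc c0.
Qed.

(** If a kernel vector p has p_0 = 0, the error term h can take the place of column 0 of the matrix.
    Otherwise the vanishing minor provides a second vector p', annihilated by all functionals but
    the last, and a combination of p and p' has no error term. *)
Lemma gapmx_coprime : f (\det (gapmx io E)) = 0 ->
  f (cofactor (gapmx io E) ord_max ord0) = 0 -> False.
Proof.
rewrite -det_map_mx -cofactor_map_mx gapmx_map -/io' -/E'.
set M := gapmx io' E' => /eqP detM cofM.
have WE j i : (i < n.+1)%N -> W' j (E' * 'X^i) = M j (inord i).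
  by move=> ig; rewrite mxE inordK.
have Wp j (p : {poly L}) : (size p <= n.+1)%N ->
    W' j (E' * p) = \sum_(i < n.+1) p`_i * M j i := @gapf_rVpoly _ _ _ j p.
have kerp (A : 'M[L]_n.+1) : \det A == 0 -> exists2 p : {poly L}, p != 0 &
    (size p <= n.+1)%N /\ forall j, \sum_(i < n.+1) p`_i * A j i = 0.
  rewrite -det_tr => /det0P[v v0 vA]; exists (rVpoly v).
    by apply: contra v0 => /eqP e; rewrite -[v]rVpolyK e raddf0.
  split=> [|j]; first exact: size_poly.
  have := congr1 (fun B : 'rV_n.+1 => B 0 j) vA; rewrite !mxE => eA; rewrite -[RHS]eA.
  by apply: eq_bigr => i _; rewrite coef_rVpoly_ord mxE.
pose ker0 (p : {poly L}) r := [/\ p != 0, (size p <= n.+1)%N, p`_0 = 0 &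
  forall j : 'I_n.+1, (j < r)%N -> W' j (E' * p) = 0].
have [[p [p0 sp pz Wp0]]|noA] := pselect (exists p, ker0 p n.+1).
  have [h [d [dP hP]]] := kernel_derivative sp Wp0.
  (* As p_0 = 0, p remains in the kernel after column 0 is replaced by [h]. A left kernel vector of
     [A] thus kills [h] as well as the columns i >= 1. *)
  pose A := \matrix_(j, i) if i == ord0 then h j else M j i.
  have : \det A == 0.
    rewrite -det_tr; apply/det0P; exists (poly_rV p).
      by apply: contra p0 => /eqP e; rewrite -(poly_rV_K sp) e raddf0.
    apply/rowP => j; rewrite !mxE -[RHS](Wp0 j) // Wp //; apply: eq_bigr => i _.
    by rewrite !mxE; case: eqP => [->|//]; rewrite pz !mul0r.
  case/det0P => om om0 omA; case/eqP: om0; apply/rowP => j; rewrite mxE.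
  have omAi i : \sum_j om 0 j * A j i = 0.
    by have := congr1 (fun B : 'rV_n.+1 => B 0 i) omA; rewrite !mxE.
  apply: (gap_functional_eq0 gapS (io := io') (E := E') (p := p) (r := n.+1)
    (om := om 0)) => //.
  - by move=> i; have := ltn_ord i; lia.
  - move=> i /andP[i0 ig]; rewrite -[RHS](omAi (inord i)).
    apply: eq_bigr => l _; rewrite WE // [A _ _]mxE; case: eqP => // e.
    by move: i0; rewrite -(inordK ig) e.
  - move=> k; under eq_bigr => l _ do rewrite hP // mulrBr.
    rewrite big_split /= sumrN [X in X - _](_ : _ = f (D k Q) * \sum_j om 0 j * A j ord0).
      rewrite omAi mulr0 add0r; apply/eqP; rewrite oppr_eq0; apply/eqP.
      have [sd d0] := dP k; under eq_bigr => l _ do rewrite Wp // mulr_sumr.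
      rewrite exchange_big big1 //= => i _.
      have [->|ni] := eqVneq i ord0; first by rewrite big1 // => l _; rewrite d0 // mul0r mulr0.
      under eq_bigr => l _ do rewrite mulrCA.
      rewrite -mulr_sumr [X in _ * X](_ : _ = \sum_j om 0 j * A j i).
        by rewrite omAi mulr0.
      by apply: eq_bigr => l _; rewrite [A _ _]mxE (negPf ni).
    by rewrite mulr_sumr; apply: eq_bigr => l _; rewrite mxE eqxx mulrCA.
have [p p0 [sp pM]] := kerp _ detM.
have Wp0 (j : 'I_n.+1) : W' j (E' * p) = 0 by rewrite Wp.
have pz : p`_0 != 0 by apply/eqP => pz; apply: noA; exists p; split.
pose B := row' ord_max (col' ord0 M).
have detB : \det B == 0.
  by move/eqP: cofM; rewrite /cofactor mulf_eq0 signr_eq0.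
have [p' [p'0 sp' p'z Wp']] : exists p', ker0 p' n.
  move: (detB); rewrite -det_tr => /det0P[v v0 vB].
  exists (rVpoly v * 'X); split.
  - rewrite mulf_neq0 ?polyX_eq0 //.
    by apply: contra v0 => /eqP e; rewrite -[v]rVpolyK e raddf0.
  - rewrite (leq_trans (size_polyMleq _ _)) // size_polyX addn2 /= ltnS.
    exact: size_poly.
  - by rewrite coefMX.
  move=> j jn; rewrite Wp; last first.
    rewrite (leq_trans (size_polyMleq _ _)) // size_polyX addn2 /= ltnS.
    exact: size_poly.
  have jE : j = lift ord_max (Ordinal jn).
    by apply: val_inj; rewrite /= /bump leqNgt jn.
  rewrite big_ord_recl coefMX /= mul0r add0r.
  have := congr1 (fun B : 'rV_n => B 0 (Ordinal jn)) vB; rewrite !mxE => eA; rewrite -[RHS]eA.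
  apply: eq_bigr => i _; rewrite coefMX /= coef_rVpoly_ord !mxE /= -jE.
  by congr (_ * W' _ (_ * 'X^_)).
have [u u0 uB] := det0P detB.
(* A left kernel vector of the minor, extended by 0 in the last row. It kills the columns i >= 1 by
   construction, and column 0 because M p = 0 and p_0 is invertible. *)
pose om j := if unlift ord_max j is Some i then u 0 i else 0.
have om_hi (j : 'I_n.+1) : (n <= j)%N -> om j = 0.
  rewrite /om; case: unliftP => [i ->|//].
  by rewrite /= /bump (leqNgt n i) ltn_ord add0n leqNgt ltn_ord.
have omM1 i : i != ord0 -> \sum_j om j * M j i = 0.
  move=> i0; have [i' iE|//] := unliftP ord0 i; last by move=> e; rewrite e eqxx in i0.
  rewrite (bigD1 ord_max) //= om_hi // mul0r add0r.
  rewrite (reindex_onto (lift ord_max) (fun j => odflt i' (unlift ord_max j))); last first.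
    by move=> j; case: unliftP => [j' ->|->] //; rewrite eqxx.
  have := congr1 (fun B : 'rV_n => B 0 i') uB; rewrite !mxE => eA; rewrite -[RHS]eA.
  apply: eq_big => [j|j _]; first by rewrite eq_sym neq_lift liftK eqxx.
  by rewrite /om liftK iE !mxE.
have omM i : \sum_j om j * M j i = 0.
  have [->|/omM1//] := eqVneq i ord0.
  apply: (mulfI pz); rewrite mulr0.
  transitivity (\sum_(i < n.+1) p`_i * \sum_j om j * M j i).
    rewrite [RHS]big_ord_recl /= [X in _ = _ + X]big1 ?addr0 // => l _.
    by rewrite omM1 ?mulr0.
  under eq_bigr => l _ do rewrite mulr_sumr.
  rewrite exchange_big big1 //= => j _; under eq_bigr => l _ do rewrite mulrCA.
  by rewrite -mulr_sumr pM mulr0.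
have om_nz : exists j, om j != 0.
  have /rV0Pn[i ui] := u0.
  by exists (lift ord_max i); rewrite /om liftK.
have omd (d : {poly L}) : (size d <= n.+1)%N -> \sum_j om j * W' j (E' * d) = 0.
  move=> sd; under eq_bigr => j _ do rewrite Wp // mulr_sumr.
  rewrite exchange_big big1 //= => i _; under eq_bigr => l _ do rewrite mulrCA.
  by rewrite -mulr_sumr omM mulr0.
(* For q = p and q = p', the obstruction depends on k only through the common factor [f (D k Q)]. *)
have dlin (q : {poly L}) : (size q <= n.+1)%N ->
    (forall j : 'I_n.+1, (j < n)%N -> W' j (E' * q) = 0) ->
    exists ka, forall k, \sum_j om j * W' j ('X^(w k) * (E' * q)) = f (D k Q) * ka.
  move=> sq Wq; have [h [d [dP hP]]] := kernel_derivative sq Wq.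
  exists (\sum_j om j * h j) => k; rewrite mulr_sumr.
  rewrite -[RHS]subr0 -[in X in _ - X](omd (d k)) ?(dP k).1 // -sumrB.
  apply: eq_bigr => j _; have [jn|/om_hi->] := ltnP j n; last by rewrite !mul0r mulr0 subr0.
  by rewrite hP // mulrBr mulrCA.
have fin (q : {poly L}) : q != 0 -> (size q <= n.+1)%N ->
    (forall j : 'I_n.+1, (j < n)%N -> W' j (E' * q) = 0) ->
    (forall k, \sum_j om j * W' j ('X^(w k) * (E' * q)) = 0) -> False.
  move=> q0 sq Wq kq; have [j /eqP[]] := om_nz.
  apply: (gap_functional_eq0 gapS (io := io') (E := E') (p := q) (r := n)) => //.
  move=> i /andP[i0 ig]; rewrite -[RHS](omM (inord i)).
  by apply: eq_bigr => l _; rewrite WE.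
have Wp0n (j : 'I_n.+1) : (j < n)%N -> W' j (E' * p) = 0 by [].
have [ka kaP] := dlin p sp Wp0n.
have [ka' ka'P] := dlin p' sp' Wp'.
have [e|ka'0] := eqVneq ka' 0.
  by apply: (fin p') => // k; rewrite ka'P e mulr0.
(* The two obstructions cancel, and the constant coefficient ka' p_0 shows that the combination is
   nonzero. *)
apply: (fin (ka' *: p - ka *: p')).
- apply: contra pz => /eqP/(congr1 (fun q : {poly L} => q`_0)).
  rewrite coefB !coefZ p'z mulr0 subr0 coef0 => /eqP.
  by rewrite mulf_eq0 (negPf ka'0).
- rewrite (leq_trans (size_polyD _ _)) // size_polyN geq_max.
  by rewrite !(leq_trans (size_scale_leq _ _)).
- move=> j jn; rewrite mulrBr -!scalerAr gapfB !gapfZ Wp0 Wp' //.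
  by rewrite !mulr0 subr0.
move=> k; transitivity (ka' * (f (D k Q) * ka) - ka * (f (D k Q) * ka')).
  rewrite -kaP -ka'P !mulr_sumr -sumrB; apply: eq_bigr => j _.
  rewrite mulrBr -!scalerAr mulrBr -!scalerAr gapfB !gapfZ mulrBr.
  by rewrite [om j * (ka' * _)]mulrCA [om j * (ka * _)]mulrCA.
by rewrite mulrCA [ka * (_ * _)]mulrCA [ka * ka']mulrC subrr.
Qed.

End Coprime.
End GapDeterminant.

(** * Polynomials in several variables *)

Section MpolyVariables.
Variables (F : numFieldType) (n : nat).
Local Notation P := (mpoly_ring F n).
Local Notation mX i := (mpoly.mpolyX F (mpoly.mnm1 i) : P).
Local Notation mC := (@mpoly.mpolyC n F : F -> P).

Lemma mpoly_rmorph_eq (S : comNzRingType) (f g : {rmorphism P -> S}) :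
  (forall c, f (mC c) = g (mC c)) -> (forall i, f (mX i) = g (mX i)) -> f =1 g.
Proof.
move=> eC eX p; rewrite (mpoly.mpolyE p) !rmorph_sum; apply: eq_bigr => m _.
rewrite -mpoly.mul_mpolyC !rmorphM /= eC mpoly.mpolyXE_id !rmorph_prod.
by congr (_ * _); apply: eq_bigr => i _; rewrite !rmorphXn /= eX.
Qed.

(** The polynomial seen in the variable z_k. The coefficients stay in the same ring P, although z_k
    no longer occurs in them, so that no renumbering of variables is needed. *)
Definition split_var (k : 'I_n) : P -> {poly P} :=
  mpoly.mmap (polyC \o mC) (fun i => if i == k then 'X else (mX i)%:P).

HB.instance Definition _ k := GRing.RMorphism.copy (split_var k) (split_var k).

Lemma split_varC k c : split_var k (mC c) = (mC c)%:P.
Proof. exact: (mpoly.mmapC _ (polyC \o mC)). Qed.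

Lemma split_varX k i : split_var k (mX i) = if i == k then 'X else (mX i)%:P.
Proof. by rewrite /split_var mpoly.mmapX mpoly.mmap1U. Qed.

Definition upd_coord (z : 'I_n -> F) (k : 'I_n) (s : F) : 'I_n -> F :=
  fun i => if i == k then s else z i.

Lemma horner_split_var k p : (split_var k p).[mX k] = p.
Proof.
apply: (mpoly_rmorph_eq (f := horner_eval (mX k) \o split_var k) (g := idfun)).
  by move=> c; rewrite /= split_varC horner_evalE hornerC.
move=> i; rewrite /= split_varX horner_evalE.
by case: eqP => [->|_]; rewrite ?hornerX ?hornerC.
Qed.

Lemma meval_split_var k z s p :
  (map_poly (mpoly.meval z) (split_var k p)).[s] =
  mpoly.meval (upd_coord z k s) p.
Proof.
apply: (mpoly_rmorph_eq
  (f := horner_eval s \o map_poly (mpoly.meval z) \o split_var k)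
  (g := mpoly.meval (upd_coord z k s))).
  by move=> c; rewrite /= split_varC horner_evalE map_polyC hornerC /= !mpoly.mevalC.
move=> i; rewrite /= split_varX horner_evalE mpoly.mevalXU /upd_coord.
by case: eqP => _; rewrite ?map_polyX ?hornerX // map_polyC hornerC /= mpoly.mevalXU.
Qed.

Lemma split_var_inj k : injective (split_var k).
Proof. by move=> p q e; rewrite -[p](horner_split_var k) e horner_split_var. Qed.

Lemma upd_coord_id z k : upd_coord z k (z k) =1 z.
Proof. by move=> i; rewrite /upd_coord; case: eqP => // ->. Qed.

Lemma exists_nonroot (S : idomainType) (io : {rmorphism F -> S}) (q : {poly S}) :
  q != 0 -> exists s, q.[io s] != 0.
Proof.
move=> q0; apply: contrapT => no.
have rt s : root q (io s) by apply/negPn/negP => h; apply: no; exists s.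
suff: (size [seq io k%:R | k <- iota 0 (size q)] < size q)%N.
  by rewrite size_map size_iota ltnn.
apply: max_poly_roots q0 _ _; first by rewrite all_map; apply/allP => k _ /=.
rewrite map_inj_uniq ?iota_uniq // => i j /fmorph_inj /eqP.
by rewrite eqr_nat => /eqP.
Qed.

Lemma mpoly_exists_nonroot (p : P) : p != 0 -> exists z, mpoly.meval z p != 0.
Proof.
move=> p0.
(* Specializes the first k variables; each further one avoids the finitely many roots of a
   polynomial in one variable. *)
pose part k (z : 'I_n -> F) : P -> P :=
  mpoly.mmap mC (fun i => if (i < k)%N then mC (z i) else mX i).
have: exists z, part n z p != 0.
  suff main k : (k <= n)%N -> exists z, part k z p != 0 by exact: main.
  elim: k => [|k IH] kn.
    exists (fun=> 0).
    have <- // : p = part 0%N (fun=> 0) p.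
    apply: (mpoly_rmorph_eq (f := idfun) (g := part 0%N (fun=> 0))).
      by move=> c; rewrite /part /= mpoly.mmapC.
    by move=> i; rewrite /part /= mpoly.mmapX mpoly.mmap1U.
  have [z] := IH (ltnW kn); rewrite -(inj_eq (@split_var_inj (Ordinal kn))) rmorph0.
  move/(exists_nonroot mC) => [s sP]; exists (upd_coord z (Ordinal kn) s).
  congr (_ != 0): sP; apply: (mpoly_rmorph_eq
    (f := horner_eval (mC s) \o split_var (Ordinal kn) \o part k z)
    (g := part k.+1 (upd_coord z (Ordinal kn) s))).
    by move=> c; rewrite /part /= !mpoly.mmapC split_varC horner_evalE hornerC.
  move=> i; rewrite /part /= !mpoly.mmapX !mpoly.mmap1U horner_evalE /upd_coord.
  rewrite (ltnS i k) (leq_eqVlt i k) -val_eqE /=; case: (ltngtP i k) => ik /=.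
  - by rewrite split_varC hornerC.
  - by rewrite split_varX -val_eqE /= gtn_eqF // hornerC.
  - by rewrite split_varX -val_eqE /= ik eqxx hornerX.
case=> z; have -> : part n z p = mC (mpoly.meval z p).
  apply: (mpoly_rmorph_eq (f := part n z) (g := mC \o mpoly.meval z)).
    by move=> c; rewrite /part /= mpoly.mmapC mpoly.mevalC.
  by move=> i; rewrite /part /= mpoly.mmapX mpoly.mmap1U ltn_ord mpoly.mevalXU.
by move=> h; exists z; apply: contra h => /eqP ->; rewrite rmorph0.
Qed.

Lemma mpoly_eval_eq0 (p : P) : (forall z, mpoly.meval z p = 0) -> p = 0.
Proof.
move=> h; apply/eqP/negPn/negP => /mpoly_exists_nonroot[z].
by rewrite h eqxx.
Qed.

End MpolyVariables.

(** * Exponentials of polynomials *)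

Lemma coefX_eq_low (S : comNzRingType) (x x' : {poly S}) e N :
  (forall i, (i <= N)%N -> x`_i = x'`_i) ->
  forall i, (i <= N)%N -> (x ^+ e)`_i = (x' ^+ e)`_i.
Proof.
move=> xx'; elim: e => [|e IH] i iN; first by rewrite !expr0.
rewrite !exprS (coefM_eq_low _ xx') // ![x' * _]mulrC.
exact: coefM_eq_low IH _ iN.
Qed.

Lemma coefM_order (S : nzRingType) (x y : {poly S}) m l :
  (forall i, (i < m)%N -> x`_i = 0) -> (forall i, (i < l)%N -> y`_i = 0) ->
  forall i, (i < m + l)%N -> (x * y)`_i = 0.
Proof.
move=> x0 y0 i im; rewrite coefM big1 // => k _.
have [km|mk] := ltnP k m; first by rewrite x0 // mul0r.
by rewrite y0 ?mulr0 //; have := ltn_ord k; lia.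
Qed.

Lemma coefX_order (S : nzRingType) (x : {poly S}) e i :
  x`_0 = 0 -> (i < e)%N -> (x ^+ e)`_i = 0.
Proof.
move=> x0; elim: e i => // e IH i ie; rewrite exprS.
apply: (@coefM_order _ _ _ 1 e) => [[]//|l le|]; last by rewrite add1n.
exact: IH.
Qed.

Section Exponential.
Variables (F : numFieldType) (S : comNzRingType) (io : {rmorphism F -> S}).

Definition exp_trunc N (y : {poly S}) : {poly S} :=
  \sum_(e < N.+1) (io (e`!%:R^-1))%:P * y ^+ e.

(* The equation t e' = t x' e for e = exp x, on coefficients. *)
Definition exp_rec (x e : nat -> S) N := e 0%N = 1 /\
  forall k, (k <= N)%N ->
    k%:R * e k = \sum_(i < k.+1) i%:R * x i * e (k - i)%N.

Definition euler (y : {poly S}) : {poly S} := 'X * y^`().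

Lemma coef_euler y k : (euler y)`_k = k%:R * y`_k.
Proof.
rewrite coefXM; case: k => [|k] /=; first by rewrite mul0r.
by rewrite coef_deriv mulr_natl.
Qed.

Lemma eulerM x y : euler (x * y) = euler x * y + x * euler y.
Proof. by rewrite /euler derivM; ring. Qed.

Lemma exp_recP (x e : {poly S}) N : e`_0 = 1 ->
  (forall k, (k <= N)%N -> (euler e)`_k = (euler x * e)`_k) ->
  exp_rec (fun i => x`_i) (fun i => e`_i) N.
Proof.
move=> e0 eq; split=> // k /eq; rewrite coef_euler coefM => ->.
by apply: eq_bigr => i _; rewrite coef_euler.
Qed.

Lemma exp_rec_euler (x e : {poly S}) N :
  exp_rec (fun i => x`_i) (fun i => e`_i) N ->
  forall k, (k <= N)%N -> (euler e)`_k = (euler x * e)`_k.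
Proof.
move=> [_ eq] k /eq; rewrite coef_euler coefM => ->.
by apply: eq_bigr => i _; rewrite coef_euler.
Qed.

Lemma exp_trunc0 N (y : {poly S}) : y`_0 = 0 -> (exp_trunc N y)`_0 = 1.
Proof.
move=> y0; rewrite coef_sum big_ord_recl big1 ?addr0 => [|e _].
  by rewrite coefCM expr0 coef1 fact0 invr1 rmorph1 mulr1.
by rewrite coefCM coefX_order ?mulr0.
Qed.

Lemma exp_truncP N (y : {poly S}) : y`_0 = 0 ->
  exp_rec (fun i => y`_i) (fun i => (exp_trunc N y)`_i) N.
Proof.
move=> y0; apply: exp_recP => [|k kN]; first exact: exp_trunc0.
have eE e : euler (y ^+ e) = e%:R * (y ^+ e.-1 * euler y).
  by rewrite /euler deriv_exp -mulr_natl; ring.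
have tE e : 'X * ((io (e.+1`!%:R^-1))%:P * y ^+ e.+1)^`() =
    (io (e`!%:R^-1))%:P * y ^+ e * euler y.
  rewrite derivM derivC mul0r add0r mulrCA [X in _ * X](eE e.+1) /= mulrA.
  rewrite -[e.+1%:R]polyC_natr !mulrA -polyCM -!mulrA; congr (_%:P * _).
  rewrite -(rmorph_nat io) -rmorphM factS natrM invfM mulrAC mulVf ?mul1r //.
have -> : euler (exp_trunc N y) =
    \sum_(e < N) (io (e`!%:R^-1))%:P * y ^+ e * euler y.
  rewrite /euler /exp_trunc raddf_sum mulr_sumr /= big_ord_recl derivM derivC.
  rewrite expr0 -polyC1 derivC mul0r mulr0 addr0 mulr0 add0r.
  by apply: eq_bigr => e _; exact: tE.
(* The truncation misses only a multiple of y^N t y', whose order is at least N + 1 because y_0 =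
   0. *)
rewrite /exp_trunc big_ord_recr /= mulrDr coefD mulr_sumr.
rewrite [X in _ = _ + X](coefM_order (m := 1) (l := N)).
- rewrite addr0 -mulr_suml -mulr_sumr mulrC. congr (_`_k); congr (_ * _).
- by case=> // _; rewrite coef_euler mul0r.
- by move=> i iN; rewrite coefCM coefX_order ?mulr0.
by rewrite add1n ltnS.
Qed.

(** The term i = 0 of the recurrence is zero, so e_k is determined by the earlier values once k is
    inverted. *)
Lemma exp_rec_uniq x e e' N : exp_rec x e N -> exp_rec x e' N ->
  forall k, (k <= N)%N -> e k = e' k.
Proof.
move=> [e0 eP] [e'0 e'P]; elim/ltn_ind => k IH kN.
case: k => [|k] in IH kN *; first by rewrite e0.
have inv : io k.+1%:R^-1 * k.+1%:R = 1 :> S.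
  by rewrite -(rmorph_nat io) -rmorphM mulVf ?rmorph1 // pnatr_eq0.
have ee : k.+1%:R * e k.+1 = k.+1%:R * e' k.+1.
  rewrite eP // e'P //; apply: eq_bigr => -[[|i] ik] _ /=; first by rewrite !mul0r.
  by rewrite IH //; lia.
by rewrite -[LHS]mul1r -inv -mulrA ee mulrA inv mul1r.
Qed.

End Exponential.

Lemma exp_rec_rmorph (S S' : comNzRingType) (f : {rmorphism S -> S'}) x e N :
  exp_rec x e N -> exp_rec (f \o x) (f \o e) N.
Proof.
case=> e0 eP; split=> [|k /eP /(congr1 f)]; first by rewrite /= e0 rmorph1.
rewrite rmorphM rmorph_nat => ->; rewrite rmorph_sum; apply: eq_bigr => i _.
by rewrite !rmorphM rmorph_nat.
Qed.

Section Sigma.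
Variables (R : realType) (n : nat) (x : nat -> mpoly_ring R[i] n).
Local Notation mC := (@mpoly.mpolyC n R[i]).

(** [sigma] truncates at its own index. One truncation N can serve all k <= N, since further
    variables and powers enter in degrees above k only. *)
Lemma sigma_exp_trunc N k : (k <= N)%N -> sigma x k =
  (exp_trunc mC N (\sum_(1 <= i < N.+1) x i *: 'X^i))`_k.
Proof.
have xE M i : (i <= M)%N -> (\sum_(1 <= i < M.+1) x i *: 'X^i)`_i =
    if i == 0%N then 0 else x i.
  move=> iM; rewrite coef_sum.
  under eq_bigr => j _ do rewrite coefZ coefXn.
  case: i iM => [|i] iM /=.
    by rewrite big_nat_cond big1 // => j /andP[/andP[j0 _] _]; rewrite ltn_eqF ?mulr0.
  rewrite (bigD1_seq i.+1) ?iota_uniq ?mem_index_iota //= eqxx mulr1 big1 ?addr0 //.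
  by move=> j /negPf ji; rewrite eq_sym ji mulr0.
move=> kN; rewrite coef_sum /= -(subnKC kN) -addSn big_split_ord /=.
rewrite [X in _ = _ + X]big1 ?addr0 => [|e _]; last first.
  by rewrite coefCM coefX_order ?mulr0 ?xE //; lia.
apply: eq_bigr => e _; rewrite coefCM mpoly.mul_mpolyC; congr (_ *: _).
apply: (coefX_eq_low _ (N := k)) => // i ik; rewrite !xE //.
exact: leq_trans ik (leq_addr _ _).
Qed.

Lemma sigma_rec N : exp_rec x (fun k => sigma x k) N.
Proof.
set y := \sum_(1 <= i < N.+1) x i *: 'X^i.
have yE i : (0 < i <= N)%N -> y`_i = x i.
  case/andP=> i0 iN; rewrite coef_sum; under eq_bigr => j _ do rewrite coefZ coefXn.
  rewrite (bigD1_seq i) ?iota_uniq ?mem_index_iota ?i0 //= eqxx mulr1 big1 ?addr0 //.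
  by move=> j /negPf ji; rewrite eq_sym ji mulr0.
have y0 : y`_0 = 0.
  rewrite coef_sum big_nat_cond big1 // => j /andP[/andP[j0 _] _].
  by rewrite coefZ coefXn ltn_eqF ?mulr0.
have sE l : (l <= N)%N -> sigma x l = (exp_trunc mC N y)`_l by exact: sigma_exp_trunc.
have [e0 eP] := exp_truncP mC N y0.
split=> [|k kN]; first by rewrite sE.
rewrite (sE k kN) (eP k kN); apply: eq_bigr => i _.
have ik : (i <= k)%N by rewrite -ltnS.
rewrite (sE (k - i)%N (leq_trans (leq_subr _ _) kN)).
case: (nat_of_ord i) ik => [|j] jk; first by rewrite !mul0r.
by rewrite yE // (leq_trans jk).
Qed.

End Sigma.

(** * Irreducible factors, denominators and derivations of exponentials *)

Lemma exists_monic_irreducible (K : fieldType) (q : {poly K}) :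
  (1 < size q)%N -> exists2 Q : {poly K}, monic_irreducible_poly Q & Q %| q.
Proof.
move=> sq; pose pr m := `[< exists Q : {poly K}, [/\ (1 < size Q)%N, size Q = m & Q %| q] >].
have ex : exists m, pr m by exists (size q); apply/asboolP; exists q.
case: (ex_minnP ex) => m /asboolP[Q [sQ mQ Qq]] min.
have Q0 : Q != 0 by rewrite -size_poly_gt0 ltnW.
have lQ : (lead_coef Q)^-1 != 0 by rewrite invr_eq0 lead_coef_eq0.
exists ((lead_coef Q)^-1 *: Q); last by rewrite dvdpZl.
split; last by rewrite monicE lead_coefZ mulVf ?lead_coef_eq0.
split=> [|d d1 dQ]; first by rewrite size_scale.
rewrite dvdpZr // in dQ; rewrite eqp_sym (eqp_trans (eqp_scale _ lQ)) // eqp_sym.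
rewrite -dvdp_size_eqp // eqn_leq dvdp_leq //= mQ min //; apply/asboolP.
exists d; split=> //; last exact: dvdp_trans Qq.
have d0 : d != 0 by apply: contraTneq dQ => ->; rewrite dvd0p.
by rewrite ltn_neqAle eq_sym d1 size_poly_gt0.
Qed.

Section FractionPoly.
Variable P : idomainType.
Local Notation K := {fraction P}.
Local Notation tf := (@tofrac P).

Lemma tofrac_inj : injective tf.
Proof. by move=> p q /eqP; rewrite tofrac_eq => /eqP. Qed.

Lemma tofrac_map_inj : injective (map_poly tf).
Proof. apply: map_inj_poly; [exact: tofrac_inj|exact: rmorph0]. Qed.

Lemma fraction_repr (f : K) : f = tf (repr f).1 / tf (repr f).2.
Proof.
have d0 := denom_ratioP (repr f).
suff e : f * tf (repr f).2 = tf (repr f).1 by rewrite -e mulfK // tofrac_eq0.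
rewrite -{1}[f]reprK; unlock tofrac; rewrite -[LHS]FracField.pi_mul.
apply/eqmodP; rewrite /= FracField.equivfE /FracField.mulf.
by rewrite !numden_Ratio ?mulf_neq0 ?oner_neq0 ?mulr1 // mulrC.
Qed.

Lemma poly_clear_denominators (l : {poly K}) :
  exists2 c : P, c != 0 & exists x : {poly P}, map_poly tf x = tf c *: l.
Proof.
elim/poly_ind: l => [|l b [c c0 [x xE]]].
  by exists 1; rewrite ?oner_neq0 //; exists 0; rewrite rmorph0 scaler0.
have [d d0 [y yE]] : exists2 d : P, d != 0 & exists y, tf y = tf d * b.
  exists (repr b).2; first exact: denom_ratioP.
  exists (repr b).1; rewrite {3}[b]fraction_repr mulrC divfK //.
  by rewrite tofrac_eq0 denom_ratioP.
exists (c * d); first by rewrite mulf_neq0.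
exists (d *: x * 'X + (c * y)%:P).
rewrite rmorphD rmorphM /= map_polyX map_polyC /= map_polyZ xE !tofracM yE.
by rewrite -!mul_polyC !polyCM; ring.
Qed.

End FractionPoly.

Section Derivation.
Variables (F : numFieldType) (S : comNzRingType) (io : {rmorphism F -> S}).
Variable D : {additive S -> S}.
Hypothesis DM : forall x y, D (x * y) = D x * y + x * D y.

Lemma derivation1 : D 1 = 0.
Proof. by have := DM 1 1; rewrite !mulr1 mul1r -[LHS]addr0 => /addrI. Qed.

(** This is the identity de/dx_m = t^m e for e = exp(sum x_i t^i), proved by applying D to the
    recurrence. *)
Lemma exp_rec_derivation (x e : nat -> S) m : (forall N, exp_rec x e N) ->
    (0 < m)%N -> (forall i, (0 < i)%N -> D (x i) = (i == m)%:R) ->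
  forall i, D (e i) = if (m <= i)%N then e (i - m)%N else 0.
Proof.
move=> ex m0 Dx; elim/ltn_ind => -[|i] IH.
  by have [-> _] := ex 0%N; rewrite derivation1 leqn0 gtn_eqF.
have [_ eP] := ex i.+1.
have DN k y : D (k%:R * y) = k%:R * D y by rewrite !mulr_natl raddfMn.
have term (l : 'I_i.+2) : D (l%:R * x l * e (i.+1 - l)%N) =
    l%:R * ((l == m :> nat)%:R * e (i.+1 - l)%N) + l%:R * x l *
    (if (m <= i.+1 - l)%N then e (i.+1 - l - m)%N else 0).
  rewrite -mulrA DN DM; case: (nat_of_ord l) => [|l']; first by rewrite !mul0r addr0.
  by rewrite Dx // IH ?mulrDr ?mulrA //; lia.
have eqD : i.+1%:R * D (e i.+1) =
    i.+1%:R * (if (m <= i.+1)%N then e (i.+1 - m)%N else 0).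
  rewrite -DN eP // raddf_sum (eq_bigr _ (fun l _ => term l)) big_split /=.
  have [mi|im] := leqP m i.+1; last first.
    rewrite mulr0 !big1 ?addr0 // => l _.
      by case: ifP => [le|]; [lia|rewrite mulr0].
    by rewrite ltn_eqF ?mul0r ?mulr0 //; have := ltn_ord l; lia.
  rewrite (bigD1 (Ordinal (leq_trans mi (leqnn _) : (m < i.+2)%N))) //=.
  rewrite eqxx mul1r big1 ?addr0 => [|l lm]; last first.
    by rewrite -val_eqE /= in lm; rewrite (negPf lm) mul0r mulr0.
  (* The term l = m contributes m e_(i+1-m). The others form the right-hand side of the recurrence
     at i+1-m, that is (i+1-m) e_(i+1-m). *)
  rewrite [X in _ + X](_ : _ = (i.+1 - m)%:R * e (i.+1 - m)%N).
    by rewrite -mulrDl -natrD subnKC.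
  have [_ ->//] := ex (i.+1 - m)%N.
  have le : ((i.+1 - m).+1 <= i.+2)%N by rewrite ltnS leq_subr.
  rewrite (big_ord_widen _ (fun l => l%:R * x l * e (i.+1 - m - l)%N) le).
  rewrite [RHS]big_mkcond; apply: eq_bigr => l _ /=.
  have -> : (m <= i.+1 - l)%N = (l < (i.+1 - m).+1)%N.
    by have := ltn_ord l; lia.
  by case: ifP => _; [congr (_ * e _); lia|rewrite mulr0].
have inv : io i.+1%:R^-1 * i.+1%:R = 1 :> S.
  by rewrite -(rmorph_nat io) -rmorphM mulVf ?rmorph1 // pnatr_eq0.
by rewrite -[LHS]mul1r -inv -mulrA eqD mulrA inv mul1r.
Qed.

End Derivation.

(** * Coprimality of the theta polynomial and its minor *)

Lemma exists_residue_field (K : fieldType) (Q : {poly K}) :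
  monic_irreducible_poly Q -> exists (L : fieldType) (f : {rmorphism {poly K} -> L}),
    (forall l, exists p, f p = l) /\ forall p, (f p == 0) = (Q %| p).
Proof.
move=> hI; pose L : fieldType := {poly %/ Q with hI}.
pose f : {rmorphism {poly K} -> L} := in_qpoly Q; exists L, f; split=> [l|p].
  exists (val (l : {poly %/ Q})); apply: val_inj; apply: in_qpoly_small.
  exact: size_mk_monic.
have -> : (f p == 0) = (Pdiv.Ring.rmodp p (mk_monic Q) == 0) by [].
by rewrite mk_monicE // -(Pdiv.IdomainMonic.modpE hI.2 p).
Qed.

Section MapDerivation.
Variables (S : comNzRingType) (f : {additive S -> S}).
Hypothesis fM : forall x y, f (x * y) = f x * y + x * f y.

Lemma map_derivationM (x y : {poly S}) :
  map_poly f (x * y) = map_poly f x * y + x * map_poly f y.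
Proof.
apply/polyP => i; rewrite coefD !coef_map /= !coefM raddf_sum.
rewrite -big_split; apply: eq_bigr => l _ /=.
by rewrite fM !coef_map.
Qed.

Lemma map_derivationX : f 1 = 0 -> map_poly f 'X = 0.
Proof.
move=> f1; apply/polyP => i; rewrite coef_map coefX coef0 /=.
by case: (i == 1%N); rewrite ?raddf0.
Qed.

End MapDerivation.

Section ThetaPolynomial.
Variables (F : numClosedFieldType) (n : nat).
Variables (w : 'I_n.+1 -> nat) (a : 'I_n.+1 -> nat -> F).
Local Notation P := (mpoly_ring F n.+1).
Local Notation mX i := (mpoly.mpolyX F (mpoly.mnm1 i) : P).
Local Notation mC := (@mpoly.mpolyC n.+1 F : F -> P).

(* [gap_vars] over an arbitrary field. *)
Definition gap_monomials (h : nat) : P := \sum_(j < n.+1 | w j == h) mX j.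

Variable s : nat -> P.

Definition theta_mx : 'M[P]_n.+1 := gapmx w a mC (gexp w s).
Definition theta_poly : P := \det theta_mx.
Definition theta_minor : P := cofactor theta_mx ord_max ord0.

Hypothesis gapS : gap_system w a.
Hypothesis w0 : w ord0 = 1%N.
Hypothesis sP : forall N, exp_rec gap_monomials s N.

Lemma gap_inj : injective w.
Proof.
move=> i j e; apply/val_inj/eqP; case: (ltngtP i j) => // h.
  by have := gap_ltn gapS h; rewrite e ltnn.
by have := gap_ltn gapS h; rewrite e ltnn.
Qed.

Lemma gap_gt0 j : (0 < w j)%N.
Proof.
have [->|j0] := eqVneq j ord0; first by rewrite w0.
have /(gap_ltn gapS) : ((ord0 : 'I_n.+1) < j)%N by rewrite lt0n.
exact: leq_ltn_trans.
Qed.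

Lemma gap_monomialsE j : gap_monomials (w j) = mX j.
Proof.
rewrite /gap_monomials (bigD1 j) //= big1 ?addr0 // => i /andP[/eqP/gap_inj ->].
by rewrite eqxx.
Qed.

Lemma gap_monomialsP h : gap_monomials h = 0 \/ exists2 j, h = w j & gap_monomials h = mX j.
Proof.
have [[j e]|no] := pselect (exists j, h = w j).
  by right; exists j => //; rewrite e gap_monomialsE.
left; rewrite /gap_monomials big1 // => j /eqP e; case: no; by exists j.
Qed.

Section CommonFactor.
Local Notation phi := (@split_var F n.+1 ord0).
Local Notation tf := (@tofrac P).
Local Notation tfp := (map_poly tf).

(** The derivation d/dz_k transported to P[X] by [split_var ord0]: X stands for the first
    variable. *)
Definition split_derivation (k : 'I_n.+1) : {additive {poly P} -> {poly P}} :=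
  if k == ord0 then (@deriv P : {additive {poly P} -> {poly P}})
  else (map_poly (mpoly.mderiv k) : {additive {poly P} -> {poly P}}).

Lemma split_derivationM k x y : split_derivation k (x * y) =
  split_derivation k x * y + x * split_derivation k y.
Proof.
rewrite /split_derivation; case: eqP => _ /=; first exact: derivM.
exact/map_derivationM/mpoly.mderivM.
Qed.

Lemma split_derivationC k c : split_derivation k (phi (mC c)) = 0.
Proof.
rewrite split_varC /split_derivation; case: eqP => _ /=; first exact: derivC.
by rewrite map_polyC /= mpoly.mderivC.
Qed.

Lemma split_derivation_monomials k i :
  split_derivation k (phi (gap_monomials i)) = (i == w k)%:R.
Proof.
have [e|[j -> ->]] := gap_monomialsP i.
  rewrite e !raddf0; case: eqP => [ik|//].
  move: e; rewrite ik gap_monomialsE => /(congr1 (mpoly.meval (fun=> 1))) /eqP.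
  by rewrite mpoly.mevalXU raddf0 oner_eq0.
rewrite (inj_eq gap_inj) split_varX /split_derivation.
have [e|k0] := eqVneq k ord0; have [e'|j0] := eqVneq j ord0.
- by rewrite e e' eqxx /= derivX.
- by rewrite e (negPf j0) /= derivC.
- rewrite e' eq_sym (negPf k0) /=.
  by apply: map_derivationX; rewrite -(rmorph1 mC); apply: mpoly.mderivC.
rewrite /= map_polyC /= mpoly.mderivX mpoly.mnm1E; case: eqP => [->|_].
  have -> : (mpoly.mnm_sub (mpoly.mnm1 k) (mpoly.mnm1 k)) = mpoly.mnm0 :> monomial n.+1.
    by apply/mpoly.mnmP => l; rewrite mpoly.mnmBE mpoly.mnm0E subnn.
  by rewrite mpoly.mpolyX0 scale1r.
by rewrite scale0r.
Qed.

(** A nonconstant gcd has an irreducible factor Q over the fraction field of P. Nonzero constants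
    are invertible modulo Q, so clearing denominators shows that the residue field consists of
    fractions from P[X] and that Q generates the kernel up to a denominator, as [gapmx_coprime]
    requires. *)
Lemma theta_coprime : theta_poly != 0 -> coprimep (phi theta_poly) (phi theta_minor).
Proof.
move=> T0; apply/negPn/negP; rewrite coprimep_def => sG.
set G := gcdp (phi theta_poly) (phi theta_minor) in sG.
have G0 : G != 0.
  apply: contra T0; rewrite gcdp_eq0 => /andP[/eqP e _]; apply/eqP.
  by apply: (@split_var_inj _ _ ord0); rewrite e rmorph0.
have sG1 : (1 < size (tfp G))%N.
  rewrite size_map_inj_poly ?rmorph0 //; last exact: tofrac_inj.
  by rewrite ltn_neqAle eq_sym sG size_poly_gt0.
have [Q hI QG] := exists_monic_irreducible sG1.
have [L [f0 [f0S f0K]]] := exists_residue_field hI.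
pose f : {rmorphism {poly P} -> L} := f0 \o tfp.
have fC c : c != 0 -> f c%:P != 0.
  move=> c0; rewrite /f /= map_polyC f0K; apply: contraL (hI.1.1) => Qc.
  rewrite -leqNgt (leq_trans (dvdp_leq _ Qc)) ?size_polyC_leq1 //.
  by rewrite polyC_eq0 tofrac_eq0.
have [c c0 [Qs QsE]] := poly_clear_denominators Q.
have f_div p : G %| p -> f p = 0.
  case/Pdiv.Idomain.dvdpP => -[d q] /= d0 /(congr1 f).
  rewrite -mul_polyC !rmorphM /= => e; apply: (mulfI (fC d d0)).
  rewrite mulr0 [LHS]e; apply/eqP; rewrite mulf_eq0 [X in _ || X](_ : _ = true) ?orbT //.
  by rewrite f0K.
apply: (@gapmx_coprime _ _ _ _ gapS {poly P} L (phi \o mC) f Qs split_derivation (phi \o s)).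
- move=> l; have [p pE] := f0S l; have [d d0 [x xE]] := poly_clear_denominators p.
  exists x, d%:P; split; first exact: fC.
  by rewrite /f /= xE map_polyC -mul_polyC rmorphM pE.
- by apply/eqP; rewrite /f /= QsE f0K dvdpZr ?dvdpp // tofrac_eq0.
- move=> x /eqP; rewrite /f /= f0K => /dvdpP[q qE].
  have [d d0 [h hE]] := poly_clear_denominators q.
  exists (c * d)%:P, h; split; first by apply: fC; rewrite mulf_neq0.
  apply: tofrac_map_inj; rewrite !rmorphM /= !map_polyC QsE hE qE /=.
  by rewrite -!mul_polyC [q * Q]mulrC; exact: mulrACA.
- exact: split_derivationM.
- exact: split_derivationC.
- by have [s0 _] := sP 0%N; rewrite /= s0 rmorph1.
- move=> k i; apply: (exp_rec_derivation (phi \o mC) (split_derivationM k)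
    (x := phi \o gap_monomials)).
  + by move=> N; apply: exp_rec_rmorph.
  + exact: gap_gt0.
  + by move=> l _; apply: split_derivation_monomials.
- have <- : phi theta_poly = \det (gapmx w a (phi \o mC) (gexp w (phi \o s))).
    exact: det_gapmx_map.
  by apply: f_div; apply: dvdp_gcdl.
have <- : phi theta_minor = cofactor (gapmx w a (phi \o mC) (gexp w (phi \o s))) ord_max ord0.
  exact: cofactor_gapmx_map.
by apply: f_div; apply: dvdp_gcdr.
Qed.

End CommonFactor.
End ThetaPolynomial.

(** * Leading terms of the theta polynomial *)

Lemma prod_top_coef (S : comNzRingType) (I : finType) (p : I -> {poly S}) (d : I -> nat) :
  (forall i l, (d i < l)%N -> (p i)`_l = 0) ->
  (forall l, (\sum_i d i < l)%N -> (\prod_i p i)`_l = 0) /\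
  (\prod_i p i)`_(\sum_i d i) = \prod_i (p i)`_(d i).
Proof.
move=> dP.
have := (big_rec3 (fun m (q : {poly S}) (c : S) => (forall l, (m < l)%N -> q`_l = 0) /\ q`_m = c)).
move=> /(_ 0%N addn 1 *%R 1 *%R); apply.
  by split=> [[|l]|] //; rewrite coef1.
move=> i m q c _ [qm qc]; split=> [l ml|].
  rewrite coefM big1 // => k _; have [km|mk] := ltnP (d i) k.
    by rewrite dP ?mul0r.
  by rewrite qm ?mulr0 //; have := ltn_ord k; lia.
rewrite coefM (bigD1 (Ordinal (leq_addr m (d i) : (d i < (d i + m).+1)%N))) //=.
rewrite addKn qc big1 ?addr0 // => k /eqP ki.
have [km|mk] := ltnP (d i) k; first by rewrite dP ?mul0r.
rewrite qm ?mulr0 //; have : (nat_of_ord k != d i)%N; last by have := ltn_ord k; lia.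
by apply/eqP => e; apply: ki; apply: val_inj.
Qed.

(** Multiplying row j by w_j! turns its entries into the falling factorials of w_j. A kernel vector
    would be a nonzero polynomial of degree below n, written in the basis of falling factorials,
    with the n distinct roots w_j. *)
Lemma ffact_det_neq0 (F : numFieldType) n (w : 'I_n -> nat) : injective w ->
  \det (\matrix_(j < n, i < n) (if (i <= w j)%N then ((w j - i)`!)%:R^-1 else 0 : F)) != 0.
Proof.
move=> wI; set A := \matrix_(_, _) _; rewrite -det_tr; apply/negP => /det0P[v v0 vA].
pose ff i : {poly F} := \prod_(0 <= l < i) ('X - l%:R%:P).
have ffS i : size (ff i) = i.+1 by rewrite size_prod_XsubC size_iota subn0.
have ff_eval m i : (ff i).[m%:R] = (m ^_ i)%:R.
  rewrite horner_prod; elim: i => [|i IH]; first by rewrite big_geq.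
  rewrite big_nat_recr //= IH !hornerE ffactnSr natrM.
  have [im|mi] := leqP i m; first by rewrite natrB.
  by rewrite ffact_small ?mul0r.
have ind m (b : nat -> F) : \sum_(i < m) b i *: ff i = 0 -> forall i, (i < m)%N -> b i = 0.
  elim: m => [|m IH] //; rewrite big_ord_recr /= => e.
  have bm : b m = 0.
    have := congr1 (fun q : {poly F} => q`_m) e; rewrite coefD coef_sum big1 => [|i _].
      rewrite add0r coefZ coef0 => /eqP; rewrite mulf_eq0 => /orP[/eqP//|].
      have -> : (ff m)`_m = lead_coef (ff m) by rewrite lead_coefE ffS.
      by rewrite (monicP (monic_prod_XsubC _ _ _)) oner_eq0.
    by rewrite coefZ nth_default ?mulr0 // ffS.
  move=> i; rewrite ltnS leq_eqVlt => /orP[/eqP->//|]; apply: IH.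
  by rewrite bm scale0r addr0 in e.
pose b i := if insub i is Some i' then v 0 i' else 0 : F.
have bE (i : 'I_n) : b i = v 0 i by rewrite /b valK.
have f0 : \sum_(i < n) b i *: ff i = 0.
  apply/eqP/negPn/negP => f0.
  have : (size [seq ((w j)%:R : F) | j <- enum 'I_n] < size (\sum_(i < n) b i *: ff i)%R)%N.
    apply: max_poly_roots f0 _ _; last first.
      rewrite map_inj_uniq ?enum_uniq // => j k /eqP.
      by rewrite eqr_nat => /eqP /wI.
    rewrite all_map; apply/allP => j _ /=; rewrite rootE horner_sum.
    have wf : (w j)`!%:R != 0 :> F by rewrite pnatr_eq0 -lt0n fact_gt0.
    have := congr1 (fun B : 'rV_n => (w j)`!%:R * B 0 j) vA; rewrite !mxE mulr0 mulr_sumr.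
    move=> e; apply/eqP; rewrite -[RHS]e; apply: eq_bigr => i _.
    rewrite hornerZ ff_eval !mxE bE mulrCA; congr (_ * _).
    case: ltnP => [wi|iw]; first by rewrite ffact_small ?mulr0.
    by rewrite -(ffact_fact iw) natrM mulfK // pnatr_eq0 -lt0n fact_gt0.
  rewrite size_map size_enum_ord ltnNge => /negP; apply.
  apply: (leq_trans (size_sum _ _ _)); apply/bigmax_leqP => i _.
  by rewrite (leq_trans (size_scale_leq _ _)) // ffS.
case/eqP: v0; apply/rowP => i; rewrite mxE.
by rewrite -bE; apply: ind f0 _ _.
Qed.

Section ThetaLeadingTerm.
Variables (F : numClosedFieldType) (n : nat).
Variables (w : 'I_n.+1 -> nat) (a : 'I_n.+1 -> nat -> F).
Local Notation P := (mpoly_ring F n.+1).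
Local Notation mX i := (mpoly.mpolyX F (mpoly.mnm1 i) : P).
Local Notation mC := (@mpoly.mpolyC n.+1 F : F -> P).
Variable s : nat -> P.
Hypothesis gapS : gap_system w a.
Hypothesis w0 : w ord0 = 1%N.
Hypothesis sP : forall N, exp_rec (gap_monomials F w) s N.
Local Notation phi := (@split_var F n.+1 ord0).

Lemma split_gap_monomials i : i != 1%N -> exists c, phi (gap_monomials F w i) = c%:P.
Proof.
move=> i1; have [->|[j e ->]] := gap_monomialsP gapS i.
  by exists 0; rewrite raddf0.
exists (mX j); rewrite split_varX; case: eqP => // j0.
by rewrite e j0 w0 in i1.
Qed.

Lemma split_gap_monomials1 : phi (gap_monomials F w 1) = 'X.
Proof. by rewrite -w0 (gap_monomialsE gapS) split_varX eqxx. Qed.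

(** The first variable has weight 1, so s_k contains its k-th power with coefficient 1/k! and no
    higher power. *)
Lemma split_exp_top k :
  (forall l, (k < l)%N -> (phi (s k))`_l = 0) /\ (phi (s k))`_k = mC (k`!%:R^-1).
Proof.
have coefCR (c : nat) (q : {poly P}) l : (c%:R * q)`_l = c%:R * q`_l.
  by rewrite !mulr_natl coefMn.
have inv i : mC i.+1%:R^-1 * i.+1%:R = 1.
  by rewrite -(rmorph_nat mC) -rmorphM mulVf ?rmorph1 // pnatr_eq0.
elim/ltn_ind: k => -[|k] IH.
  have [-> _] := sP 0%N; rewrite rmorph1 fact0 invr1 rmorph1 coef1; split=> //.
  by move=> [|l] // _; rewrite coef1.
have [_ /(_ k.+1 (leqnn _)) /(congr1 phi)] := sP k.+1.
rewrite rmorphM rmorph_nat rmorph_sum => e.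
(* Above degree k only the summand i = 1 contributes: s_(k+1-i) has degree k+1-i, and x_i is
   constant in X for i > 1. *)
have main l : (k < l)%N -> k.+1%:R * (phi (s k.+1))`_l = (phi (s k))`_l.-1.
  move=> kl; rewrite -coefCR e coef_sum.
  rewrite (bigD1 (Ordinal (isT : (1 < k.+2)%N))) //= big1 ?addr0 => [|i /eqP i1].
    rewrite !rmorphM rmorph_nat /= split_gap_monomials1 mul1r subSS subn0 mulrC coefMX.
    by rewrite gtn_eqF // (leq_ltn_trans _ kl).
  rewrite !rmorphM rmorph_nat -mulrA coefCR /=.
  have [->|i0] := eqVneq (i : nat) 0%N; first by rewrite mul0r.
  have [|c ->] := @split_gap_monomials i.
    by apply/eqP => e1; apply: i1; apply: val_inj.
  have lt : (k.+1 - i < k.+1)%N by lia.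
  have [IH1 _] := IH _ lt.
  by rewrite coefCM IH1 ?mulr0 //; lia.
have [IH1 IH2] := IH k (ltnSn k).
have kl1 l : (k.+1 < l)%N -> (k < l.-1)%N by lia.
split=> [l kl|].
  have e0 := etrans (main l (ltnW kl)) (IH1 l.-1 (kl1 l kl)).
  by rewrite -[LHS]mul1r -(inv k) -mulrA e0 mulr0.
have e0 := etrans (main k.+1 (leqnn _)) IH2.
rewrite -[LHS]mul1r -(inv k) -mulrA e0 -rmorphM; congr (mC _).
by rewrite factS natrM invfM.
Qed.

Lemma theta_mx_top (j i : 'I_n.+1) :
  ((w j < i)%N -> phi (theta_mx w a s j i) = 0) /\ ((i <= w j)%N ->
  (forall l, (w j - i < l)%N -> (phi (theta_mx w a s j i))`_l = 0) /\
  (phi (theta_mx w a s j i))`_(w j - i) = mC (((w j - i)`!)%:R^-1)).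
Proof.
have entry : phi (theta_mx w a s j i) =
    \sum_(k < (w j).+1) (mC (a j k))%:P * (if (i <= k)%N then phi (s (k - i)%N) else 0).
  rewrite mxE rmorph_sum; apply: eq_bigr => k _; rewrite rmorphM /= split_varC.
  congr (_ * _); rewrite mulrC coef_shift; first by case: ifP; rewrite ?raddf0.
  by rewrite (leq_trans (ltn_ord k)) // ltnS (gap_ltn_max gapS).
split=> [wi|iw].
  rewrite entry big1 // => k _; case: ifP => [ik|]; last by rewrite mulr0.
  by have := ltn_ord k; lia.
have low k l : (k < (w j).+1)%N -> (w j - i <= l)%N -> (k != w j) || (w j - i < l)%N ->
    ((mC (a j k))%:P * (if (i <= k)%N then phi (s (k - i)%N) else 0))`_l = 0.
  move=> kw lw h; rewrite coefCM; case: ifP => [ik|]; last by rewrite coef0 mulr0.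
  by rewrite (split_exp_top _).1 ?mulr0 //; lia.
split=> [l lw|]; rewrite entry coef_sum.
  by rewrite big1 // => k _; rewrite low ?lw ?orbT // ltnW.
rewrite (bigD1 ord_max) //= big1 ?addr0 => [|k kw].
  by rewrite iw (gap_delta gapS) eqxx rmorph1 mul1r (split_exp_top _).2.
by rewrite low // ltnn orbF; apply: contra kw => /eqP e; apply/eqP/val_inj.
Qed.

(** The entry (j, i) has degree w_j - i in the first variable, so all nonzero permutation products
    have the same degree, and their top coefficients add up to the determinant of the 1/(w_j -
    i)!. *)
Lemma theta_lead : exists2 c : F, c != 0 & lead_coef (phi (theta_poly w a s)) = mC c.
Proof.
pose c (j i : 'I_n.+1) : F := if (i <= w j)%N then ((w j - i)`!)%:R^-1 else 0.
exists (\det (\matrix_(j, i) c j i)); first by apply: ffact_det_neq0; exact: gap_inj gapS.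
set D := ((\sum_j w j) - \sum_(i < n.+1) i)%N.
have term (sg : {perm 'I_n.+1}) :
    (forall l, (D < l)%N -> (\prod_j phi (theta_mx w a s j (sg j)))`_l = 0) /\
    (\prod_j phi (theta_mx w a s j (sg j)))`_D = mC (\prod_j c j (sg j)).
  have [[j lt]|no] := pselect (exists j, (w j < sg j)%N).
    (* Here the product is zero; in the other case no subtraction is truncated and [D] is the true
       degree. *)
    rewrite (bigD1 j) //= (theta_mx_top j (sg j)).1 // mul0r; split=> [l _|].
      by rewrite coef0.
    by rewrite coef0 (bigD1 j) //= /c leqNgt lt mul0r rmorph0.
  have le j : (sg j <= w j)%N by rewrite leqNgt; apply/negP => lt; apply: no; exists j.
  have De : (\sum_j (w j - sg j) = D)%N.
    rewrite sumnB => [|j _]; last exact: le.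
    by rewrite /D; congr (_ - _)%N; rewrite [RHS](reindex_inj (@perm_inj _ sg)).
  have [h1 h2] := prod_top_coef (fun j => ((theta_mx_top j (sg j)).2 (le j)).1).
  rewrite De in h1 h2; split=> //; rewrite h2 rmorph_prod; apply: eq_bigr => j _.
  by rewrite ((theta_mx_top j (sg j)).2 (le j)).2 /c le.
have TE : phi (theta_poly w a s) =
    \sum_(sg : {perm 'I_n.+1}) (-1) ^+ sg * \prod_j phi (theta_mx w a s j (sg j)).
  rewrite /theta_poly rmorph_sum; apply: eq_bigr => sg _.
  by rewrite rmorphM rmorphXn rmorphN1 rmorph_prod.
have signC (b : bool) (q : {poly P}) l : ((-1) ^+ b * q)`_l = (-1) ^+ b * q`_l.
  by rewrite !mulr_sign; case: b => //; rewrite coefN.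
have top : (phi (theta_poly w a s))`_D = mC (\det (\matrix_(j, i) c j i)).
  rewrite TE coef_sum rmorph_sum; apply: eq_bigr => sg _.
  rewrite signC (term sg).2 rmorphM rmorphXn rmorphN1; congr (_ * mC _).
  by apply: eq_bigr => j _; rewrite mxE.
have c0 : \det (\matrix_(j, i) c j i) != 0 :> F.
  by apply: ffact_det_neq0; exact: gap_inj gapS.
suff sz : size (phi (theta_poly w a s)) = D.+1 by rewrite lead_coefE sz.
apply/eqP; rewrite eqn_leq; apply/andP; split; last first.
  rewrite ltnNge; apply/negP => /leq_sizeP/(_ D (leqnn _)) /eqP.
  by rewrite top fmorph_eq0 (negPf c0).
apply/leq_sizeP => l Dl; rewrite TE coef_sum big1 // => sg _.
by rewrite signC (term sg).1 ?mulr0.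
Qed.

End ThetaLeadingTerm.

(** * Dependence on the last variable *)

Section ThetaLastVariable.
Variables (F : numClosedFieldType) (n : nat).
Variables (w : 'I_n.+1 -> nat) (a : 'I_n.+1 -> nat -> F).
Local Notation P := (mpoly_ring F n.+1).
Local Notation mX i := (mpoly.mpolyX F (mpoly.mnm1 i) : P).
Local Notation mC := (@mpoly.mpolyC n.+1 F : F -> P).
Variable s : nat -> P.
Hypothesis gapS : gap_system w a.
Hypothesis w0 : w ord0 = 1%N.
Hypothesis sP : forall N, exp_rec (gap_monomials F w) s N.
Local Notation psi := (@split_var F n.+1 ord_max).

Definition last_free (p : P) := psi p = p%:P.

Lemma last_freeC c : last_free (mC c).
Proof. exact: split_varC. Qed.

Lemma last_freeD p q : last_free p -> last_free q -> last_free (p + q).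
Proof. by rewrite /last_free => hp hq; rewrite rmorphD /= hp hq polyCD. Qed.

Lemma last_freeM p q : last_free p -> last_free q -> last_free (p * q).
Proof. by rewrite /last_free => hp hq; rewrite rmorphM /= hp hq polyCM. Qed.

Lemma last_free_sum (I : finType) (A : pred I) (f : I -> P) :
  (forall i, A i -> last_free (f i)) -> last_free (\sum_(i | A i) f i).
Proof.
move=> h; apply: (big_ind last_free) => //; last exact: last_freeD.
by rewrite -(rmorph0 mC); apply: last_freeC.
Qed.

Lemma last_free_det m (A : 'M[P]_m) :
  (forall i j, last_free (A i j)) -> last_free (\det A).
Proof.
move=> h; apply: last_free_sum => sg _; apply: last_freeM.
  by rewrite -(rmorphN1 mC) -rmorphXn; apply: last_freeC.
apply: (big_ind last_free) => //; last exact: last_freeM.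
by rewrite -(rmorph1 mC); apply: last_freeC.
Qed.

Lemma exp_solve k : s k.+1 =
  mC k.+1%:R^-1 * \sum_(i < k.+1) i.+1%:R * gap_monomials F w i.+1 * s (k - i)%N.
Proof.
have [_ /(_ k.+1 (leqnn _))] := sP k.+1; rewrite big_ord_recl !mul0r add0r => e.
have inv : mC k.+1%:R^-1 * k.+1%:R = 1.
  by rewrite -(rmorph_nat mC) -rmorphM mulVf ?rmorph1 // pnatr_eq0.
rewrite -[LHS]mul1r -{1}inv -mulrA e; congr (_ * _).
Qed.

Lemma last_free_monomials i : (i < w ord_max)%N -> last_free (gap_monomials F w i).
Proof.
have [-> _|[j -> ->] jm] := gap_monomialsP gapS i.
  by rewrite -(rmorph0 mC); apply: last_freeC.
rewrite /last_free split_varX; case: eqP => // e.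
by rewrite e ltnn in jm.
Qed.

Lemma last_free_term i k : (i < w ord_max)%N -> last_free (s k) ->
  last_free (i%:R * gap_monomials F w i * s k).
Proof.
move=> iw sk; apply: last_freeM => //; apply: last_freeM.
  by rewrite -(rmorph_nat mC); apply: last_freeC.
exact: last_free_monomials.
Qed.

Lemma last_free_exp k : (k < w ord_max)%N -> last_free (s k).
Proof.
elim/ltn_ind: k => -[|k] IH kw.
  by have [-> _] := sP 0%N; rewrite -(rmorph1 mC); apply: last_freeC.
rewrite exp_solve; apply: last_freeM; first exact: last_freeC.
apply: last_free_sum => i _; apply: last_free_term.
  by have := ltn_ord i; lia.
by apply: IH; lia.
Qed.

Lemma exp_last : exists2 r0, last_free r0 & s (w ord_max) = mX ord_max + r0.
Proof.
have := gap_gt0 gapS w0 ord_max; case wE : (w ord_max) => [|m] // _.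
exists (mC m.+1%:R^-1 * \sum_(i < m) i.+1%:R * gap_monomials F w i.+1 * s (m - i)%N).
  apply: last_freeM; first exact: last_freeC.
  apply: last_free_sum => i _; apply: last_free_term.
    by rewrite wE ltnS.
  by apply: last_free_exp; rewrite wE; lia.
rewrite exp_solve big_ord_recr /= subnn mulrDr addrC; congr (_ + _).
have [-> _] := sP 0%N; rewrite mulr1 mulrA -wE (gap_monomialsE gapS).
by rewrite -(rmorph_nat mC) -rmorphM mulVf ?rmorph1 ?mul1r // wE pnatr_eq0.
Qed.

Lemma theta_mxE (j i : 'I_n.+1) : theta_mx w a s j i =
  \sum_(k < (w j).+1) mC (a j k) * (if (i <= k)%N then s (k - i)%N else 0).
Proof.
rewrite mxE; apply: eq_bigr => k _; congr (_ * _); rewrite mulrC coef_shift //.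
by rewrite (leq_trans (ltn_ord k)) // ltnS (gap_ltn_max gapS).
Qed.

(** Only s_(w_max) contains the last variable, linearly and with coefficient 1, and it occurs only
    in the last row of column 0. Expanding along this column isolates the minor. *)
Lemma theta_last : last_free (theta_minor w a s) /\ exists2 r, last_free r &
  theta_poly w a s = mX ord_max * theta_minor w a s + r.
Proof.
have [r0 r0P r0E] := exp_last.
pose z0 : P := mX ord_max.
have free0 : last_free 0 by rewrite -(rmorph0 mC); apply: last_freeC.
have entry (j i : 'I_n.+1) : (j != ord_max) || (i != ord0) ->
    last_free (theta_mx w a s j i).
  move=> ji; rewrite theta_mxE; apply: last_free_sum => k _.
  apply: last_freeM; first exact: last_freeC.
  case: ifP => // ik; apply: last_free_exp.
  have kj : (k <= w j)%N by rewrite -ltnS.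
  have jw := gap_ltn_max gapS j.
  case/orP: ji => [jm|i0].
    suff : (w j < w ord_max)%N by lia.
    by apply: (gap_ltn gapS); rewrite ltn_neqAle jm /= -ltnS ltn_ord.
  have : (0 < i)%N by rewrite lt0n.
  by have := gap_gt0 gapS w0 ord_max; lia.
have cof j : last_free (cofactor (theta_mx w a s) j ord0).
  apply: last_freeM; first by rewrite -(rmorphN1 mC) -rmorphXn; apply: last_freeC.
  apply: last_free_det => i l; rewrite [row' _ _ _ _]mxE [col' _ _ _ _]mxE; apply: entry.
  by rewrite -val_eqE /= /bump /= orbT.
split; first exact: cof.
exists ((\sum_(j | j != ord_max) theta_mx w a s j ord0 * cofactor (theta_mx w a s) j ord0) +
  (theta_mx w a s ord_max ord0 - z0) * theta_minor w a s).
  apply: last_freeD.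
    by apply: last_free_sum => j jm; apply: last_freeM => //; apply: entry; rewrite jm.
  apply: last_freeM; last exact: cof.
  rewrite theta_mxE big_ord_recr /= (gap_delta gapS) eqxx subn0 r0E rmorph1 mul1r.
  rewrite -/z0 addrCA [_ - z0]addrC addKr; apply: last_freeD => //.
  apply: last_free_sum => k _; apply: last_freeM; first exact: last_freeC.
  by rewrite subn0; apply: last_free_exp.
transitivity (\sum_j theta_mx w a s j ord0 * cofactor (theta_mx w a s) j ord0).
  exact: expand_det_col.
rewrite (bigD1 ord_max) //=.
by rewrite -/(theta_minor w a s) addrCA addrC -mulrDl addrCA subrr addr0.
Qed.

End ThetaLastVariable.

(** * The theta polynomial and the Abel map *)

Section AbelPoints.
Variables (F : numClosedFieldType) (n : nat).
Variables (w : 'I_n.+1 -> nat) (a : 'I_n.+1 -> nat -> F).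
Hypothesis gapS : gap_system w a.
Hypothesis w0 : w ord0 = 1%N.
Let N := w ord_max.
Local Notation W := (gapf w a (@idfun F : {rmorphism F -> F})).
Local Notation eqN p q := (forall l, (l <= N)%N -> (p : {poly F})`_l = (q : {poly F})`_l).

(** Missing roots are supplied by c_k = 0, which corresponds to the base point u = 0. *)
Lemma factor_inverse_roots m (p : {poly F}) : (size p <= m.+1)%N -> p`_0 = 1 ->
  exists c : 'I_m -> F, p = \prod_k (1 - c k *: 'X).
Proof.
elim: m p => [|m IH] p sp p0.
  by exists (fun=> 0); rewrite big_ord0 [p]size1_polyC // p0.
have [|sp1] := leqP (size p) 1.
  move=> p1; exists (fun=> 0); rewrite [p]size1_polyC // p0 big1 // => k _.
  by rewrite scale0r subr0.
have [z /factor_theorem [q qE]] := closed_rootP p (negbT (gtn_eqF sp1)).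
have z0 : z != 0.
  apply/eqP => z0; move: p0; rewrite qE z0 subr0 coefMX => /eqP.
  by rewrite eq_sym oner_eq0.
have q0 : q != 0.
  by apply: contraTneq sp1 => e; rewrite qE e mul0r size_poly0.
(* Since q (X - z) = (- z q)(1 - X / z), the new factor contributes c = 1/z and the cofactor keeps
   constant term 1. *)
have [||c cE] := IH (- z *: q).
- move: sp; rewrite qE size_mul ?polyXsubC_eq0 // size_XsubC addn2 /= ltnS.
  exact: leq_trans (size_scale_leq _ _).
- by move: p0; rewrite qE mulrBr coefB coefMX coefMC coefZ /= sub0r mulNr mulrC.
exists (fun k => if unlift ord0 k is Some i then c i else z^-1).
rewrite big_ord_recl unlift_none; under eq_bigr => i _ do rewrite liftK.
rewrite -cE qE mulrC -scalerAr scalerAl; congr (_ * _).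
by rewrite scalerBr scalerA mulNr mulfV // scaleN1r scaleNr -mul_polyC mulr1 opprK addrC.
Qed.

(** Minus the logarithm of [abel_den c], truncated. The convention 1/0 = 0 removes the term l =
    0. *)
Definition abel_series (c : 'I_n -> F) : {poly F} :=
  \poly_(l < N.+1) \sum_k c k ^+ l / l%:R.

(** Sum of the integrals from 0 to c_k of omega_j, the differential with coefficients a_j(l)
    u^(l-1). *)
Definition abel_pt (c : 'I_n -> F) (j : 'I_n.+1) : F :=
  \sum_k \sum_(l < (w j).+1) a j l / l%:R * c k ^+ l.

Lemma gap_coef_le j l : (l <= w j)%N -> (l <= N)%N.
Proof. by move=> lj; apply: leq_trans lj (gap_ltn_max gapS j). Qed.

Lemma abel_ptE c j : abel_pt c j = W j (abel_series c).
Proof.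
rewrite /abel_pt exchange_big; apply: eq_bigr => l _ /=.
have lj : (l <= w j)%N by rewrite -ltnS.
rewrite coef_poly ltnS (gap_coef_le lj) mulr_sumr.
by apply: eq_bigr => k _; rewrite mulrCA mulrC mulrA.
Qed.

Definition abel_den (c : 'I_n -> F) : {poly F} := \prod_k (1 - c k *: 'X).

Lemma abel_den_size c : (size (abel_den c) <= n.+1)%N.
Proof.
rewrite /abel_den (leq_trans (size_poly_prod_leq _ _)) // cardT size_enum_ord.
have : (\sum_(k < n) size (1 - c k *: 'X)%R <= \sum_(k < n) 2)%N.
  apply: leq_sum => k _; rewrite (leq_trans (size_polyD _ _)) // geq_max.
  by rewrite size_poly1 size_polyN (leq_trans (size_scale_leq _ _)) // size_polyX.
rewrite sum_nat_const card_ord leq_subLR => h.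
by rewrite addnS addnn -muln2; exact: h.
Qed.

Lemma abel_den0 c : (abel_den c)`_0 = 1.
Proof.
rewrite -horner_coef0 horner_prod big1 // => k _.
by rewrite !(hornerE, mulr0, oppr0, addr0).
Qed.

Lemma eqN_mull p q r : eqN p q -> eqN (p * r) (q * r).
Proof. exact: coefM_eq_low. Qed.

Lemma eqN_mulr p q r : eqN p q -> eqN (r * p) (r * q).
Proof. by move=> e; rewrite ![r * _]mulrC; apply: eqN_mull. Qed.

Lemma abel_series0 c : (abel_series c)`_0 = 0.
Proof. by rewrite coef_poly /= big1 // => k _; rewrite invr0 mulr0. Qed.

Lemma euler_abel_den c : eqN (euler (abel_den c)) (- (euler (abel_series c) * abel_den c)).
Proof.
pose y k := \poly_(l < N.+1) (c k ^+ l / l%:R).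
have yu k : eqN (euler (1 - c k *: 'X)) (- (euler (y k) * (1 - c k *: 'X))).
  move=> l lN; rewrite coef_euler coefN mulrBr mulr1 -scalerAr !coefB !coefZ coefMX.
  rewrite !coef_euler coef1 coefX !coef_poly ltnS lN.
  have ll m x : m.+1%:R * (x / m.+1%:R) = x :> F by rewrite mulrC divfK ?pnatr_eq0.
  case: l lN => [|[|l]] lN /=; first by rewrite !mul0r mulr0 subr0 oppr0.
    by rewrite !ll mul0r mulr0 subr0 sub0r mul1r mulr1 expr1.
  by rewrite ltnW // !ll mulr0 subr0 mulr0 -exprS subrr oppr0.
have ser : euler (abel_series c) = \sum_k euler (y k).
  apply/polyP => l; rewrite coef_euler coef_sum coef_poly.
  case: ifP => lN; last by rewrite mulr0 big1 // => k _; rewrite coef_euler coef_poly lN mulr0.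
  by rewrite mulr_sumr; apply: eq_bigr => k _; rewrite coef_euler coef_poly lN.
rewrite ser /abel_den.
have := (big_rec2 (fun (S Q : {poly F}) => eqN (euler Q) (- (S * Q)))); apply.
  by move=> l _; rewrite coef_euler mul0r oppr0 coef0 coef1; case: l => [|l]; rewrite ?mul0r ?mulr0.
move=> k S Q _ e l lN; rewrite eulerM [(_ + S) * _]mulrDl opprD !coefD; congr (_ + _).
  by rewrite mulrA -mulNr; apply: eqN_mull => // i; apply: yu.
by rewrite [S * _]mulrCA -mulrN; apply: eqN_mulr.
Qed.

Section Point.
Variables (z : 'I_n.+1 -> F) (e : nat -> F).
Hypothesis eP : exp_rec (fun i => \sum_(j | w j == i) z j) e N.

Let xz : {poly F} := \sum_j z j *: 'X^(w j).

Lemma gapf_point j : W j xz = z j.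
Proof.
rewrite gapf_sum (bigD1 j) //= gapfZ (gapfXn gapS) /= (gap_delta gapS) eqxx mulr1.
rewrite big1 ?addr0 // => i ij; rewrite gapfZ (gapfXn gapS) /= (gap_delta gapS).
by rewrite eq_sym (negPf ij) mulr0.
Qed.

Let xzE i : xz`_i = \sum_(j | w j == i) z j.
Proof.
rewrite coef_sum [RHS]big_mkcond; apply: eq_bigr => j _.
by rewrite coefZ coefXn eq_sym; case: eqP => _; rewrite ?mulr1 ?mulr0.
Qed.

Let E : {poly F} := gexp w e.

(** As [xz] is the logarithm of E, E times [abel_den c] is the exponential of the difference of the
    two logarithms. *)
Lemma point_exp_rec c :
  exp_rec (fun i => (xz - abel_series c)`_i) (fun i => (E * abel_den c)`_i) N.
Proof.
have [e0 eN] := eP.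
have EP : eqN (euler E) (euler xz * E).
  apply: exp_rec_euler; split=> [|k kN]; first by rewrite coef_poly /= e0.
  rewrite coef_poly ltnS kN eN //; apply: eq_bigr => i _.
  by rewrite xzE coef_poly ltnS (leq_trans (leq_subr _ _)).
apply: exp_recP => [|l lN].
  by rewrite coef0M coef_poly /= e0 mul1r abel_den0.
rewrite eulerM coefD (eqN_mull _ EP) // (eqN_mulr _ (euler_abel_den c)) // -coefD.
apply: (congr1 (fun q : {poly F} => q`_l)); rewrite /euler derivB; ring.
Qed.

Lemma point_diff0 c : (xz - abel_series c)`_0 = 0.
Proof.
rewrite coefB abel_series0 subr0 xzE big1 // => j /eqP wj.
by have := gap_gt0 gapS w0 j; rewrite wj.
Qed.

Let W1 j : W j 1 = 0.
Proof. by rewrite -(expr0 'X) (gapfXn gapS) /= (gap_0 gapS). Qed.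

Let Wexp (y : {poly F}) : (forall j, W j y = 0) -> forall k j, W j (y ^+ k) = 0.
Proof.
move=> Wy; elim=> [|k IH] j; first by rewrite expr0 W1.
by rewrite exprS (gapf_mul gapS).
Qed.

(** The logarithm of E [abel_den c] lies in the kernel, and so does its truncated exponential, a
    polynomial in it. *)
Lemma abel_kernel c : z =1 abel_pt c -> forall j, W j (E * abel_den c) = 0.
Proof.
move=> zE; have y0 := point_diff0 c; set y := xz - _ in y0.
have Wy j : W j y = 0 by rewrite gapfB gapf_point zE abel_ptE subrr.
have eq := exp_rec_uniq (@idfun F : {rmorphism F -> F}) (point_exp_rec c)
  (exp_truncP (@idfun F : {rmorphism F -> F}) N y0).
move=> j; rewrite (gapf_eq _ _ (y' := exp_trunc (@idfun F : {rmorphism F -> F}) N y)).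
  rewrite gapf_sum big1 // => k _; rewrite mul_polyC gapfZ Wexp ?mulr0 //.
by move=> k /gap_coef_le /eq.
Qed.

(** The converse uses the logarithm of v = E [abel_den c]: it is a polynomial in 1 - v up to the
    truncation, so it lies in the kernel ring. *)
Lemma kernel_abel c : (forall j, W j (E * abel_den c) = 0) -> z =1 abel_pt c.
Proof.
move=> Wv; have y0 := point_diff0 c; set y := xz - _ in y0.
have yv := exp_rec_euler (point_exp_rec c); rewrite -/y in yv.
set v := E * _ in Wv yv.
have v0 : v`_0 = 1 by have [-> _] := point_exp_rec c.
pose u := 1 - v.
have u0 : u`_0 = 0 by rewrite coefB coef1 v0 subrr.
have Wu j : W j u = 0 by rewrite gapfB W1 Wv subrr.
(* Truncated logarithm of v = 1 - u. It will agree with y up to degree N because t y1' v and t y' v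
   both equal t v' there, v is invertible, and both constant terms are 0. *)
pose y1 := - \sum_(k < N) k.+1%:R^-1 *: u ^+ k.+1.
have Wy1 j : W j y1 = 0.
  rewrite gapfN gapf_sum big1 ?oppr0 // => k _; rewrite gapfZ Wexp ?mulr0 //.
have ey1 : euler y1 = (\sum_(k < N) u ^+ k) * euler v.
  rewrite /euler derivN raddf_sum /= -sumrN mulr_sumr mulr_suml; apply: eq_bigr => k _.
  rewrite derivZ deriv_exp /= -scaler_nat scalerA mulVf ?pnatr_eq0 // scale1r.
  by rewrite /u derivB -polyC1 derivC; ring.
have y1v : eqN (euler y1 * v) (euler y * v).
  move=> l lN; rewrite -yv // ey1.
  (* Geometric sum times v = 1 - u; the remainder u^N t v' has order at least N + 1. *)
  have -> : (\sum_(k < N) u ^+ k) * euler v * v = euler v - u ^+ N * euler v.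
    have := subrX1 u N; rewrite (_ : u - 1 = - v) ?mulNr; last by rewrite /u addrAC subrr add0r.
    by move=> h; rewrite -[u ^+ N](subrK 1) h; ring.
  rewrite coefB [X in _ - X](coefM_order (m := N) (l := 1)) ?subr0 //.
  - by move=> i iN; apply: coefX_order.
  - by case=> // _; rewrite coef_euler mul0r.
  by rewrite addn1 ltnS.
have cancel (d : {poly F}) : eqN (d * v) 0 -> eqN d 0.
  move=> dv; elim/ltn_ind => l IH lN; have := dv l lN.
  rewrite coefM big_ord_recr /= subnn v0 mulr1 big1 ?add0r // => k _.
  by rewrite IH ?coef0 ?mul0r // (leq_trans (ltnW (ltn_ord k))).
have yy1 : eqN y1 y.
  have d0 : eqN (euler y1 - euler y) 0.
    by apply: cancel => l lN; rewrite mulrBl coefB y1v // subrr coef0.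
  move=> [|l] lN.
    rewrite y0 coefN coef_sum big1 ?oppr0 // => k _.
    by rewrite coefZ coefX_order ?mulr0.
  have := d0 _ lN; rewrite coefB coef0 !coef_euler -mulrBr => /eqP.
  by rewrite mulf_eq0 pnatr_eq0 /= subr_eq0 => /eqP.
move=> j; apply/eqP; rewrite -subr_eq0 -gapf_point abel_ptE -gapfB; apply/eqP.
by rewrite -[RHS](Wy1 j); apply: gapf_eq => k /gap_coef_le kN; rewrite yy1.
Qed.

End Point.
End AbelPoints.

(** * Divisibility by a polynomial that is linear in one variable *)

Lemma dvd_coprime_unit_lead (B : idomainType) (T m p q : {poly B}) d :
  lead_coef T \is a GRing.unit -> coprimep T m -> m ^+ d * p = T * q ->
  exists q', p = T * q'.
Proof.
move=> uT cop e.
have : T %| m ^+ d * p by rewrite e; apply: Pdiv.Idomain.dvdp_mulr; apply: Pdiv.Idomain.dvdpp.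
rewrite Pdiv.Idomain.Gauss_dvdpr ?Pdiv.Idomain.coprimep_expr //.
(* Over a domain [%|] allows a constant factor; the invertible leading coefficient of T turns it
   into division in B[X]. *)
by move=> /(Pdiv.IdomainUnit.dvdpP uT)[q' ->]; exists q'; rewrite mulrC.
Qed.

Lemma coprime_bezout (B : idomainType) (T m : {poly B}) : coprimep T m ->
  exists u v (rho : B), rho != 0 /\ u * T + v * m = rho%:P.
Proof.
move=> /Pdiv.Idomain.Bezout_coprimepP[[u v] /= /Pdiv.Idomain.eqpP[[c1 c2] /= /andP[c10 c20] e]].
exists (c1 *: u), (c1 *: v), c2; split=> //.
by rewrite -!scalerAl -scalerDr e -mul_polyC mulr1.
Qed.

Lemma rmorph_bezout0 (A B : nzRingType) (f : {rmorphism A -> B}) (u t v m c : A) :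
  u * t + v * m = c -> f t = 0 -> f m = 0 -> f c = 0.
Proof. by move=> <- ft fm; rewrite rmorphD !rmorphM /= ft fm !mulr0 addr0. Qed.

(* Substitutes X = - r / m, with denominators cleared. *)
Lemma pseudo_subst (B : comNzRingType) (x m r : B) (p : {poly B}) :
  exists q, m ^+ (size p) * p.[x] =
    (x * m + r) * q + \sum_(i < size p) p`_i * (- r) ^+ i * m ^+ (size p - i).
Proof.
have term i : exists q, p`_i * ((m * x) ^+ i - (- r) ^+ i) = (x * m + r) * q.
  rewrite subrXX opprK; set S := \sum_(_ < i) _; exists (p`_i * S); ring.
have /choice[f fP] := term.
exists (\sum_(i < size p) f i * m ^+ (size p - i)).
rewrite horner_coef !mulr_sumr -big_split; apply: eq_bigr => i _ /=.
rewrite mulrA -fP -{1}(subnK (ltnW (ltn_ord i))) exprD exprMn.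
by ring.
Qed.

Lemma pseudo_subst_eval (B : comNzRingType) (L : fieldType) (f : {rmorphism B -> L})
    (m r : B) (p : {poly B}) : f m != 0 -> (map_poly f p).[- f r / f m] = 0 ->
  f (\sum_(i < size p) p`_i * (- r) ^+ i * m ^+ (size p - i)) = 0.
Proof.
move=> fm; rewrite (horner_coef_wide _ (size_poly _ _)) => p0.
rewrite -[RHS](mulr0 (f m ^+ size p)) -[X in _ = _ * X]p0 mulr_sumr rmorph_sum.
apply: eq_bigr => i _; rewrite !rmorphM !rmorphXn rmorphN /= coef_map /=.
have -> : f m ^+ size p = f m ^+ (size p - i) * f m ^+ i.
  by rewrite -exprD subnK // ltnW.
rewrite exprMn exprVn; have mi : f m ^+ i != 0 by rewrite expf_neq0.
by field.
Qed.

Section MpolyConstants.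
Variables (F : numClosedFieldType) (n : nat).
Local Notation P := (mpoly_ring F n).
Local Notation mC := (@mpoly.mpolyC n F : F -> P).

Lemma mpoly_unit_const (p q : P) : p * q = 1 -> exists c, p = mC c.
Proof.
rewrite mulrC => /mpoly.mpoly_intro_unit /andP[/eqP e _].
by exists (mpoly.mcoeff mpoly.mnm0 p).
Qed.

Lemma split_var_dvd k (q p : P) q' : split_var k p = split_var k q * q' ->
  p = q * q'.[mpoly.mpolyX F (mpoly.mnm1 k)].
Proof. by move=> e; rewrite -{1}[p](horner_split_var k) e hornerM horner_split_var. Qed.

Lemma split_var_dvd_coprime k (t m p q : P) d : lead_coef (split_var k t) \is a GRing.unit ->
  coprimep (split_var k t) (split_var k m) -> m ^+ d * p = t * q ->
  exists q', p = t * q'.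
Proof.
move=> u cop /(congr1 (split_var k)); rewrite !rmorphM rmorphXn /= => e.
have [q' /split_var_dvd ->] := dvd_coprime_unit_lead u cop e.
by exists q'.[mpoly.mpolyX F (mpoly.mnm1 k)].
Qed.

Lemma split_var_const (p : P) k : (size (split_var k p) <= 1)%N ->
  forall z s, mpoly.meval (upd_coord z k s) p = mpoly.meval z p.
Proof.
move=> sp z s; rewrite -(meval_split_var k z s p).
rewrite -(mpoly.meval_eq p (upd_coord_id z k)) -(meval_split_var k z (z k) p).
by rewrite (size1_polyC sp) map_polyC !hornerC.
Qed.

Lemma nonconst_split_var (p : P) : (forall c, p != mC c) ->
  exists k, (1 < size (split_var k p))%N.
Proof.
move=> pc; apply: contrapT => no.
have sz k : (size (split_var k p) <= 1)%N.
  by rewrite leqNgt; apply/negP => h; apply: no; exists k.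
pose part k (z : 'I_n -> F) : 'I_n -> F := fun i => if (i < k)%N then z i else 0.
have pt z k : (k <= n)%N -> mpoly.meval (part k z) p = mpoly.meval (fun=> 0) p.
  elim: k => [_|k IH kn]; first by apply: mpoly.meval_eq.
  rewrite -IH ?(ltnW kn) // -[RHS](split_var_const (sz (Ordinal kn)) _ (z (Ordinal kn))).
  apply: mpoly.meval_eq => i; rewrite /part /upd_coord ltnS leq_eqVlt -val_eqE /=.
  by case: eqP => //= e; congr (z _); apply: val_inj.
have := pc (mpoly.meval (fun=> 0) p); rewrite -subr_eq0 => /eqP; apply.
apply: mpoly_eval_eq0 => z; rewrite rmorphB /= mpoly.mevalC -(pt z n (leqnn n)).
apply/eqP; rewrite subr_eq0; apply/eqP; apply: mpoly.meval_eq => i.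
by rewrite /part ltn_ord.
Qed.

(** Where the leading coefficient is nonzero the specialized polynomial keeps its degree and has a
    root; [c] is an open condition preserved by the choice of z. *)
Lemma split_var_root (p c : P) k : (1 < size (split_var k p))%N -> c != 0 ->
  exists z s, mpoly.meval z c != 0 /\ mpoly.meval (upd_coord z k s) p = 0.
Proof.
move=> sp c0; have lc0 : c * lead_coef (split_var k p) != 0.
  by rewrite mulf_neq0 // lead_coef_eq0 -size_poly_gt0 ltnW.
have [z] := mpoly_exists_nonroot lc0; rewrite rmorphM mulf_eq0 => /norP[zc zl].
have sz : size (map_poly (mpoly.meval z) (split_var k p)) != 1%N.
  by rewrite size_poly_eq // gtn_eqF.
have [s] := closed_rootP _ sz; rewrite rootE meval_split_var => /eqP zs.
by exists z, s.
Qed.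

Lemma nonconst_root (p : P) : (forall c, p != mC c) -> exists z, mpoly.meval z p = 0.
Proof.
move=> /nonconst_split_var[k sp].
have [z [s [_ zs]]] := split_var_root sp (oner_neq0 _).
by exists (upd_coord z k s).
Qed.

End MpolyConstants.

Section LinearFactor.
Variables (F : numClosedFieldType) (n : nat).
Local Notation P := (mpoly_ring F n).
Local Notation mX i := (mpoly.mpolyX F (mpoly.mnm1 i) : P).
Local Notation mC := (@mpoly.mpolyC n F : F -> P).
Local Notation ev := mpoly.meval.
Variables (k0 k1 : 'I_n) (t m r : P).
Hypothesis m_free : split_var k1 m = m%:P.
Hypothesis r_free : split_var k1 r = r%:P.
Hypothesis tE : t = mX k1 * m + r.
Hypothesis m_neq0 : m != 0.
Hypothesis t_lead : lead_coef (split_var k0 t) \is a GRing.unit.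
Hypothesis tm_cop : coprimep (split_var k0 t) (split_var k0 m).

Let free_eval (p : P) z u : split_var k1 p = p%:P -> ev (upd_coord z k1 u) p = ev z p.
Proof. by move=> h; rewrite -meval_split_var h map_polyC hornerC. Qed.

Lemma linear_eval z u : ev (upd_coord z k1 u) t = u * ev z m + ev z r.
Proof.
by rewrite tE rmorphD rmorphM /= mpoly.mevalXU !free_eval // /upd_coord eqxx.
Qed.

(** Substituting - r / m for the variable [k1] leaves a remainder H that vanishes wherever c m does
    not, hence is 0. Then m^d p = t q, and m^d is removed by coprimality. The factor [c] allows the
    hypothesis to hold at generic points only. *)
Lemma linear_dvd (c p : P) : c != 0 ->
  (forall z u, ev z c != 0 -> ev z m != 0 -> ev (upd_coord z k1 u) t = 0 ->
     ev (upd_coord z k1 u) p = 0) ->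
  exists q, p = t * q.
Proof.
move=> c0 pP; have [q] := pseudo_subst (mX k1) m r (split_var k1 p).
rewrite horner_split_var -tE; set H := \sum_(_ < _) _ => pE.
suff H0 : H = 0.
  by apply: (split_var_dvd_coprime t_lead tm_cop (d := size (split_var k1 p)) (q := q));
    rewrite pE H0 addr0.
suff : H * (c * m) = 0 by move/eqP; rewrite !mulf_eq0 (negPf c0) (negPf m_neq0) !orbF => /eqP.
apply: mpoly_eval_eq0 => z; rewrite !rmorphM /=.
have [e|zm] := eqVneq (ev z m) 0; first by rewrite e !mulr0.
have [e|zc] := eqVneq (ev z c) 0; first by rewrite e mul0r mulr0.
have := pP z (- ev z r / ev z m) zc zm; rewrite linear_eval divfK // addNr => /(_ erefl).
rewrite -meval_split_var => /(pseudo_subst_eval zm) e.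
have -> : ev z H = 0 by exact: e.
exact: mul0r.
Qed.

(** Zeros of a nonconstant q are zeros of t. The contradiction depends on the variables that q
    involves: [k1], or [k0] but not [k1], or neither. *)
Lemma linear_cofactor_const (f q : P) : (forall c, t != mC c) ->
  (forall q' r', f = q' * q' * r' -> exists c, q' = mC c) ->
  (forall z, ev z f = 0 -> ev z t = 0) -> f = t * q -> exists c, q = mC c.
Proof.
move=> t_nc f_red f_zero fE; apply: contrapT => no.
have q_nc c : q != mC c by apply/negP => /eqP e; apply: no; exists c.
have qz z : ev z q = 0 -> ev z t = 0.
  by move=> z0; apply: f_zero; rewrite fE rmorphM /= z0 mulr0.
have [sq1|sq1] := ltnP 1 (size (split_var k1 q)).
  have lq0 : lead_coef (split_var k1 q) != 0.
    by rewrite lead_coef_eq0 -size_poly_gt0 ltnW.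
  (* For generic z, q has a root in the direction [k1]; it must be the only zero u of the linear
     polynomial t. So q vanishes on generic zeros of t, t divides q, and t^2 divides f. *)
  have [|q' qE] := @linear_dvd (lead_coef (split_var k1 q)) q lq0.
    move=> z u zc zm zt.
    have sz : size (map_poly (ev z) (split_var k1 q)) != 1%N by rewrite size_poly_eq // gtn_eqF.
    have [u'] := closed_rootP _ sz; rewrite rootE meval_split_var => /eqP u'q.
    suff -> : u = u' by [].
    apply: (mulIf zm); apply: (addIr (ev z r)).
    by rewrite -!linear_eval zt qz.
  have [c tc] : exists c, t = mC c.
    by apply: (f_red t q'); rewrite fE qE mulrA.
  by have := t_nc c; rewrite tc eqxx.
have q_free z u := split_var_const sq1 z u.
have [sq0|sq0] := ltnP 1 (size (split_var k0 q)).
  (* Along the direction [k1] the zero set of q is a union of lines, on which t vanishes; so m and r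
     vanish there. Bezout then forces rho to vanish, against the choice of z. *)
  have [u [v [rho [rho0 bez]]]] := coprime_bezout tm_cop.
  have [z [s [zrho zq]]] := split_var_root sq0 rho0.
  set y := upd_coord z k0 s in zq.
  have yt x : x * ev y m + ev y r = 0.
    by rewrite -linear_eval; apply: qz; rewrite q_free.
  have ym : ev y m = 0.
    by have := yt 1; have := yt 0; rewrite mul0r add0r => ->; rewrite mul1r addr0.
  pose f0 : {rmorphism {poly P} -> F} := horner_eval s \o map_poly (ev z).
  have f0E x : f0 (split_var k0 x) = ev y x by exact: meval_split_var.
  have f0C x : f0 x%:P = ev z x by rewrite /f0 /= horner_evalE map_polyC hornerC.
  have := rmorph_bezout0 bez (etrans (f0E t) (qz y zq)) (etrans (f0E m) ym).
  by rewrite f0C => e; rewrite e eqxx in zrho.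
(* Now t vanishes on a line in the direction [k0], although its leading coefficient in that variable
   is a unit. *)
have [z zq] := nonconst_root q_nc.
have tz s : (map_poly (ev z) (split_var k0 t)).[s] = 0.
  by rewrite meval_split_var; apply: qz; rewrite (split_var_const sq0).
have : map_poly (ev z) (split_var k0 t) = 0.
  apply/eqP/negPn/negP => /(exists_nonroot (@idfun F : {rmorphism F -> F}))[s].
  by rewrite tz eqxx.
move=> /(congr1 (fun h : {poly F} => h`_(size (split_var k0 t)).-1)).
rewrite coef_map -lead_coefE coef0 /= => e.
have := rmorph_unit (ev z) t_lead; rewrite unitfE => /eqP; apply.
exact: e.
Qed.

End LinearFactor.

(** * The ideal of the image of the Abel map *)

Section ThetaIdeal.
Variables (F : numClosedFieldType) (n : nat).
Variables (w : 'I_n.+1 -> nat) (a : 'I_n.+1 -> nat -> F).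
Local Notation P := (mpoly_ring F n.+1).
Local Notation mX i := (mpoly.mpolyX F (mpoly.mnm1 i) : P).
Local Notation mC := (@mpoly.mpolyC n.+1 F : F -> P).
Variable s : nat -> P.
Hypothesis gapS : gap_system w a.
Hypothesis w0 : w ord0 = 1%N.
Hypothesis sP : forall N, exp_rec (gap_monomials F w) s N.
Local Notation phi := (@split_var F n.+1 ord0).
Local Notation T := (theta_poly w a s).
Local Notation m := (theta_minor w a s).
Local Notation ev := mpoly.meval.
Local Notation Mz z := (gapmx w a (@idfun F : {rmorphism F -> F}) (gexp w (ev z \o s))).

Lemma gapmx_meval_io (z : 'I_n.+1 -> F) (E : {poly F}) :
  gapmx w a (ev z \o mC : {rmorphism F -> F}) E =
  gapmx w a (@idfun F : {rmorphism F -> F}) E.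
Proof.
apply/matrixP => i j; rewrite !mxE; apply: eq_bigr => k _ /=.
by rewrite mpoly.mevalC.
Qed.

Lemma meval_theta z : ev z T = \det (Mz z).
Proof. by rewrite -(gapmx_meval_io z); exact: det_gapmx_map. Qed.

Lemma meval_theta_minor z : ev z m = cofactor (Mz z) ord_max ord0.
Proof. by rewrite -(gapmx_meval_io z); exact: cofactor_gapmx_map. Qed.

Lemma exp_rec_meval (z : 'I_n.+1 -> F) N :
  exp_rec (fun i => \sum_(j | w j == i) z j) (ev z \o s) N.
Proof.
have [e0 eP] := exp_rec_rmorph (ev z) (sP N); split=> // k /eP ->.
apply: eq_bigr => i _; rewrite /= rmorph_sum; congr (_ * _ * _).
by apply: eq_bigr => j _; rewrite /= mpoly.mevalXU.
Qed.

Lemma theta_eval_abel c : ev (abel_pt w a c) T = 0.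
Proof.
rewrite meval_theta.
have K := abel_kernel gapS w0 (exp_rec_meval (abel_pt w a c) (w ord_max))
  (fun _ => erefl _).
apply/eqP; rewrite -det_tr; apply/det0P; exists (poly_rV (abel_den c)).
  apply/eqP => /(congr1 (fun v : 'rV_n.+1 => v 0 ord0)); rewrite !mxE /=.
  by rewrite abel_den0 => /eqP; rewrite oner_eq0.
apply/rowP => j; rewrite !mxE -[RHS](K j) (gapf_rVpoly w a _ _ j (abel_den_size c)).
by apply: eq_bigr => i _; rewrite mxE [_^T _ _]mxE.
Qed.

Lemma theta_zero_abel z : ev z T = 0 -> ev z m != 0 -> exists c, z =1 abel_pt w a c.
Proof.
rewrite meval_theta meval_theta_minor => /eqP; set M := Mz z.
rewrite -det_tr => /det0P[v v0 vM] m0.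
have Mv j : \sum_i v 0 i * M j i = 0.
  have := congr1 (fun u : 'rV_n.+1 => u 0 j) vM; rewrite !mxE => e.
  by rewrite -[RHS]e; apply: eq_bigr => i _; rewrite [_^T _ _]mxE.
(* Otherwise the remaining coordinates of v would be a kernel vector of the minor. *)
have v00 : v 0 ord0 != 0.
  apply: contra m0 => /eqP v00; rewrite /cofactor mulf_eq0 signr_eq0 /=.
  rewrite -det_tr; apply/det0P; exists (\row_(i < n) v 0 (lift ord0 i)).
    apply: contra v0 => /eqP e; apply/eqP/rowP => i; rewrite mxE.
    case: (unliftP ord0 i) => [i' ->|->//].
    by have := congr1 (fun u : 'rV_n => u 0 i') e; rewrite !mxE.
  apply/rowP => j; rewrite mxE [RHS]mxE -[RHS](Mv (lift ord_max j)).
  rewrite [RHS]big_ord_recl v00 mul0r add0r; apply: eq_bigr => i _.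
  by rewrite !mxE.
pose p := (v 0 ord0)^-1 *: rVpoly v.
have sp : (size p <= n.+1)%N.
  by rewrite (leq_trans (size_scale_leq _ _)) // size_poly.
have [|c pE] := factor_inverse_roots sp.
  by rewrite coefZ (coef_rVpoly_ord v ord0) mulVf.
exists c; apply: (kernel_abel gapS w0 (exp_rec_meval z _)) => j.
have -> : abel_den c = p by [].
rewrite (gapf_rVpoly w a _ _ j sp) -[RHS](mulr0 (v 0 ord0)^-1) -[X in _ = _ * X](Mv j) mulr_sumr.
by apply: eq_bigr => i _; rewrite coefZ coef_rVpoly_ord mulrA.
Qed.

Lemma theta_split_neq0 z : map_poly (ev z) (phi T) != 0.
Proof.
have [c c0 cE] := theta_lead gapS w0 sP.
apply/negP => /eqP/(congr1 (fun q : {poly F} => q`_(size (phi T)).-1)).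
by rewrite coef_map -lead_coefE cE coef0 /= mpoly.mevalC => /eqP; rewrite (negPf c0).
Qed.

Lemma theta_neq0 : T != 0.
Proof.
apply/negP => /eqP e; have := theta_split_neq0 (fun=> 0).
by rewrite e raddf0 map_poly0 eqxx.
Qed.

Lemma theta_lead_unit : lead_coef (phi T) \is a GRing.unit.
Proof.
have [c c0 ->] := theta_lead gapS w0 sP.
by rewrite rmorph_unit // unitfE.
Qed.

Let cop : coprimep (phi T) (phi m).
Proof. exact: theta_coprime gapS w0 sP theta_neq0. Qed.

Lemma theta_nonconst c : T != mC c.
Proof.
apply/negP => /eqP e; have := theta_eval_abel (fun=> 0); rewrite e mpoly.mevalC => c0.
by have := theta_neq0; rewrite e c0 raddf0 eqxx.
Qed.

(** If m were 0, coprimality would leave T without the first variable, hence equal to its constant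
    leading coefficient. *)
Lemma theta_minor_neq0 : m != 0.
Proof.
apply/negP => /eqP e; have := cop; rewrite e raddf0 coprimep0 => /Pdiv.Idomain.eqpP.
case=> -[c1 c2] /= /andP[c10 c20] h.
have sz : (size (phi T) <= 1)%N.
  by rewrite -(size_scale _ c10) h -mul_polyC mulr1 size_polyC_leq1.
have [c cn cE] := theta_lead gapS w0 sP.
have := theta_nonconst c; rewrite -(horner_split_var ord0 T) (size1_polyC sz) hornerC.
have -> : (phi T)`_0 = lead_coef (phi T); last by rewrite cE eqxx.
by rewrite lead_coefE; case: (size (phi T)) sz => [|[|]].
Qed.

Lemma theta_dvd p : (forall c, ev (abel_pt w a c) p = 0) -> exists q, p = T * q.
Proof.
move=> pA; have [mP [r rP TE]] := theta_last gapS w0 sP.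
apply: (linear_dvd mP rP TE theta_minor_neq0 theta_lead_unit cop (oner_neq0 _)).
move=> z u _ zm zT; have zm' : ev (upd_coord z ord_max u) m != 0.
  by rewrite -meval_split_var (mP : split_var _ _ = _) map_polyC hornerC.
have [c cE] := theta_zero_abel zT zm'.
by rewrite (mpoly.meval_eq _ cE).
Qed.

Definition abel_mpoly (j : 'I_n.+1) : mpoly_ring F n :=
  \sum_k \sum_(l < (w j).+1)
    (a j l / l%:R) *: (mpoly.mpolyX F (mpoly.mnm1 k) : mpoly_ring F n) ^+ l.

Lemma abel_mpolyE c p :
  mpoly.meval c (mpoly.mmap (@mpoly.mpolyC n F) abel_mpoly p) = ev (abel_pt w a c) p.
Proof.
apply: (mpoly_rmorph_eq (f := mpoly.meval c \o mpoly.mmap (@mpoly.mpolyC n F) abel_mpoly)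
  (g := ev (abel_pt w a c))).
  by move=> b; rewrite /= mpoly.mmapC !mpoly.mevalC.
move=> j; rewrite /= mpoly.mmapX mpoly.mmap1U mpoly.mevalXU rmorph_sum.
apply: eq_bigr => k _; rewrite rmorph_sum; apply: eq_bigr => l _ /=.
by rewrite mpoly.mevalZ rmorphXn /= mpoly.mevalXU.
Qed.

(** Pulled back along the polynomial map [abel_mpoly], the product vanishes in a polynomial ring,
    which is a domain. *)
Lemma abel_vanish_prime q r : (forall c, ev (abel_pt w a c) (q * r) = 0) ->
  (forall c, ev (abel_pt w a c) q = 0) \/ (forall c, ev (abel_pt w a c) r = 0).
Proof.
pose h := mpoly.mmap (@mpoly.mpolyC n F) abel_mpoly => qr.
have : h q * h r = 0.
  rewrite -rmorphM; apply: mpoly_eval_eq0 => c; rewrite abel_mpolyE; exact: qr.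
move=> /eqP; rewrite mulf_eq0 => /orP[]/eqP e; [left|right] => c.
  by rewrite -abel_mpolyE [mpoly.mmap _ _ _]e raddf0.
by rewrite -abel_mpolyE [mpoly.mmap _ _ _]e raddf0.
Qed.

(** One of q and r vanishes on the image, hence is a multiple of T. For q, cancelling T gives 1 = q'
    q r, absurd at a point of the image; for r, it makes q a unit. *)
Lemma theta_reduced q r : T = q * q * r -> exists c, q = mC c.
Proof.
move=> TE.
have [qqA|rA] := @abel_vanish_prime (q * q) r
  (fun c => etrans (congr1 _ (esym TE)) (theta_eval_abel c)).
  have qA c : ev (abel_pt w a c) q = 0.
    by have /eqP := qqA c; rewrite rmorphM mulf_eq0 orbb => /eqP.
  have [q' qE] := theta_dvd qA; exfalso.
  have : T * (1 - q' * q * r) = 0.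
    by rewrite mulrBr mulr1 {1}TE {1}qE !mulrA subrr.
  move=> /eqP; rewrite mulf_eq0 (negPf theta_neq0) subr_eq0 => /eqP e.
  have := congr1 (ev (abel_pt w a (fun=> 0))) e.
  rewrite rmorph1 qE !rmorphM /= theta_eval_abel mul0r mulr0 mul0r => /eqP.
  by rewrite oner_eq0.
have [r' rE] := theta_dvd rA.
have : T * (1 - q * (q * r')) = 0.
  by rewrite mulrBr mulr1 {1}TE {1}rE [q * q * _]mulrCA !mulrA subrr.
move=> /eqP; rewrite mulf_eq0 (negPf theta_neq0) subr_eq0 => /eqP e.
exact: mpoly_unit_const (esym e).
Qed.

Lemma theta_unique theta :
  (forall q r, theta = q * q * r -> exists c, q = mC c) ->
  (forall z, ev z theta = 0 <-> ev z T = 0) ->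
  exists2 c, c != 0 & theta = mC c * T.
Proof.
move=> red zer.
have [q qE] := @theta_dvd theta (fun c => (zer _).2 (theta_eval_abel c)).
have [mP [r rP TE]] := theta_last gapS w0 sP.
have [c cE] := linear_cofactor_const mP rP TE theta_minor_neq0 theta_lead_unit cop
  theta_nonconst red (fun z => (zer z).1) qE.
exists c; last by rewrite qE cE mulrC.
(* With c = 0, [theta] would be 0, of which the square of any variable is a factor. *)
apply/eqP => c0; have [|b XE] := red (mX ord0) 0.
  by rewrite qE cE c0 raddf0 !mulr0.
have := congr1 (fun p => ev (fun=> 0) p - ev (fun=> 1) p) XE.
rewrite /= !mpoly.mevalC !mpoly.mevalXU subrr sub0r => /eqP.
by rewrite oppr_eq0 oner_eq0.
Qed.

End ThetaIdeal.

(** * Laurent expansions *)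

Section LaurentSequences.
Variable F : fieldType.

(** Product of a polynomial and a two-sided sequence. It is a finite sum, so sequences need not be
    bounded below to be multiplied. *)
Definition conv (q : {poly F}) (L : int -> F) : int -> F :=
  fun n => \sum_(k < size q) q`_k * L (n - k%:Z).

Definition pseq (p : {poly F}) : int -> F :=
  fun n => if n is Posz k then p`_k else 0.

Definition bounded_below (L : int -> F) := exists v : int, forall n, n < v -> L n = 0.

Lemma conv_wide N (q : {poly F}) L n : (size q <= N)%N ->
  conv q L n = \sum_(k < N) q`_k * L (n - k%:Z).
Proof.
move=> sN; rewrite /conv (big_ord_widen _ (fun k => q`_k * L (n - k%:Z)) sN).
rewrite big_mkcond; apply: eq_bigr => k _; case: ltnP => // sk.
by rewrite nth_default ?mul0r.
Qed.

Lemma eq_conv q L L' : L =1 L' -> conv q L =1 conv q L'.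
Proof. by move=> e n; apply: eq_bigr => k _; rewrite e. Qed.

Lemma convD p q L n : conv (p + q) L n = conv p L n + conv q L n.
Proof.
rewrite !(@conv_wide (maxn (size p) (size q))) ?leq_maxl ?leq_maxr ?size_polyD //.
by rewrite -big_split; apply: eq_bigr => k _; rewrite coefD mulrDl.
Qed.

Lemma convDr q L L' n : conv q (fun i => L i + L' i) n = conv q L n + conv q L' n.
Proof. by rewrite -big_split; apply: eq_bigr => k _; rewrite mulrDr. Qed.

Lemma convZr q c L n : conv q (fun i => c * L i) n = c * conv q L n.
Proof. by rewrite mulr_sumr; apply: eq_bigr => k _; rewrite mulrCA. Qed.

Lemma convC c L n : conv c%:P L n = c * L n.
Proof.
by rewrite (@conv_wide 1) ?size_polyC_leq1 // big_ord1 coefC subr0.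
Qed.

Lemma convMX q L n : conv (q * 'X) L n = conv q L (n - 1).
Proof.
rewrite (@conv_wide (size q).+1); last first.
  by rewrite (leq_trans (size_polyMleq _ _)) // size_polyX addn2.
rewrite big_ord_recl coefMX mul0r add0r; apply: eq_bigr => k _.
by rewrite coefMX lift0 /=; congr (_ * L _); lia.
Qed.

Lemma conv_shift q L m n : conv q (fun i => L (i - m)) n = conv q L (n - m).
Proof. by apply: eq_bigr => k _; congr (_ * L _); lia. Qed.

Lemma convM p q L n : conv (p * q) L n = conv p (conv q L) n.
Proof.
elim/poly_ind: p n => [|p c IH] n.
  by rewrite mul0r -polyC0 !convC !mul0r.
rewrite mulrDl !convD mulrAC convMX convMX IH; congr (_ + _).
rewrite convC (@conv_wide (size q)); last first.
  by rewrite mul_polyC size_scale_leq.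
rewrite mulr_sumr; apply: eq_bigr => k _.
by rewrite coefCM mulrA.
Qed.

Lemma conv_pseq q p n : conv q (pseq p) n = pseq (q * p) n.
Proof.
elim/poly_ind: q n => [|q c IH] n.
  by rewrite mul0r -polyC0 convC mul0r; case: n => // k; rewrite /= polyC0 coef0.
rewrite mulrDl convD convMX IH convC mulrAC.
case: n => [[|k]|k] /=; rewrite ?coefD ?coefMX ?coefCM ?mulr0 ?addr0 //=.
  by rewrite subn1.
Qed.

(** The lowest coefficient of q determines L upwards from its bound. The bound matters: 1 - t kills
    the constant sequences. *)
Lemma conv_inj q L : q != 0 -> bounded_below L ->
  (forall n, conv q L n = 0) -> forall n, L n = 0.
Proof.
move=> q0 [v Lv] qL.
have [m [qm0 qm]] : exists m, q`_m != 0 /\ forall i, (i < m)%N -> q`_i = 0.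
  have ex : exists m, q`_m != 0 by exists (size q).-1; rewrite -lead_coefE lead_coef_eq0.
  exists (ex_minn ex); case: ex_minnP => m qm mn; split=> // i im.
  by apply/eqP; apply/negP => /negP /mn; rewrite leqNgt im.
have main k : L (v + k%:Z) = 0.
  elim/ltn_ind: k => k IH.
  have := qL (v + k%:Z + m%:Z); rewrite (@conv_wide (m.+1 + size q)) ?leq_addl //.
  rewrite big_split_ord /= big_ord_recr /= !big1 ?add0r ?addr0 => [|i _|i _].
  - rewrite addrK => /eqP; rewrite mulf_eq0 (negPf qm0) /= => /eqP //.
  - have [ik|ki] := leqP i.+1 k; last by rewrite Lv ?mulr0 //; lia.
    rewrite (_ : _ - _ = v + (k - i.+1)%N%:Z); last by lia.
    by rewrite IH ?mulr0 //; lia.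
  by rewrite qm ?mul0r.
move=> n; have [/Lv//|vn] := ltP n v.
by rewrite (_ : n = v + `|n - v|%N%:Z) ?main //; lia.
Qed.

End LaurentSequences.

Section LaurentExpansion.
Variable R : realType.
Local Notation C := R[i].

(** Together with [conv_inj] this characterizes the expansion as the only bounded below L with q L =
    p; later arguments rest on it instead of the formula. *)
Lemma laurent_frac_spec (p q : {poly C}) : q != 0 ->
  bounded_below (laurent_frac p q) /\
  forall n, conv q (laurent_frac p q) n = pseq p n.
Proof.
move=> q0; set v := mup 0 q; set q' := q %/ 'X^v.
have qE : q = q' * 'X^v.
  by rewrite divpK // -['X]subr0 -polyC0 -mup_geq.
have q'0 : q'.[0] != 0.
  apply/negP => r0; have : (v < mup 0 q)%N; last by rewrite ltnn.
  rewrite mup_geq // polyC0 subr0 exprS [X in _ %| X]qE dvdp_mul //.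
  by rewrite -['X]subr0 -polyC0 dvdp_XsubCl rootE.
split; first by exists (- v%:Z) => n nv; rewrite /laurent_frac -/v; case e : (n + v%:Z) => //; lia.
pose c := q'.[0]^-1; pose r := 1 - c *: q'.
have r0 : r`_0 = 0.
  by rewrite coefB coef1 coefZ -horner_coef0 mulVf // subrr.
pose e N := c * (p * \sum_(k < N.+1) r ^+ k)`_N.
have eE N j : (j <= N)%N -> e j = c * (p * \sum_(k < N.+1) r ^+ k)`_j.
  move=> jN; congr (_ * _); rewrite ![p * _]mulrC.
  apply: (@coefM_eq_low _ _ _ _ j) => // i ij; rewrite !coef_sum.
  rewrite (big_ord_widen _ (fun k => (r ^+ k)`_i) (jN : (j.+1 <= N.+1)%N)) big_mkcond.
  apply: eq_bigr => k _; case: ltnP => // jk.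
  by rewrite coefX_order //; lia.
have LE n : laurent_frac p q n = (fun i => if i is Posz N then e N else 0) (n + v%:Z).
  by rewrite /laurent_frac -/v -/q'; case: (n + _).
move=> n; rewrite [X in conv X _]qE convM.
have shift (L : int -> C) i k : conv 'X^k L i = L (i - k%:Z).
  elim: k i => [|k IH] i; first by rewrite expr0 -polyC1 convC mul1r subr0.
  by rewrite exprSr convMX IH; congr L; lia.
rewrite (eq_conv _ (fun i => shift _ i v)) (eq_conv _ (fun i => LE (i - v%:Z))).
have -> : conv q' (fun i : int => match i - v%:Z + v%:Z with Posz N => e N | _ => 0 end) n =
    conv q' (fun i : int => match i with Posz N => e N | _ => 0 end) n.
  by apply: eq_conv => i; rewrite subrK.
case: n => [N|N]; last first.
  by rewrite /= /conv big1 // => k _; case ek : (_ - _) => [m|m]; [lia|rewrite mulr0].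
rewrite (@conv_wide _ (N.+1 + size q')) ?leq_addl // big_split_ord /=.
rewrite [X in _ + X]big1 ?addr0 => [|k _]; last first.
  by case ek : (_ - _) => [m|m]; [lia|rewrite mulr0].
transitivity ((q' * (c *: (p * \sum_(k < N.+1) r ^+ k)))`_N).
  rewrite coefM; apply: eq_bigr => k _.
  have kN : (k <= N)%N by rewrite -ltnS.
  by rewrite subzn // coefZ -eE // leq_subr.
(* Telescoping: c q' = 1 - r, and r^(N+1) does not reach degree N. *)
have -> : q' * (c *: (p * \sum_(k < N.+1) r ^+ k)) = p - r ^+ N.+1 * p.
  have := subrX1 r N.+1; rewrite (_ : r - 1 = - (c *: q')); last by rewrite /r addrAC subrr add0r.
  rewrite mulNr => h0; have -> : r ^+ N.+1 = 1 - c *: q' * \sum_(k < N.+1) r ^+ k.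
    by rewrite -[LHS](subrK 1) h0 addrC.
  rewrite -scalerAr scalerAl; ring.
by rewrite coefB (coefM_order (m := N.+1) (l := 0)) ?subr0 ?addn0 // => i iN; rewrite coefX_order.
Qed.

End LaurentExpansion.

Lemma frac_cross (K : fieldType) (p q p' q' : K) : q != 0 -> q' != 0 ->
  p / q = p' / q' <-> q' * p = q * p'.
Proof.
move=> q0 q'0; split=> [/eqP|e]; last by apply/eqP; rewrite eqr_div // mulrC e mulrC.
by rewrite eqr_div // => /eqP; rewrite mulrC => ->; rewrite mulrC.
Qed.

Section LaurentCoefficients.
Variable R : realType.
Local Notation C := R[i].
Local Notation tf := (@tofrac {poly C}).
Local Notation X := (ratX R).
Implicit Types (Q : P1 R) (f g : ratfun R).

Definition laurent (f : ratfun R) : int -> C := laurent_frac (repr f).1 (repr f).2.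

Lemma laurent_bounded f : bounded_below (laurent f).
Proof. by have [] := laurent_frac_spec (repr f).1 (denom_ratioP (repr f)). Qed.

(** [laurent] is computed from a chosen representative; cross-multiplying and cancelling its
    denominator gives the result for any other. *)
Lemma laurentP (p q : {poly C}) n : q != 0 ->
  conv q (laurent (tf p / tf q)) n = pseq p n.
Proof.
move=> q0; set f := tf p / tf q.
have [b0 s0] := laurent_frac_spec (repr f).1 (denom_ratioP (repr f)).
set p0 := (repr f).1 in s0; set q1 := (repr f).2 in s0.
have q10 : q1 != 0 by exact: denom_ratioP.
have e : q1 * p = q * p0.
  apply: (@tofrac_inj {poly C}); rewrite !tofracM; apply/frac_cross.
  - by rewrite tofrac_eq0.
  - by rewrite tofrac_eq0.
  exact: fraction_repr.
apply/eqP; rewrite -subr_eq0; apply/eqP; move: n.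
apply: (conv_inj q10 (L := fun n => conv q (laurent f) n - pseq p n)).
  have [v vP] := laurent_bounded f; exists (Num.min v 0) => n; rewrite lt_min => /andP[nv n0].
  rewrite /conv big1 => [|k _]; last by rewrite vP ?mulr0 //; lia.
  by rewrite sub0r; case: n n0 {nv} => // k _; rewrite oppr0.
move=> n; rewrite (eq_conv q1 (L' := fun n => conv q (laurent f) n + (-1) * pseq p n)); last first.
  by move=> i; rewrite mulN1r.
rewrite convDr convZr -convM mulrC convM (eq_conv _ s0) !conv_pseq e.
by rewrite mulN1r subrr.
Qed.

Lemma laurent_uniq (p q : {poly C}) L : q != 0 -> bounded_below L ->
  (forall n, conv q L n = pseq p n) -> laurent (tf p / tf q) =1 L.
Proof.
move=> q0 [v vL] h n; apply/eqP; rewrite -subr_eq0; apply/eqP; move: n.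
apply: (conv_inj q0 (L := fun n => laurent (tf p / tf q) n - L n)).
  have [u uL] := laurent_bounded (tf p / tf q).
  exists (Num.min v u) => n; rewrite lt_min => /andP[nv nu].
  by rewrite vL // uL // subrr.
move=> n; rewrite (eq_conv q (L' := fun n => laurent (tf p / tf q) n + (-1) * L n)); last first.
  by move=> i; rewrite mulN1r.
by rewrite convDr convZr laurentP // h mulN1r subrr.
Qed.

Lemma ratfunP (f : ratfun R) : exists p q : {poly C}, q != 0 /\ f = tf p / tf q.
Proof.
by exists (repr f).1, (repr f).2; split; [exact: denom_ratioP|exact: fraction_repr].
Qed.

Lemma laurentD f g n : laurent (f + g) n = laurent f n + laurent g n.
Proof.
have [p [q [q0 ->]]] := ratfunP f; have [p' [q' [q'0 ->]]] := ratfunP g.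
have -> : tf p / tf q + tf p' / tf q' = tf (p * q' + p' * q) / tf (q * q').
  by rewrite tofracD !tofracM addf_div ?tofrac_eq0.
apply: (@laurent_uniq _ _ (fun n => laurent (tf p / tf q) n + laurent (tf p' / tf q') n)).
- by rewrite mulf_neq0.
- have [v vL] := laurent_bounded (tf p / tf q).
  have [u uL] := laurent_bounded (tf p' / tf q').
  exists (Num.min v u) => i; rewrite lt_min => /andP[nv nu].
  by rewrite vL // uL // addr0.
move=> i; rewrite convDr {1}[q * q']mulrC !convM.
rewrite (eq_conv _ (fun j => laurentP p j q0)) (eq_conv q (fun j => laurentP p' j q'0)).
rewrite !conv_pseq [q' * p]mulrC [q * p']mulrC.
by case: i => [k|k] /=; rewrite ?addr0 // coefD.
Qed.

Lemma laurentZ c f n : laurent (ratC c * f) n = c * laurent f n.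
Proof.
have [p [q [q0 ->]]] := ratfunP f.
have -> : ratC c * (tf p / tf q) = tf (c%:P * p) / tf q by rewrite tofracM mulrA.
apply: (@laurent_uniq _ _ (fun n => c * laurent (tf p / tf q) n)) => //.
  by have [v vL] := laurent_bounded (tf p / tf q); exists v => i /vL ->; rewrite mulr0.
move=> i; rewrite convZr laurentP //.
by case: i => [k|k] /=; rewrite ?mulr0 // coefCM.
Qed.

Lemma laurentX f n : laurent (X * f) n = laurent f (n - 1).
Proof.
have [p [q [q0 ->]]] := ratfunP f.
have -> : X * (tf p / tf q) = tf ('X * p) / tf q by rewrite tofracM mulrA.
apply: (@laurent_uniq _ _ (fun n => laurent (tf p / tf q) (n - 1))) => //.
  have [v vL] := laurent_bounded (tf p / tf q); exists v => i iv; apply: vL; lia.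
move=> i; rewrite conv_shift laurentP //.
by case: i => [[|k]|k] //=; rewrite coefXM //= subn1.
Qed.

Lemma laurent_poly p n : laurent (tf p) n = pseq p n.
Proof.
have -> : tf p = tf p / tf 1 by rewrite tofrac1 divr1.
apply: (@laurent_uniq _ _ (pseq p)); first exact: oner_neq0.
  by exists 0 => -[].
by move=> i; rewrite conv_pseq mul1r.
Qed.

Lemma ratX_neq0 : X != 0.
Proof. by rewrite tofrac_eq0 polyX_eq0. Qed.

Lemma chart_neqC Q z : chart Q != ratC z.
Proof.
case: Q => [b|] /=; apply/eqP.
  move=> /eqP; rewrite -subr_eq0 /ratX /ratC -tofracD -tofracB tofrac_eq0.
  by rewrite -addrA -polyCB -size_poly_eq0 size_XaddC.
move=> e; have : X * ratC z = 1 by rewrite -e mulfV // ratX_neq0.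
move/eqP; rewrite /ratX /ratC -tofracM -tofrac1 tofrac_eq => /eqP/(congr1 (horner^~ 0)) e1.
by move/eqP: (oner_neq0 C); apply; rewrite -[LHS](hornerC 1 0) -[LHS]e1 hornerM hornerX mul0r.
Qed.

Definition subst (g : ratfun R) : {poly C} -> ratfun R :=
  fun p => (map_poly (@ratC R) p).[g].

Let ratC_rm : {rmorphism C -> ratfun R} := tf \o polyC.

Lemma substE g p : subst g p = (map_poly ratC_rm p).[g].
Proof. by []. Qed.

Lemma substD g p q : subst g (p + q) = subst g p + subst g q.
Proof. by rewrite !substE rmorphD hornerD. Qed.

Lemma substM g p q : subst g (p * q) = subst g p * subst g q.
Proof. by rewrite !substE rmorphM hornerM. Qed.

Lemma substX g : subst g 'X = g.
Proof. by rewrite substE map_polyX hornerX. Qed.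

Lemma substC g c : subst g c%:P = ratC c.
Proof. by rewrite substE map_polyC hornerC. Qed.

(** The polynomial splits over C and the chart is not constant, so no linear factor becomes 0. Hence
    composition with a chart is defined on fractions. *)
Lemma subst_neq0 Q p : p != 0 -> subst (chart Q) p != 0.
Proof.
move=> p0; have [r rE] := closed_field_poly_normal p.
rewrite rE substE map_polyZ hornerZ mulf_neq0 //.
  by rewrite fmorph_eq0 lead_coef_eq0.
rewrite rmorph_prod horner_prod prodf_seq_neq0; apply/allP => z _ /=.
rewrite rmorphB /= map_polyX map_polyC hornerD hornerN hornerX hornerC subr_eq0.
exact: chart_neqC.
Qed.

Lemma rcompE Q p q : q != 0 ->
  rcomp (tf p / tf q) (chart Q) = subst (chart Q) p / subst (chart Q) q.
Proof.
move=> q0; set f := tf p / tf q; have d0 := denom_ratioP (repr f).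
rewrite /rcomp -/(subst (chart Q) (repr f).1) -/(subst (chart Q) (repr f).2).
have e : (repr f).2 * p = q * (repr f).1.
  apply: (@tofrac_inj {poly C}); rewrite !tofracM; apply/frac_cross.
  - by rewrite tofrac_eq0.
  - by rewrite tofrac_eq0.
  exact: fraction_repr.
apply/frac_cross; [exact: subst_neq0|exact: subst_neq0|].
by rewrite -!substM e.
Qed.

Lemma rcompD Q f g : rcomp (f + g) (chart Q) = rcomp f (chart Q) + rcomp g (chart Q).
Proof.
have [p [q [q0 ->]]] := ratfunP f; have [p' [q' [q'0 ->]]] := ratfunP g.
have -> : tf p / tf q + tf p' / tf q' = tf (p * q' + p' * q) / tf (q * q').
  by rewrite tofracD !tofracM addf_div ?tofrac_eq0.
by rewrite !rcompE ?mulf_neq0 // substD !substM addf_div ?subst_neq0.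
Qed.

Lemma rcompM Q f g : rcomp (f * g) (chart Q) = rcomp f (chart Q) * rcomp g (chart Q).
Proof.
have [p [q [q0 ->]]] := ratfunP f; have [p' [q' [q'0 ->]]] := ratfunP g.
have -> : tf p / tf q * (tf p' / tf q') = tf (p * p') / tf (q * q').
  by rewrite !tofracM mulf_div.
by rewrite !rcompE ?mulf_neq0 // !substM mulf_div.
Qed.

Lemma rcomp_poly Q p : rcomp (tf p) (chart Q) = subst (chart Q) p.
Proof.
have -> : tf p = tf p / tf 1 by rewrite tofrac1 divr1.
by rewrite rcompE ?oner_neq0 // -[X in _ / X]/(subst _ 1%:P) substC /ratC tofrac1 divr1.
Qed.

Lemma lcoefE Q f n : lcoef Q f n = laurent (rcomp f (chart Q)) n.
Proof. by []. Qed.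

Lemma lcoefD Q f g n : lcoef Q (f + g) n = lcoef Q f n + lcoef Q g n.
Proof. by rewrite !lcoefE rcompD laurentD. Qed.

Lemma lcoefZ Q c f n : lcoef Q (ratC c * f) n = c * lcoef Q f n.
Proof. by rewrite !lcoefE rcompM rcomp_poly substC laurentZ. Qed.

Lemma lcoef0 Q n : lcoef Q 0 n = 0.
Proof. by rewrite -(mul0r 1) -[0 in LHS]tofrac0 -polyC0 -/(ratC 0) lcoefZ mul0r. Qed.

Lemma lcoefN Q f n : lcoef Q (- f) n = - lcoef Q f n.
Proof.
by apply/eqP; rewrite -addr_eq0 -lcoefD addNr lcoef0.
Qed.

Lemma lcoefB Q f g n : lcoef Q (f - g) n = lcoef Q f n - lcoef Q g n.
Proof. by rewrite lcoefD lcoefN. Qed.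

Lemma lcoef_sum Q (I : Type) (r : seq I) (P : pred I) (f : I -> ratfun R) n :
  lcoef Q (\sum_(i <- r | P i) f i) n = \sum_(i <- r | P i) lcoef Q (f i) n.
Proof.
by apply: (big_morph (fun f => lcoef Q f n)) => [f' g'|]; rewrite ?lcoefD ?lcoef0.
Qed.

Lemma lcoef_bounded Q f : bounded_below (lcoef Q f).
Proof. exact: laurent_bounded. Qed.

Lemma lcoef_infX f n : lcoef None (X * f) n = lcoef None f (n + 1).
Proof.
rewrite !lcoefE rcompM rcomp_poly substX /= -[n in LHS](addrK 1) -laurentX.
by rewrite mulrA mulfV ?ratX_neq0 // mul1r.
Qed.

Lemma lcoef_infVX f n : lcoef None (X^-1 * f) n = lcoef None f (n - 1).
Proof. by rewrite -[in RHS](mulVKf ratX_neq0 f) lcoef_infX subrK. Qed.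

Lemma lcoef_infX_nat f k n : lcoef None (X ^+ k * f) n = lcoef None f (n + k%:Z).
Proof.
elim: k n => [|k IH] n; first by rewrite mul1r addr0.
by rewrite exprS -mulrA lcoef_infX IH; congr lcoef; lia.
Qed.

Lemma lcoef_infVX_nat f k n : lcoef None (X ^- k * f) n = lcoef None f (n - k%:Z).
Proof.
by rewrite -[in RHS](mulVKf (expf_neq0 k ratX_neq0) f) lcoef_infX_nat subrK.
Qed.

Lemma lcoef_finX a f n : lcoef (Some a) ((X - ratC a) * f) n = lcoef (Some a) f (n - 1).
Proof.
rewrite !lcoefE rcompM -laurentX; congr (laurent (_ * _) n).
have -> : X - ratC a = tf ('X - a%:P) by rewrite tofracB.
by rewrite rcomp_poly substD substX -polyCN substC /= /ratC polyCN tofracN addrK.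
Qed.

Lemma lcoef_finX_nat a f k n :
  lcoef (Some a) ((X - ratC a) ^+ k * f) n = lcoef (Some a) f (n - k%:Z).
Proof.
elim: k n => [|k IH] n; first by rewrite mul1r subr0.
by rewrite exprS -mulrA lcoef_finX IH; congr lcoef; lia.
Qed.

Lemma lcoef_fin_poly a p n : lcoef (Some a) (tf p) n = pseq (p \Po ('X + a%:P)) n.
Proof.
rewrite lcoefE rcomp_poly -laurent_poly; congr (laurent _ n).
elim/poly_ind: p => [|p c IH]; first by rewrite comp_poly0 tofrac0 substE rmorph0 horner0.
rewrite substD substM substX substC IH comp_polyD comp_polyM comp_polyX comp_polyC.
by rewrite tofracD tofracM tofracD.
Qed.

Lemma lcoef_1 Q n : lcoef Q 1 n = (n == 0)%:R.
Proof.
rewrite -tofrac1 lcoefE rcomp_poly -[1]/(1%:P) substC laurent_poly.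
by case: n => [[|k]|k] //=; rewrite coefC.
Qed.

Lemma ratfun_polyE (p : {poly C}) : tf p = \sum_(k < size p) ratC p`_k * X ^+ k.
Proof.
rewrite -[in LHS](coefK p) poly_def rmorph_sum; apply: eq_bigr => k _.
by rewrite -mul_polyC rmorphM rmorphXn.
Qed.

Lemma lcoef_inf_poly f (p : {poly C}) n :
  lcoef None (tf p * f) n = \sum_(k < size p) p`_k * lcoef None f (n + k%:Z).
Proof.
rewrite ratfun_polyE mulr_suml lcoef_sum; apply: eq_bigr => k _.
by rewrite -mulrA lcoefZ lcoef_infX_nat.
Qed.

Lemma lcoef_fin_polyM a f (p : {poly C}) n :
  lcoef (Some a) (tf p * f) n =
  \sum_(k < size (p \Po ('X + a%:P))) (p \Po ('X + a%:P))`_k * lcoef (Some a) f (n - k%:Z).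
Proof.
set q := p \Po _.
have -> : tf p = \sum_(k < size q) ratC q`_k * (X - ratC a) ^+ k.
  have -> : p = q \Po ('X - a%:P).
    by rewrite /q -comp_polyA comp_polyD comp_polyX comp_polyC subrK comp_polyXr.
  rewrite comp_polyE rmorph_sum; apply: eq_bigr => k _.
  by rewrite -mul_polyC rmorphM rmorphXn /= tofracB.
rewrite mulr_suml lcoef_sum; apply: eq_bigr => k _.
by rewrite -mulrA lcoefZ lcoef_finX_nat.
Qed.

Lemma coef0_shift a (p : {poly C}) : (p \Po ('X + a%:P))`_0 = p.[a].
Proof. by rewrite -horner_coef0 horner_comp !hornerE. Qed.

Lemma rval_poly a p : rval (Some a) (tf p) = p.[a].
Proof.
by rewrite /rval lcoef_fin_poly /= coef0_shift.
Qed.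

Lemma regular_poly a p : regular_at (Some a) (tf p).
Proof. by move=> k k0; rewrite lcoef_fin_poly; case: k k0. Qed.

(** At a root a of the denominator q, regularity of f makes the value of p = q f at a zero, so u - a
    cancels. *)
Lemma regular_finite_poly f : (forall a, regular_at (Some a) f) -> exists p, f = tf p.
Proof.
have [p0 [q0 [q00 ->]]] := ratfunP f.
move: {2}(size q0) (leqnn (size q0)) => m; elim: m p0 q0 q00 => [|m IH] p q q0 sq reg.
  by rewrite leqn0 size_poly_eq0 (negPf q0) in sq.
have [sq1|sq1] := leqP (size q) 1.
  have := size1_polyC sq1; set c := q`_0 => qc.
  have c0 : c != 0 by apply: contra q0 => /eqP c0; rewrite qc c0.
  exists (c^-1 *: p); rewrite qc -mul_polyC tofracM mulrC; congr (_ * _).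
  apply: (mulIf (x := tf c%:P)); first by rewrite tofrac_eq0 polyC_eq0.
  by rewrite mulVf ?tofrac_eq0 ?polyC_eq0 // -tofracM -polyCM mulVf // tofrac1.
have [a /factor_theorem[q1 qE]] := closed_rootP q (negbT (gtn_eqF sq1)).
have q10 : q1 != 0 by apply: contraNneq q0 => e; rewrite qE e mul0r.
have Xa0 : 'X - a%:P != 0 :> {poly C} by rewrite polyXsubC_eq0.
have sq1m : (size q1 <= m)%N.
  by move: sq; rewrite qE size_Mmonic ?monicXsubC // size_XsubC addn2.
have [/factor_theorem[p1 pE]|pa] := boolP (root p a).
  have e : tf p / tf q = tf p1 / tf q1.
    by rewrite pE qE !tofracM -mulf_div divff ?tofrac_eq0 // mulr1.
  by rewrite e; apply: (IH _ _ q10 sq1m) => b; rewrite -e; exact: reg.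
case/negP: pa; rewrite rootE; apply/eqP.
have e : tf q * (tf p / tf q) = tf p by rewrite mulrC divfK ?tofrac_eq0.
have := lcoef_fin_polyM a (tf p / tf q) q 0; rewrite e lcoef_fin_poly /=.
rewrite coef0_shift => ->; apply: big1 => k _.
have qa : q.[a] = 0 by rewrite qE hornerM hornerXsubC subrr mulr0.
have [k0|k0] := eqVneq (k : nat) 0%N.
  by rewrite k0 coef0_shift qa; exact: mul0r.
by rewrite (reg a) ?mulr0 //; lia.
Qed.

End LaurentCoefficients.

(** * The curve and its differentials *)

Section RegularFunctions.
Variable R : realType.
Local Notation C := R[i].
Local Notation tf := (@tofrac {poly C}).
Local Notation X := (ratX R).

Lemma regular_repr (a : C) (f : ratfun R) : regular_at (Some a) f ->
  exists p q : {poly C}, q.[a] != 0 /\ f = tf p / tf q.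
Proof.
have [p0 [q0 [q00 ->]]] := ratfunP f.
move: {2}(size q0) (leqnn (size q0)) => m; elim: m p0 q0 q00 => [|m IH] p q q0 sq reg.
  by rewrite leqn0 size_poly_eq0 (negPf q0) in sq.
have [/factor_theorem[q1 qE]|qa] := boolP (root q a); last by exists p, q.
have q10 : q1 != 0 by apply: contraNneq q0 => e; rewrite qE e mul0r.
have sq1m : (size q1 <= m)%N.
  by move: sq; rewrite qE size_Mmonic ?monicXsubC // size_XsubC addn2.
have pa : root p a.
  have e : tf q * (tf p / tf q) = tf p by rewrite mulrC divfK ?tofrac_eq0.
  have := lcoef_fin_polyM a (tf p / tf q) q 0; rewrite e lcoef_fin_poly /=.
  rewrite rootE coef0_shift => ->; apply/eqP; apply: big1 => k _.
  have [k0|k0] := eqVneq (k : nat) 0%N.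
    rewrite k0 coef0_shift; have -> : q.[a] = 0 by rewrite qE hornerM hornerXsubC subrr mulr0.
    exact: mul0r.
  by rewrite reg ?mulr0 //; lia.
have /factor_theorem[p1 pE] := pa.
have Xa0 : 'X - a%:P != 0 :> {poly C} by rewrite polyXsubC_eq0.
have e : tf p / tf q = tf p1 / tf q1.
  by rewrite pE qE !tofracM -mulf_div divff ?tofrac_eq0 // mulr1.
by rewrite e; apply: (IH _ _ q10 sq1m); rewrite -e.
Qed.

Lemma repr_regular (a : C) (p q : {poly C}) : q.[a] != 0 ->
  regular_at (Some a) (tf p / tf q).
Proof.
move=> qa; have q0 : q != 0 by apply: contraNneq qa => ->; rewrite horner0.
set f := tf p / tf q; set q' := q \Po ('X + a%:P).
have e n : n < 0 -> \sum_(k < size q') q'`_k * lcoef (Some a) f (n - k%:Z) = 0.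
  move=> n0; rewrite -lcoef_fin_polyM /f mulrC divfK ?tofrac_eq0 // lcoef_fin_poly.
  by case: n n0.
have [v vL] := lcoef_bounded (Some a) f.
have q'0 : q'`_0 != 0 by rewrite coef0_shift.
have sq' : (0 < size q')%N.
  by rewrite size_poly_gt0; apply: contraNneq q'0 => ->; rewrite coef0.
have main k : v + k%:Z < 0 -> lcoef (Some a) f (v + k%:Z) = 0.
  elim/ltn_ind: k => k IH k0; have := e _ k0.
  case: (size q') sq' => // m _; rewrite big_ord_recl subr0 big1 => [|i _].
    by rewrite addr0 => /eqP; rewrite mulf_eq0 (negPf q'0) => /eqP.
  rewrite lift0; have [ik|ki] := leqP i.+1 k; last by rewrite vL ?mulr0 //; lia.
  rewrite (_ : _ - _ = v + (k - i.+1)%N%:Z); last by lia.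
  by rewrite IH ?mulr0 //; lia.
move=> n n0; have [/vL//|vn] := ltP n v.
by rewrite (_ : n = v + `|n - v|%N%:Z) ?main //; lia.
Qed.

Lemma regularM (a : C) (f h : ratfun R) : regular_at (Some a) f ->
  regular_at (Some a) h -> regular_at (Some a) (f * h).
Proof.
move=> /regular_repr[p [q [q0 ->]]] /regular_repr[p' [q' [q'0 ->]]].
by rewrite mulf_div -!tofracM; apply: repr_regular; rewrite hornerM mulf_neq0.
Qed.

Lemma regularVX (a : C) k : a != 0 -> regular_at (Some a) (X ^- k).
Proof.
move=> a0; rewrite -div1r -tofrac1 /ratX -tofracXn; apply: repr_regular.
by rewrite hornerXn expf_neq0.
Qed.

End RegularFunctions.

Section CurveGeometry.
Variables (R : realType) (Cv : rational_curve R) (P0 Pinf : curve_point Cv).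
Local Notation C := R[i].
Local Notation tf := (@tofrac {poly C}).
Local Notation X := (ratX R).
Hypothesis C_sing : forall P : curve_point Cv, ~ smooth P <-> P = Pinf.
Hypothesis Pinf_unibranch : unibranch Pinf.
Hypothesis P0_coord : nu Cv (Some 0) = P0.
Hypothesis Pinf_coord : nu Cv None = Pinf.
Local Notation O := (@stalk R Cv Pinf).

Lemma nu_finite_neq a : nu Cv (Some a) <> Pinf.
Proof. by move=> h; have := Pinf_unibranch h Pinf_coord. Qed.

Lemma finite_smooth a : smooth (nu Cv (Some a)).
Proof. by apply: contrapT => /C_sing; exact: nu_finite_neq. Qed.

(** The function u belongs to the local ring at a smooth point at finite distance, and elements of a
    local ring take equal values at the points above; so u separates them. *)
Lemma finite_fiber a Q : nu Cv Q = nu Cv (Some a) -> Q = Some a.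
Proof.
case: Q => [b|] h; last by case: (@nu_finite_neq a); rewrite -h.
have XS : stalk (nu Cv (Some a)) X.
  apply: finite_smooth => -[c _|h']; first exact: regular_poly.
  by case: (@nu_finite_neq a); rewrite -h'.
have := stalk_local XS h erefl.
by rewrite /ratX !rval_poly !hornerX => ->.
Qed.

Lemma inf_fiber Q : nu Cv Q = Pinf -> Q = None.
Proof. by move=> h; exact: Pinf_unibranch h Pinf_coord. Qed.

Lemma fiber_sum P Q (f : P1 R -> C) : nu Cv Q = P ->
  (forall Q', nu Cv Q' = P -> Q' = Q) ->
  \sum_(Q' \in [set Q' | nu Cv Q' = P]) f Q' = f Q.
Proof.
move=> QP h; have -> : [set Q' | nu Cv Q' = P] = [set Q].
  by apply/seteqP; split=> [Q' /h //|Q' ->].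
by rewrite fsbig_set1.
Qed.

Lemma omega_stalk_finite a f : omega_stalk (nu Cv (Some a)) f <-> regular_at (Some a) f.
Proof.
have fs h := @fiber_sum (nu Cv (Some a)) (Some a)
  (fun Q => residue Q (h * f)) erefl (@finite_fiber a).
split=> [om n n0|reg h hS].
  (* The factor (u - a)^(-n-1) moves the coefficient of index n < 0 to the residue. *)
  have hS : stalk (nu Cv (Some a)) ((X - ratC a) ^+ absz (n + 1)).
    apply: finite_smooth => Q /finite_fiber ->.
    by rewrite /ratX /ratC -tofracB -tofracXn; exact: regular_poly.
  have := om _ hS; rewrite fs /= lcoef_finX_nat => <-; congr lcoef; lia.
rewrite fs /=; apply: regularM => //; exact: (stalk_regular hS).
Qed.

Lemma omega_stalk_inf f : omega_stalk Pinf f <->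
  forall h, O h -> lcoef None (h * f) 1 = 0.
Proof.
have fs h := @fiber_sum Pinf None (fun Q => residue Q (h * f)) Pinf_coord inf_fiber.
split=> om h hS.
  by have := om h hS; rewrite fs /= => /eqP; rewrite oppr_eq0 => /eqP.
by rewrite fs /= om // oppr0.
Qed.

Lemma H0omegaP f : H0omega Cv f <-> (exists p, f = tf p) /\
  forall h, O h -> lcoef None (h * f) 1 = 0.
Proof.
split=> [om|[[p ->] om] P].
  split; last exact/omega_stalk_inf/om.
  by apply: regular_finite_poly => a; apply/omega_stalk_finite/om.
have [Q <-] := nu_surj P; case: Q => [a|]; first exact/omega_stalk_finite/regular_poly.
by rewrite Pinf_coord; apply/omega_stalk_inf.
Qed.

(** The union over n allows poles of any order at u = 0; the residue condition at infinity is all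
    that remains besides regularity elsewhere. *)
Lemma H0L_inftyP g f : H0L_infty P0 g f <-> (exists K p, f = X ^- K * tf p) /\
  forall h, O h -> lcoef None (h * f) 1 = 0.
Proof.
have X0 := ratX_neq0 R; split=> [[n [om0 om]]|[[K [p fE]] om]].
  split; last first.
    apply/omega_stalk_inf/om; rewrite -P0_coord => e.
    exact: (@nu_finite_neq 0).
  set k := n%:Z - (g%:Z - 1) in om0.
  have [p pE] : exists p, X ^+ `|k|%N * f = tf p.
    apply: regular_finite_poly => a; have [a0|a0] := eqVneq a 0.
      rewrite a0; rewrite -P0_coord in om0; move/omega_stalk_finite: om0 => reg.
      have -> : X ^+ `|k|%N * f = X ^+ absz (`|k|%N%:Z - k) * (X ^ k * f).
        rewrite mulrA; congr (_ * _); rewrite !exprnP -expfzDr //; congr (X ^ _); lia.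
      apply: regularM => //; rewrite /ratX -tofracXn; exact: regular_poly.
    apply: regularM; first by rewrite /ratX -tofracXn; exact: regular_poly.
    apply/omega_stalk_finite/om; rewrite -P0_coord => /finite_fiber[e].
    by rewrite e eqxx in a0.
  exists `|k|%N, p; rewrite -pE.
  exact: esym (mulKf (expf_neq0 _ X0) f).
exists (K + g)%N; split=> [|P PP0].
  rewrite -P0_coord (_ : X ^ _ * f = tf ('X * p)); first exact/omega_stalk_finite/regular_poly.
  rewrite fE (_ : (K + g)%N%:Z - _ = 1 + K%:Z); last by lia.
  rewrite expfzDr // expr1z -exprnP -mulrA (mulVKf (expf_neq0 _ X0)).
  by rewrite tofracM.
have [Q QP] := nu_surj P; case: Q QP => [a aP|]; last first.
  by rewrite Pinf_coord => <-; apply/omega_stalk_inf.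
rewrite -aP; apply/omega_stalk_finite; rewrite fE; apply: regularM; last exact: regular_poly.
apply: regularVX; apply/eqP => a0; apply: PP0; by rewrite -aP a0.
Qed.

End CurveGeometry.

(** If w_0 were above 1, the kernel would contain an element h of order 1 with leading coefficient
    1, hence also h^(w_0), on which W_0 takes the value 1. *)
Lemma gap_first (F : fieldType) n (w : 'I_n.+1 -> nat) (a : 'I_n.+1 -> nat -> F) :
  gap_system w a -> w ord0 = 1%N.
Proof.
move=> gapS; have w0 : (0 < w ord0)%N.
  rewrite lt0n; apply/negP => /eqP e.
  by have := gap_delta gapS ord0 ord0; rewrite e (gap_0 gapS) eqxx => /eqP; rewrite eq_sym oner_eq0.
apply/eqP; rewrite eqn_leq w0 andbT leqNgt; apply/negP => w1.
have wi i : (1 < w i)%N.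
  have [->//|i0] := eqVneq i ord0.
  by apply: (ltn_trans w1); apply: (gap_ltn gapS); rewrite lt0n.
set io : {rmorphism F -> F} := @idfun F.
pose h := gapproj w a 1.
have Wh k j : (0 < k)%N -> gapf w a io j (h ^+ k) = 0.
  case: k => // k _; elim: k j => [|k IH] j; first by rewrite expr1; exact: gapf_gapproj.
  by rewrite exprS; apply: (gap_mul gapS) => i; [exact: gapf_gapproj|exact: IH].
have [u hE] : exists u : {poly F}, h = 'X * (1 + 'X * u).
  exists (- \sum_i a i 1%N *: 'X^((w i).-2)).
  rewrite /h /gapproj mulrDr mulr1 expr1; congr (_ + _).
  rewrite !mulrN; congr (- _); rewrite !mulr_sumr; apply: eq_bigr => i _.
  rewrite -!scalerAr; congr (_ *: _).
  by rewrite -!exprS; congr ('X^_); have := wi i; lia.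
have := Wh _ ord0 w0; rewrite hE exprMn.
set v := (1 + _) ^+ _.
have v0 : v`_0 = 1.
  by rewrite -horner_coef0 !(hornerE, mul0r, addr0, expr1n).
rewrite /gapf big_ord_recr /= big1 ?add0r => [|k _].
  rewrite (gap_delta gapS) eqxx mul1r coefXnM ltnn subnn v0 => /eqP.
  by rewrite oner_eq0.
by rewrite coefXnM ltn_ord mulr0.
Qed.

(** * Functionals that cut out the local ring at infinity *)

Section LocalRingAtInfinity.
Variables (R : realType) (Cv : rational_curve R) (Pinf : curve_point Cv).
Local Notation C := R[i].
Local Notation X := (ratX R).
Variables (g : nat) (w : 'I_g -> nat).
Hypothesis Pinf_unibranch : unibranch Pinf.
Hypothesis Pinf_coord : nu Cv None = Pinf.
Hypothesis w_ltn : forall i j : 'I_g, (i < j)%N -> (w i < w j)%N.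
Hypothesis w_gaps : forall n : nat,
  (exists j, w j = n) <-> ~ value_semigroup Cv None n.
Local Notation O := (@stalk R Cv Pinf).
Local Notation H n := (value_semigroup Cv None n).

Lemma stalkZ c f : O f -> O (ratC c * f).
Proof. by apply: stalkM; exact: stalkC. Qed.

Lemma stalk0 : O 0.
Proof. by have := stalkC Pinf (0 : C); rewrite /ratC polyC0 tofrac0. Qed.

Lemma stalk1 : O 1.
Proof. by have := stalkC Pinf (1 : C); rewrite /ratC polyC1 tofrac1. Qed.

Lemma stalkD f h : O f -> O h -> O (f + h).
Proof.
move=> fS hS; rewrite -[h]opprK; apply: stalkB => //.
by rewrite -[- h]sub0r; apply: stalkB => //; exact: stalk0.
Qed.

Lemma stalk_sum (I : Type) (r : seq I) (P : pred I) (f : I -> ratfun R) :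
  (forall i, P i -> O (f i)) -> O (\sum_(i <- r | P i) f i).
Proof. by move=> h; apply: (big_ind O) => //; [exact: stalk0|exact: stalkD]. Qed.

Lemma stalk_inf_regular f : O f -> ord_ge None f 0.
Proof. by move=> fS; apply: (stalk_regular fS). Qed.

Lemma conductor_exists : exists N, forall f, ord_ge None f N%:Z -> O f.
Proof.
have [N NP] := stalk_conductor Pinf; exists N => f fN; apply: NP => Q QP.
by have -> : Q = None by exact: Pinf_unibranch QP Pinf_coord.
Qed.

Lemma lcoef_infV k n : lcoef None (X ^- k) n = (n == k%:Z)%:R.
Proof. by rewrite -[X ^- k]mulr1 lcoef_infVX_nat lcoef_1 subr_eq0. Qed.

Section Conductor.
Variable N : nat.
Hypothesis NP : forall f, ord_ge None f N%:Z -> O f.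

Lemma semigroup_ge n : (N <= n)%N -> H n.
Proof.
move=> Nn; exists (X ^- n).
  by rewrite Pinf_coord; apply: NP => k kN; rewrite lcoef_infV; case: eqP => //; lia.
split=> [k kn|]; rewrite lcoef_infV; first by case: eqP => //; lia.
by rewrite eqxx; apply/eqP/oner_neq0.
Qed.

Lemma gap_lt j : (w j < N)%N.
Proof.
rewrite ltnNge; apply/negP => /semigroup_ge.
by apply/(w_gaps (w j)).1; exists j.
Qed.

(** An element of the reduced echelon basis of the local ring modulo its conductor: leading term t^n
    and no other term at a semigroup index below N. *)
Definition reduced_element n (r : ratfun R) := [/\ O r,
  forall k : int, k < n%:Z -> lcoef None r k = 0, lcoef None r n%:Z = 1 &
  forall k : nat, H k -> k != n -> (k < N)%N -> lcoef None r k%:Z = 0].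

Lemma reduced_elementP n : H n -> exists r, reduced_element n r.
Proof.
have [m mE] : exists m, (N <= n + m)%N by exists N; rewrite leq_addl.
(* Descending induction on n: an element of order n is corrected by the reduced elements of larger
   order. *)
elim: m n mE => [|m IH] n mE Hn.
  rewrite addn0 in mE; exists (X ^- n); split.
  - by apply: NP => k kN; rewrite lcoef_infV; case: eqP => //; lia.
  - by move=> k kn; rewrite lcoef_infV; case: eqP => //; lia.
  - by rewrite lcoef_infV eqxx.
  - by move=> k _ _ kN; rewrite lcoef_infV; case: eqP => //; lia.
have ex k : exists r, H k -> (n < k)%N -> reduced_element k r.
  have [[Hk nk]|no] := pselect (H k /\ (n < k)%N); last by exists 0 => Hk nk; case: no.
  by have [|r rP] := IH k _ Hk; [lia|exists r].
have /choice[r rP] := ex.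
have [f fS [f0 fn]] := Hn; rewrite Pinf_coord in fS.
have lfn : lcoef None f n%:Z != 0 by apply/eqP.
pose f1 := ratC (lcoef None f n%:Z)^-1 * f.
pose D (k : 'I_N) := `[< H k >] && (n < k)%N.
have DP k : D k -> reduced_element k (r k) by case/andP=> /asboolP Hk nk; apply: rP.
exists (f1 - \sum_(k < N | D k) ratC (lcoef None f1 k%:Z) * r k).
have f1k k : k < n%:Z -> lcoef None f1 k = 0 by move=> /f0 h; rewrite lcoefZ h mulr0.
have f1n : lcoef None f1 n%:Z = 1 by rewrite lcoefZ mulVf.
have co i : lcoef None (f1 - \sum_(k < N | D k) ratC (lcoef None f1 k%:Z) * r k) i =
    lcoef None f1 i - \sum_(k < N | D k) lcoef None f1 k%:Z * lcoef None (r k) i.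
  by rewrite lcoefB lcoef_sum; congr (_ - _); apply: eq_bigr => k _; rewrite lcoefZ.
have lowD i : i <= n%:Z -> \sum_(k < N | D k) lcoef None f1 k%:Z * lcoef None (r k) i = 0.
  move=> ilt; rewrite big1 // => k Dk; have [_ rk _ _] := DP k Dk.
  by rewrite rk ?mulr0 //; case/andP: Dk => _; lia.
split.
- apply: stalkB; first by apply: stalkZ.
  by apply: stalk_sum => k /DP[rk _ _ _]; apply: stalkZ.
- by move=> k kn; rewrite co f1k // lowD ?subr0 // ltW.
- by rewrite co f1n lowD ?subr0.
move=> k Hk kn kN; rewrite co; have [nk|kn'] := ltnP n k; last first.
  by rewrite f1k ?lowD ?subr0 //; lia.
have Dk : D (Ordinal kN) by rewrite /D /= nk andbT; apply/asboolP.
rewrite (bigD1 (Ordinal kN)) //= big1 => [|l /andP[Dl lk]].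
  by have [_ _ -> _] := DP _ Dk; rewrite mulr1 addr0 subrr.
have [_ _ _ rl] := DP _ Dl; rewrite rl ?mulr0 //.
by apply: contra lk => /eqP e; apply/eqP/val_inj.
Qed.

(** The order of a nonzero element lies in the semigroup, so a first nonzero coefficient below N
    would be among those assumed zero. *)
Lemma stalk_zero f : O f ->
  (forall k : nat, H k -> (k < N)%N -> lcoef None f k%:Z = 0) -> ord_ge None f N%:Z.
Proof.
move=> fS f0 k kN; have [k0|k0] := ltP k 0; first exact: (stalk_inf_regular fS).
have -> : k = (absz k)%:Z by lia.
have {kN k0} : (absz k < N)%N by lia.
move: (absz k) => {}k; elim/ltn_ind: k => k IH kN.
apply: contrapT => fk; apply: (fk); apply: f0 => //; exists f; first by rewrite Pinf_coord.
split=> // i ik; have [i0|i0] := ltP i 0; first exact: (stalk_inf_regular fS).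
by have -> : i = (absz i)%:Z; [lia|apply: IH; lia].
Qed.

Variable r : nat -> ratfun R.
Hypothesis rP : forall n, H n -> reduced_element n (r n).

(** Chosen so that W_j(f) is the coefficient at w_j after the reduced elements have cleared the
    semigroup coefficients of f; hence the sign. *)
Definition gap_coef (j : 'I_g) (n : nat) : C :=
  if `[< H n >] then - lcoef None (r n) (w j)%:Z else (n == w j)%:R.

Lemma gap_notH j : ~ H (w j).
Proof. by apply/w_gaps; exists j. Qed.

Lemma gap_w_inj : injective w.
Proof.
move=> i j e; apply/val_inj/eqP; case: (ltngtP i j) => // /w_ltn; rewrite e ltnn //.
Qed.

Lemma gap_coef_top j k : (w j < k)%N -> gap_coef j k = 0.
Proof.
move=> jk; rewrite /gap_coef; case: asboolP => [Hk|_].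
  by have [_ rk _ _] := rP Hk; rewrite rk ?oppr0 //; lia.
by rewrite gtn_eqF.
Qed.

Lemma gap_coef_delta j k : gap_coef j (w k) = (j == k)%:R.
Proof.
rewrite /gap_coef; case: asboolP => [/gap_notH//|_].
by rewrite (inj_eq gap_w_inj) eq_sym.
Qed.

Definition gap_reduction f := f - \sum_(n < N | `[< H n >]) ratC (lcoef None f n%:Z) * r n.

Lemma gap_reductionH f k : H k -> (k < N)%N -> lcoef None (gap_reduction f) k%:Z = 0.
Proof.
move=> Hk kN; rewrite lcoefB lcoef_sum (bigD1 (Ordinal kN)) /=; last exact/asboolP.
rewrite big1 => [|l /andP[/asboolP Hl lk]].
  by rewrite addr0 lcoefZ; have [_ _ -> _] := rP Hk; rewrite mulr1 subrr.
rewrite lcoefZ; have [_ _ _ rl] := rP Hl; rewrite rl ?mulr0 //.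
by apply: contra lk => /eqP e; apply/eqP/val_inj.
Qed.

Lemma gap_reduction_gap f j : lcoef None (gap_reduction f) (w j)%:Z =
  \sum_(n < (w j).+1) gap_coef j n * lcoef None f n%:Z.
Proof.
rewrite lcoefB lcoef_sum.
have le : ((w j).+1 <= N)%N := gap_lt j.
rewrite [RHS](big_ord_widen N (fun n => gap_coef j n * lcoef None f n%:Z)) //.
rewrite [RHS]big_mkcond /= [in RHS](bigD1 (Ordinal le)) //= ltnSn.
rewrite gap_coef_delta eqxx mul1r; congr (_ + _).
rewrite [in LHS]big_mkcond (bigD1 (Ordinal le)) //= asboolF ?add0r; last exact: gap_notH.
rewrite -sumrN; apply: eq_bigr => n nj; rewrite /gap_coef.
case: asboolP => [Hn|nH]; last first.
  by rewrite oppr0 (negPf (_ : (n : nat) != w j)) ?mul0r ?if_same.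
rewrite lcoefZ; case: ltnP => [_|jn]; first by rewrite mulNr mulrC.
by have [_ rn _ _] := rP Hn; rewrite rn ?mulr0 ?oppr0 //; lia.
Qed.

Lemma stalk_gap_coef f j : O f -> \sum_(n < (w j).+1) gap_coef j n * lcoef None f n%:Z = 0.
Proof.
move=> fS; rewrite -gap_reduction_gap; apply: (@stalk_zero (gap_reduction f)).
- apply: stalkB => //; apply: stalk_sum => k /asboolP Hk; apply: stalkZ.
  by have [rS _ _ _] := rP Hk.
- by move=> k; exact: gap_reductionH.
by have := gap_lt j; lia.
Qed.

Lemma gap_coef_stalk f : ord_ge None f 0 ->
  (forall j, \sum_(n < (w j).+1) gap_coef j n * lcoef None f n%:Z = 0) -> O f.
Proof.
move=> f0 fW; have rS : O (\sum_(n < N | `[< H n >]) ratC (lcoef None f n%:Z) * r n).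
  by apply: stalk_sum => k /asboolP Hk; apply: stalkZ; have [? _ _ _] := rP Hk.
rewrite -[f](subrK (\sum_(n < N | `[< H n >]) ratC (lcoef None f n%:Z) * r n)).
apply: stalkD => //; apply: NP => k kN; rewrite -/(gap_reduction f).
have [k0|k0] := ltP k 0.
  rewrite lcoefB f0 // lcoef_sum big1 ?subr0 // => l /asboolP Hl.
  by rewrite lcoefZ; have [_ rl _ _] := rP Hl; rewrite rl ?mulr0 //; lia.
have -> : k = (absz k)%:Z by lia.
have [Hk|nH] := pselect (H (absz k)); first by apply: gap_reductionH => //; lia.
by have [j <-] := (w_gaps _).2 nH; rewrite gap_reduction_gap.
Qed.

Lemma gap_coef_0 j : gap_coef j 0 = 0.
Proof.
have := stalk_gap_coef j stalk1; rewrite big_ord_recl lcoef_1 mulr1 big1 ?addr0 //.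
by move=> i _; rewrite lcoef_1 lift0 mulr0.
Qed.

End Conductor.

Definition gap_fun (a : 'I_g -> nat -> C) j f : C :=
  \sum_(n < (w j).+1) a j n * lcoef None f n%:Z.

Lemma gap_coefP : exists a : 'I_g -> nat -> C, [/\
  forall j k, (w j < k)%N -> a j k = 0,
  forall j k, a j (w k) = (j == k)%:R,
  forall j, a j 0%N = 0 &
  forall f, O f <-> ord_ge None f 0 /\ forall j, gap_fun a j f = 0].
Proof.
have [N NP] := conductor_exists.
have ex k : exists r, H k -> reduced_element N k r.
  have [Hk|no] := pselect (H k); last by exists 0 => Hk; case: no.
  by have [r rP] := reduced_elementP NP Hk; exists r.
have /choice[r rP] := ex.
exists (gap_coef r); split.
- exact: gap_coef_top rP.
- exact: gap_coef_delta.
- exact: (gap_coef_0 NP rP).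
move=> f; split=> [fS|[f0 fW]]; last exact: (gap_coef_stalk NP rP).
by split=> [|j]; [exact: stalk_inf_regular|exact: (stalk_gap_coef NP rP)].
Qed.

End LocalRingAtInfinity.

Section GapDifferentials.
Variables (R : realType) (Cv : rational_curve R) (Pinf : curve_point Cv).
Local Notation C := R[i].
Local Notation tf := (@tofrac {poly C}).
Local Notation X := (ratX R).
Hypothesis C_sing : forall P : curve_point Cv, ~ smooth P <-> P = Pinf.
Hypothesis Pinf_unibranch : unibranch Pinf.
Hypothesis Pinf_coord : nu Cv None = Pinf.
Local Notation O := (@stalk R Cv Pinf).

Lemma lcoef_inv_poly (y : {poly C}) k : lcoef None (subst X^-1 y) k = pseq y k.
Proof.
elim/poly_ind: y k => [|y c IH] k.
  rewrite -polyC0 substC /ratC polyC0 tofrac0 lcoef0.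
  by case: k => // k; rewrite /= coef0.
rewrite substD substM substX substC mulrC lcoefD lcoef_infVX IH.
rewrite -[ratC c]mulr1 lcoefZ lcoef_1.
case: k => [[|k]|k] /=; rewrite ?coefD ?coefMX ?coefC ?mulr0 ?addr0 ?mulr1 //=.
  by rewrite subn1.
Qed.

Section Gaps.
Variables (g : nat) (w : 'I_g -> nat) (a : 'I_g -> nat -> C).
Hypothesis a_top : forall j k, (w j < k)%N -> a j k = 0.
Hypothesis a_delta : forall j k, a j (w k) = (j == k)%:R.
Hypothesis a_0 : forall j, a j 0%N = 0.
Hypothesis a_stalk : forall f, O f <-> ord_ge None f 0 /\ forall j, gap_fun w a j f = 0.

Lemma gap_fun_inv_poly j y :
  gap_fun w a j (subst X^-1 y) = \sum_(k < (w j).+1) a j k * y`_k.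
Proof. by apply: eq_bigr => k _; rewrite lcoef_inv_poly. Qed.

Lemma stalk_inv_poly y : O (subst X^-1 y) <->
  forall j, \sum_(k < (w j).+1) a j k * y`_k = 0.
Proof.
rewrite a_stalk; split=> [[_ h] j|h]; first by rewrite -gap_fun_inv_poly.
split=> [k k0|j]; last by rewrite gap_fun_inv_poly.
by rewrite lcoef_inv_poly; case: k k0.
Qed.

(** The element [gapproj], for a number g of gaps not yet known to be positive. *)
Definition gap_mono n : {poly C} := 'X^n - \sum_i a i n *: 'X^(w i).

Lemma gap_w_gt0 j : (0 < w j)%N.
Proof.
rewrite lt0n; apply/eqP => e; have := a_delta j j.
by rewrite e a_0 eqxx => /eqP; rewrite eq_sym oner_eq0.
Qed.

Lemma sum_coefXn j n (b : nat -> C) : (forall k, (w j < k)%N -> b k = 0) ->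
  \sum_(k < (w j).+1) b k * ('X^n : {poly C})`_k = b n.
Proof.
move=> b0; have [jn|nj] := ltnP (w j) n.
  rewrite b0 // big1 // => k _; rewrite coefXn ltn_eqF ?mulr0 //.
  by have := ltn_ord k; lia.
rewrite (bigD1 (Ordinal (nj : n < (w j).+1)%N)) //= coefXn eqxx mulr1 big1 ?addr0 //.
move=> k kn; rewrite coefXn; case: eqP => [e|]; last by rewrite mulr0.
by case/eqP: kn; apply: val_inj.
Qed.

Lemma stalk_gap_mono n : O (subst X^-1 (gap_mono n)).
Proof.
apply/stalk_inv_poly => j; rewrite /gap_mono.
transitivity (\sum_(k < (w j).+1) a j k * ('X^n : {poly C})`_k -
    \sum_i a i n * \sum_(k < (w j).+1) a j k * ('X^(w i) : {poly C})`_k).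
  under [X in _ = _ - X]eq_bigr do rewrite mulr_sumr.
  rewrite exchange_big -sumrB; apply: eq_bigr => k _.
  rewrite coefB coef_sum mulrBr mulr_sumr; congr (_ - _).
  by apply: eq_bigr => i _; rewrite coefZ mulrCA.
rewrite sum_coefXn => [|k]; last exact: a_top.
under eq_bigr => i _ do rewrite (sum_coefXn _ (a_top (j := j))) a_delta.
rewrite (bigD1 j) //= eqxx mulr1 big1 ?addr0 ?subrr // => i ij.
by rewrite eq_sym (negPf ij) mulr0.
Qed.

Lemma lcoef_inf_mul f (p : {poly C}) K N : (size p <= N)%N ->
  lcoef None (f * (X ^- K * tf p)) 1 =
  \sum_(k < N) p`_k * lcoef None f (k%:Z + 1 - K%:Z).
Proof.
move=> pN; rewrite mulrCA lcoef_infVX_nat mulrC lcoef_inf_poly.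
rewrite (big_ord_widen N (fun k => p`_k * lcoef None f (1 - K%:Z + k%:Z))) //.
rewrite big_mkcond; apply: eq_bigr => k _; case: ltnP => [_|pk].
  by congr (_ * lcoef _ _ _); lia.
by rewrite nth_default ?mul0r.
Qed.


(** t^n pairs with the coefficient of u^(n-1) du. Pairing with 1 kills the coefficient of du/u,
    pairing with [gap_mono n] expresses the others by those at the gaps, and the terms u^(-2) du and
    below are free. *)
Lemma residue_pairing (p : {poly C}) K :
  (forall h, O h -> lcoef None (h * (X ^- K * tf p)) 1 = 0) <->
  ((0 < K)%N -> p`_K.-1 = 0) /\
  forall n, p`_(n + K) = \sum_j a j n.+1 * p`_((w j).-1 + K).
Proof.
(* The guard covers n = K = 0, where the predecessor would wrongly select the coefficient of index
   0. *)
have pair f N : (size p <= N + K)%N -> ord_ge None f 0 ->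
    lcoef None (f * (X ^- K * tf p)) 1 =
    \sum_(n < N.+1) (if (0 < n + K)%N then p`_(n + K).-1 else 0) * lcoef None f n%:Z.
  move=> sp f0; rewrite (@lcoef_inf_mul _ _ _ (N + K)) //.
  rewrite -(big_mkord xpredT (fun k => p`_k * lcoef None f (k%:Z + 1 - K%:Z))).
  have [->|K0] := posnP K.
    rewrite addn0 big_ord_recl /= mul0r add0r big_mkord; apply: eq_bigr => k _.
    by rewrite /bump /= !addn0 add1n /=; congr (_ * lcoef _ _ _); lia.
  rewrite (big_cat_nat (n := K.-1)) /=; [|by []|by lia].
  rewrite big_nat big1 ?add0r => [|k kK]; last by rewrite f0 ?mulr0 //; lia.
  rewrite -{1}[K.-1]add0n big_addn.
  have -> : (N + K - K.-1 = N.+1)%N by lia.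
  rewrite big_mkord; apply: eq_bigr => k _.
  rewrite addn_gt0 K0 orbT; congr (_`_ _ * lcoef _ _ _); first by lia.
  by lia.
split=> [om|[p0 pE] h /a_stalk[h0 hW]].
  have e n : (if (0 < n + K)%N then p`_(n + K).-1 else 0) =
      \sum_j a j n * p`_((w j).-1 + K).
    pose N := (size p + n + \sum_j w j)%N.
    have nN : (n < N.+1)%N by rewrite /N; lia.
    have wN j : (w j < N.+1)%N.
      by rewrite /N (bigD1 j) //=; lia.
    have := om _ (stalk_gap_mono n); rewrite (@pair _ N) => [||k k0]; first last.
    - by rewrite lcoef_inv_poly; case: k k0.
    - by rewrite /N; lia.
    pose b m := if (0 < m + K)%N then p`_(m + K).-1 else 0.
    have sX m : (m < N.+1)%N -> \sum_(l < N.+1) b l * ('X^m : {poly C})`_l = b m.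
      move=> mN; rewrite (bigD1 (Ordinal mN)) //= coefXn eqxx mulr1 big1 ?addr0 //.
      move=> k kn; rewrite coefXn; case: eqP => [e'|]; last by rewrite mulr0.
      by case/eqP: kn; apply: val_inj.
    rewrite [LHS](_ : _ = b n - \sum_i a i n * b (w i)); last first.
      rewrite -(sX n) //.
      under [X in _ = _ - X]eq_bigr => i _ do rewrite -(sX (w i)) // mulr_sumr.
      rewrite exchange_big -sumrB; apply: eq_bigr => k _.
      rewrite lcoef_inv_poly /= coefB coef_sum mulrBr mulr_sumr; congr (_ - _).
      by apply: eq_bigr => i _; rewrite coefZ mulrCA.
    move/eqP; rewrite subr_eq0 => /eqP; rewrite {1}/b => ->.
    apply: eq_bigr => i _; rewrite /b; have := gap_w_gt0 i.
    by case: (w i) => // k _; rewrite addSn.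
  split=> [K0|n]; last by have := e n.+1; rewrite addSn.
  by have := e 0%N; rewrite add0n K0 => ->; rewrite big1 // => j _; rewrite a_0 mul0r.
pose N := (size p + \sum_j w j)%N.
have wN j : ((w j).+1 <= N.+1)%N by rewrite /N (bigD1 j) //=; lia.
rewrite (@pair _ N) //; last by rewrite /N; lia.
transitivity (\sum_(n < N.+1) (\sum_j a j n * p`_((w j).-1 + K)) * lcoef None h n%:Z).
  apply: eq_bigr => -[[|n] nN] _; rewrite /= ?add0n ?addSn /=; last by rewrite pE.
  rewrite [X in _ = X * _]big1 ?mul0r => [|j _]; last by rewrite a_0 mul0r.
  by case: posnP => [|/p0 ->]; rewrite mul0r.
under eq_bigr do rewrite mulr_suml.
rewrite exchange_big big1 // => j _; under eq_bigr do rewrite mulrAC.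
rewrite -mulr_suml; have := hW j; rewrite /gap_fun.
rewrite (big_ord_widen N.+1 (fun n => a j n * lcoef None h n%:Z) (wN j)) big_mkcond /=.
move=> e; rewrite [X in X * _](_ : _ = 0) ?mul0r // -[RHS]e.
by apply: eq_bigr => n _; case: ltnP => // jn; rewrite a_top ?mul0r.
Qed.

Definition gap_diff (j : 'I_g) : ratfun R := tf (\poly_(k < w j) a j k.+1).

Lemma gap_diff_coef j k : (\poly_(k < w j) a j k.+1)`_k = a j k.+1.
Proof. by rewrite coef_poly; case: ltnP => // jk; rewrite a_top. Qed.

Lemma gap_diff_sum (b : 'I_g -> C) :
  \sum_j ratC (b j) * gap_diff j = tf (\sum_j b j *: \poly_(k < w j) a j k.+1).
Proof.
rewrite rmorph_sum; apply: eq_bigr => j _ /=.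
by rewrite -mul_polyC rmorphM.
Qed.

Lemma gap_diff_sum_coef (b : 'I_g -> C) k :
  (\sum_j b j *: \poly_(k < w j) a j k.+1)`_k = \sum_j b j * a j k.+1.
Proof.
by rewrite coef_sum; apply: eq_bigr => j _; rewrite coefZ gap_diff_coef.
Qed.

Lemma gap_diff_sum_coef_gap (b : 'I_g -> C) i :
  (\sum_j b j *: \poly_(k < w j) a j k.+1)`_(w i).-1 = b i.
Proof.
rewrite gap_diff_sum_coef prednK ?gap_w_gt0 //.
under eq_bigr do rewrite a_delta.
rewrite (bigD1 i) //= eqxx mulr1 big1 ?addr0 // => j ij.
by rewrite (negPf ij) mulr0.
Qed.

Lemma H0omega_gap_diff f : H0omega Cv f <->
  exists b : 'I_g -> C, f = \sum_j ratC (b j) * gap_diff j.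
Proof.
rewrite (H0omegaP C_sing Pinf_unibranch Pinf_coord).
have E p : tf p = X ^- 0 * tf p by rewrite expr0 invr1 mul1r.
split=> [[[p ->]]|[b ->]].
  rewrite {1}E => /residue_pairing[_ pE].
  exists (fun j => p`_(w j).-1); rewrite gap_diff_sum; congr tf.
  apply/polyP => k; rewrite gap_diff_sum_coef.
  have := pE k; rewrite addn0 => ->; apply: eq_bigr => j _.
  by rewrite addn0 mulrC.
rewrite gap_diff_sum; split; first by eexists.
rewrite E; apply/residue_pairing; split=> // n.
rewrite addn0 gap_diff_sum_coef; apply: eq_bigr => j _.
by rewrite addn0 gap_diff_sum_coef_gap mulrC.
Qed.

Lemma gap_diff_canonical : canonical_basis Cv gap_diff.
Proof.
split=> [j|f /H0omega_gap_diff[b ->]].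
  apply/H0omega_gap_diff; exists (fun i => (i == j)%:R).
  rewrite (bigD1 j) //= eqxx big1 ?addr0 => [|i /negPf ->].
    by rewrite /ratC tofrac1 mul1r.
  by rewrite /ratC polyC0 tofrac0 mul0r.
exists [ffun j => b j]; split.
  by apply: eq_bigr => j _; rewrite ffunE.
move=> c; rewrite !gap_diff_sum => /tofrac_inj e; apply/ffunP => i.
by rewrite ffunE -gap_diff_sum_coef_gap e gap_diff_sum_coef_gap.
Qed.

End Gaps.
End GapDifferentials.

(** * Frames *)

Section StandardFrame.
Variables (C : comNzRingType) (g : nat) (w : 'I_g -> nat) (a : 'I_g -> nat -> C).
Hypothesis a_top : forall j k, (w j < k)%N -> a j k = 0.
Hypothesis a_delta : forall j k, a j (w k) = (j == k)%:R.
Hypothesis a_0 : forall j, a j 0%N = 0.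
Hypothesis w_gt0 : forall j, (0 < w j)%N.

(* Coefficients of u^(i+1) in the images under iota of the differentials given
   by the functionals a_j, followed by u^(-2)du, u^(-3)du, ... *)
Definition std_frame (i : int) (k : nat) : C :=
  if insub k is Some l then (if i + g%:Z is Posz m then a l m else 0)
  else (i == - k.+1%:Z)%:R.

(* Index at which the k-th vector of the standard frame is 1 and all the others
   vanish. *)
Definition std_pos (k : nat) : int :=
  if insub k is Some l then (w (l : 'I_g))%:Z - g%:Z else - k.+1%:Z.

Lemma std_frame_gap i (l : 'I_g) :
  std_frame i l = if i + g%:Z is Posz m then a l m else 0.
Proof. by rewrite /std_frame valK. Qed.

Lemma std_frame_ge i k : (g <= k)%N -> std_frame i k = (i == - k.+1%:Z)%:R.
Proof. by move=> gk; rewrite /std_frame insubF // ltnNge gk. Qed.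

Lemma std_pos_gap (l : 'I_g) : std_pos l = (w l)%:Z - g%:Z.
Proof. by rewrite /std_pos valK. Qed.

Lemma std_pos_ge k : (g <= k)%N -> std_pos k = - k.+1%:Z.
Proof. by move=> gk; rewrite /std_pos insubF // ltnNge gk. Qed.

Lemma ltn_ordE k : (k < g)%N -> exists l : 'I_g, k = l.
Proof. by move=> kg; exists (Ordinal kg). Qed.

Lemma std_frame_pos k k' : std_frame (std_pos k) k' = (k == k')%:R.
Proof.
have [/ltn_ordE[l ->]|gk'] := ltnP k' g; have [/ltn_ordE[j ->]|gk] := ltnP k g.
- by rewrite std_frame_gap std_pos_gap subrK a_delta eq_sym.
- rewrite std_frame_gap std_pos_ge // gtn_eqF ?(leq_trans (ltn_ord l)) //.
  by have : - k.+1%:Z + g%:Z < 0; [lia|case: (_ + _)].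
- rewrite std_frame_ge // std_pos_gap ltn_eqF ?(leq_trans (ltn_ord j)) //.
  by case: eqP => // e; have := w_gt0 j; lia.
- rewrite std_frame_ge // std_pos_ge //; congr (_%:R).
Qed.

Lemma std_frame_rec (t k : nat) :
  std_frame (t.+1%:Z - g%:Z) k = \sum_j a j t.+1 * std_frame ((w j)%:Z - g%:Z) k.
Proof.
under eq_bigr do rewrite -std_pos_gap std_frame_pos.
have [/ltn_ordE[l ->]|gk] := ltnP k g.
  rewrite std_frame_gap subrK (bigD1 l) //= eqxx mulr1 big1 ?addr0 // => j jl.
  by rewrite (_ : (_ == _) = (j == l)) // (negPf jl) mulr0.
rewrite big1 => [|j _]; last by rewrite ltn_eqF ?mulr0 // (leq_trans (ltn_ord j)).
by rewrite std_frame_ge //; case: eqP => //; lia.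
Qed.

Lemma std_frame_m1 k : std_frame (- g%:Z) k = 0.
Proof.
have [/ltn_ordE[l ->]|gk] := ltnP k g; first by rewrite std_frame_gap addNr; exact: a_0.
by rewrite std_frame_ge //; case: eqP => //; lia.
Qed.

Lemma std_frame_low i k : i + (maxn g k.+1)%:Z < 0 -> std_frame i k = 0.
Proof.
have [/ltn_ordE[l ->]|gk] := ltnP k g => ig.
  by rewrite std_frame_gap; have : i + g%:Z < 0; [lia|case: (_ + _)].
by rewrite std_frame_ge //; case: eqP => //; lia.
Qed.

Lemma std_frame_high i k : (\sum_j w j)%:Z < i + g%:Z -> std_frame i k = 0.
Proof.
move=> ig; have [/ltn_ordE[l ->]|gk] := ltnP k g.
  rewrite std_frame_gap; case: (_ + _) ig => // m; rewrite ltz_nat => mw.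
  by rewrite a_top //; apply: leq_ltn_trans mw; rewrite (bigD1 l) //= leq_addr.
by rewrite std_frame_ge //; case: eqP => //; lia.
Qed.

Definition std_comb (N : nat) (c : nat -> C) (i : int) : C :=
  \sum_(k < N) c k * std_frame i k.

Lemma std_comb_pos N c k : std_comb N c (std_pos k) = if (k < N)%N then c k else 0.
Proof.
rewrite /std_comb; case: ltnP => kN.
  rewrite (bigD1 (Ordinal kN)) //= std_frame_pos eqxx mulr1 big1 ?addr0 // => j jk.
  by rewrite std_frame_pos; case: eqP => [e|]; rewrite ?mulr0 //; case/eqP: jk; apply: val_inj.
rewrite big1 // => j _; rewrite std_frame_pos gtn_eqF ?mulr0 //.
by have := ltn_ord j; lia.
Qed.

(** Besides finite support, these are the conditions of [residue_pairing] on the coefficients of a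
    differential, shifted by g; index - g is that of du/u. *)
Lemma std_combP (s : int -> C) :
  (exists N c, s =1 std_comb N c) <->
  [/\ exists K : nat, forall i : int, i + K%:Z < 0 -> s i = 0,
      exists K : nat, forall i : int, K%:Z < i -> s i = 0,
      s (- g%:Z) = 0 &
      forall t : nat, s (t.+1%:Z - g%:Z) = \sum_j a j t.+1 * s ((w j)%:Z - g%:Z)].
Proof.
split=> [[N [c sE]]|[[K sK] _ s1 srec]].
  split.
  - exists (g + N)%N => i iK; rewrite sE /std_comb big1 // => k _.
    by rewrite std_frame_low ?mulr0 //; have := ltn_ord k; lia.
  - exists (\sum_j w j)%N => i iK; rewrite sE /std_comb big1 // => k _.
    by rewrite std_frame_high ?mulr0 //; lia.
  - by rewrite sE /std_comb big1 // => k _; rewrite std_frame_m1 mulr0.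
  move=> t; rewrite sE /std_comb; under [RHS]eq_bigr do rewrite sE /std_comb mulr_sumr.
  rewrite exchange_big; apply: eq_bigr => k _; rewrite std_frame_rec mulr_sumr.
  by apply: eq_bigr => j _; rewrite mulrCA.
exists (g + K)%N, (fun k => s (std_pos k)) => i; rewrite /std_comb.
rewrite big_split_ord /=.
under [X in X + _]eq_bigr do rewrite /= std_pos_gap std_frame_gap.
under [X in _ + X]eq_bigr do rewrite /= std_frame_ge ?leq_addr // std_pos_ge ?leq_addr //.
have [ig|ig] := ltP (i + g%:Z) 0; last first.
  rewrite [X in _ + X]big1 => [|k _]; last by case: eqP; rewrite ?mulr0 //; lia.
  have [t tE] : exists t : nat, i + g%:Z = t%:Z by exists (absz (i + g%:Z)); lia.
  have iE : i = t%:Z - g%:Z by lia.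
  rewrite tE addr0 iE; case: t {ig tE iE} => [|t].
    by rewrite sub0r s1 big1 // => j _; rewrite a_0 mulr0.
  by rewrite srec; apply: eq_bigr => j _; rewrite mulrC.
rewrite big1 ?add0r => [|j _]; last by case: (_ + _) ig; rewrite ?mulr0.
have [iK|iK] := ltP (i + (g + K)%N%:Z) 0.
  by rewrite sK ?big1 // => [k _|]; [case: eqP; rewrite ?mulr0 //; have := ltn_ord k; lia|lia].
pose q := absz (- i - g%:Z - 1)%R.
have kP : (q < K)%N by lia.
rewrite (bigD1 (Ordinal kP)) //= big1 ?addr0.
  have e : i = - (g + q).+1%:Z by lia.
  by rewrite -e eqxx mulr1.
move=> k kk; case: eqP => e; rewrite ?mulr0 //; case/eqP: kk; apply: val_inj => /=; lia.
Qed.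

End StandardFrame.

(** * The point of the Sato Grassmannian *)

Section GapSystemOfCurve.
Variables (R : realType) (Cv : rational_curve R) (P0 Pinf : curve_point Cv).
Local Notation C := R[i].
Local Notation tf := (@tofrac {poly C}).
Local Notation X := (ratX R).
Hypothesis C_sing : forall P : curve_point Cv, ~ smooth P <-> P = Pinf.
Hypothesis Pinf_unibranch : unibranch Pinf.
Hypothesis P0_coord : nu Cv (Some 0) = P0.
Hypothesis Pinf_coord : nu Cv None = Pinf.
Local Notation O := (@stalk R Cv Pinf).

Lemma lcoef_0_X f (z n : int) :
  lcoef (Some 0) (X ^ z * f) n = lcoef (Some 0) f (n - z).
Proof.
have pos (m : nat) h k : lcoef (Some 0) (X ^+ m * h) k = lcoef (Some 0) h (k - m%:Z).
  by have := lcoef_finX_nat 0 h m k; rewrite /ratC polyC0 tofrac0 subr0.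
case: z => m; first exact: pos.
rewrite -[in RHS](mulVKf (expf_neq0 m.+1 (ratX_neq0 R)) f) pos; congr lcoef.
by lia.
Qed.

Lemma iota_diffE g (p : {poly C}) K n :
  iota_diff g (X ^- K * tf p) n = pseq p (n - 2 + g%:Z + K%:Z).
Proof.
rewrite /iota_diff lcoef_0_X; have -> : X ^- K = X ^ (- K%:Z) by rewrite -exprnN.
rewrite lcoef_0_X lcoef_fin_poly polyC0 addr0 comp_polyXr; congr pseq.
by lia.
Qed.

Variables (g : nat) (w : 'I_g -> nat) (a : 'I_g -> nat -> C).
Hypothesis a_top : forall j k, (w j < k)%N -> a j k = 0.
Hypothesis a_delta : forall j k, a j (w k) = (j == k)%:R.
Hypothesis a_0 : forall j, a j 0%N = 0.
Hypothesis a_stalk : forall f, O f <-> ord_ge None f 0 /\ forall j, gap_fun w a j f = 0.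

Let w_gt0 := gap_w_gt0 a_delta a_0.

(** Without functionals the local ring would contain all functions regular at infinity, against the
    singularity of [Pinf]. *)
Lemma gap_number_neq0 : g != 0%N.
Proof.
apply/eqP => g0; have /C_sing : Pinf = Pinf by []; apply=> f reg.
apply/a_stalk; split; first exact: (reg None).
by move=> j; have := ltn_ord j; rewrite [in X in (_ < X)%N]g0.
Qed.

Lemma iota_H0L_infty s : (exists2 f, H0L_infty P0 g f & iota_diff g f = s) <->
  exists N c, s =1 (fun n => std_comb a N c (n - 1)).
Proof.
have -> : (exists N c, s =1 (fun n => std_comb a N c (n - 1))) <->
    (exists N c, (fun i => s (i + 1)) =1 std_comb a N c).
  by split=> -[N [c sE]]; exists N, c => i; [rewrite sE addrK|rewrite -sE subrK].
rewrite (std_combP a_top a_delta a_0 w_gt0); split=> [[f]|[[K1 sK1] [K2 sK2] s1 srec]].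
  rewrite (H0L_inftyP C_sing Pinf_unibranch P0_coord Pinf_coord).
  case=> -[K [p ->]] /(residue_pairing a_top a_delta a_0 a_stalk)[p0 pE] <-; split.
  - exists (g + K)%N => i iK; rewrite iota_diffE.
    by have : i + 1 - 2 + g%:Z + K%:Z < 0; [lia|case: (_ + _)].
  - exists (size p + 1)%N => i iK; rewrite iota_diffE.
    have : (size p)%:Z <= i + 1 - 2 + g%:Z + K%:Z by lia.
    by case: (_ + _) => // k pk; rewrite /= nth_default.
  - rewrite iota_diffE; case: K p0 {pE} => [|K] p0.
      by have : - g%:Z + 1 - 2 + g%:Z + 0%:Z < 0; [lia|case: (_ + _)].
    by have -> : - g%:Z + 1 - 2 + g%:Z + K.+1%:Z = K%:Z; [lia|exact: p0].
  move=> t; rewrite iota_diffE.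
  have -> : t.+1%:Z - g%:Z + 1 - 2 + g%:Z + K%:Z = (t + K)%N%:Z by lia.
  rewrite /= pE; apply: eq_bigr => j _; rewrite iota_diffE; congr (_ * _).
  have -> : (w j)%:Z - g%:Z + 1 - 2 + g%:Z + K%:Z = ((w j).-1 + K)%N%:Z; last by [].
  by have := w_gt0 j; lia.
(* The shift K moves the support of s to nonnegative indices, and the length N + g reaches its upper
   end. *)
pose K := K1.+2; pose N := (K2 + K + 2)%N.
pose p : {poly C} := \poly_(m < N + g) s (m%:Z - K%:Z + 2 - g%:Z).
have pE m : p`_m = s (m%:Z - K%:Z + 2 - g%:Z).
  rewrite coef_poly; case: ltnP => // mN.
  have := sK2 (m%:Z - K%:Z + 1 - g%:Z); rewrite -[X in s X]addrA => sm.
  have -> : m%:Z - K%:Z + 2 - g%:Z = m%:Z - K%:Z + 1 - g%:Z + 1 by lia.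
  by rewrite -[in RHS]addrA sm //; rewrite /N in mN; lia.
exists (X ^- K * tf p).
  rewrite (H0L_inftyP C_sing Pinf_unibranch P0_coord Pinf_coord); split; first by exists K, p.
  apply/(residue_pairing a_top a_delta a_0 a_stalk); split=> [_|n].
    by rewrite pE -[RHS]s1; congr s; lia.
  rewrite pE; have -> : (n + K)%N%:Z - K%:Z + 2 - g%:Z = n.+1%:Z - g%:Z + 1 by lia.
  rewrite srec; apply: eq_bigr => j _; rewrite pE; congr (_ * s _).
  by have := w_gt0 j; lia.
apply/funext => n; rewrite iota_diffE.
case E : (n - 2 + g%:Z + K%:Z) => [m|m] /=.
  by rewrite pE; congr s; lia.
by have <- : n - 1 + 1 = n; [lia|rewrite sK1 //; lia].
Qed.

End GapSystemOfCurve.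

Lemma gap_system_of_curve (R : realType) (Cv : rational_curve R) (Pinf : curve_point Cv)
    n (w : 'I_n.+1 -> nat) (a : 'I_n.+1 -> nat -> R[i]) :
  (forall i j : 'I_n.+1, (i < j)%N -> (w i < w j)%N) ->
  (forall j k, (w j < k)%N -> a j k = 0) ->
  (forall j k, a j (w k) = (j == k)%:R) ->
  (forall j, a j 0%N = 0) ->
  (forall f, stalk Pinf f <-> ord_ge None f 0 /\ forall j, gap_fun w a j f = 0) ->
  gap_system w a.
Proof.
move=> w_ltn a_top a_delta a_0 a_stalk; split=> // y v /(stalk_inv_poly a_stalk) yS.
move=> /(stalk_inv_poly a_stalk) vS; apply/(stalk_inv_poly a_stalk).
by rewrite substM; apply: stalkM.
Qed.

(** * Stable determinants and change of frame *)

Section StableDeterminant.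
Variable C : comNzRingType.
Implicit Type f : nat -> nat -> C.

Definition detn (N : nat) f : C := \det (\matrix_(i < N, j < N) f i j).

Lemma eq_detn N f f' : (forall i j, (i < N)%N -> (j < N)%N -> f i j = f' i j) ->
  detn N f = detn N f'.
Proof. by move=> e; congr (\det _); apply/matrixP => i j; rewrite !mxE e. Qed.

Lemma detn_last_row N f : (forall j, (j < N)%N -> f N j = 0) -> f N N = 1 ->
  detn N.+1 f = detn N f.
Proof.
move=> f0 f1; rewrite /detn (expand_det_row _ ord_max) (bigD1 ord_max) //=.
rewrite big1 => [|j jN]; last first.
  rewrite !mxE /= f0 ?mul0r // ltn_neqAle -ltnS ltn_ord andbT.
  by apply: contra jN => /eqP e; apply/eqP/val_inj.
rewrite addr0 mxE /= f1 mul1r /cofactor /= addnn -signr_odd odd_double expr0 mul1r.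
by congr (\det _); apply/matrixP => i j; rewrite !mxE !lift_max.
Qed.

Lemma detn_stable N N' f : (N <= N')%N ->
  (forall k j, (N <= k)%N -> (j < k)%N -> f k j = 0) ->
  (forall k, (N <= k)%N -> f k k = 1) -> detn N' f = detn N f.
Proof.
move=> NN' f0 f1; rewrite -(subnK NN'); elim: (N' - N)%N => // d IH.
by rewrite addSn detn_last_row ?IH // => [j jd|]; [apply: f0|apply: f1]; rewrite ?leq_addl.
Qed.

Lemma detn_col0 N f j : (j < N)%N -> (forall i, (i < N)%N -> f i j = 0) -> detn N f = 0.
Proof.
move=> jN f0; rewrite /detn (expand_det_col _ (Ordinal jN)) big1 // => i _.
by rewrite mxE f0 ?mul0r.
Qed.

Lemma detnM N f f' :
  detn N (fun i j => \sum_(k < N) f i k * f' k j) = detn N f * detn N f'.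
Proof.
rewrite /detn -det_mulmx; congr (\det _); apply/matrixP => i j; rewrite !mxE.
by apply: eq_bigr => k _; rewrite !mxE.
Qed.

End StableDeterminant.

Section FrameChange.
Variable R : realType.
Local Notation C := R[i].
Variables (g : nat) (w : 'I_g -> nat) (a : 'I_g -> nat -> C).
Hypothesis a_delta : forall j k, a j (w k) = (j == k)%:R.
Hypothesis w_gt0 : forall j, (0 < w j)%N.
Variable U : set (int -> C).
Hypothesis UP : forall s, U s <-> exists N c, s =1 (fun n => std_comb a N c (n - 1)).
Local Notation pos := (std_pos w).

Lemma frame_combE xi N (c : nat -> C) n :
  frame_comb xi N.+1 c n = \sum_(j < N) c j.+1 * xi (n - 1) j.+1.
Proof. by rewrite /frame_comb big_add1 big_mkord. Qed.

Lemma std_frame_is_frame : is_frame U (fun i j => std_frame a i j.-1).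
Proof.
split.
- apply/seteqP; split=> s.
    move/UP=> [N [c sE]]; exists N.+1, (fun j => c j.-1); apply/funext => n.
    by rewrite sE frame_combE.
  move=> [N [c ->]]; apply/UP; case: N => [|N].
    by exists 0%N, (fun=> 0) => n; rewrite /frame_comb big_geq // /std_comb big_ord0.
  by exists N, (fun j => c j.+1) => n; rewrite frame_combE.
- case=> [|N] c h [|j] //= jN.
  have := h (pos j + 1); rewrite frame_combE addrK => e.
  have := std_comb_pos a_delta w_gt0 N (fun j => c j.+1) j.
  by rewrite /std_comb e ltnS in jN * => ->; rewrite jN.
exists g => -[|j] // _; rewrite ltnS; case: ltnP => [jg|gj].
  by move=> i ig; rewrite std_frame_low //= (maxn_idPl _) //; lia.
rewrite /= std_frame_ge // eqxx; split=> // i ij.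
by rewrite std_frame_ge // lt_eqF.
Qed.

Variable xi : int -> nat -> C.
Hypothesis xi_frame : is_frame U xi.

(** For k >= N the k-th standard vector is supported at -(k+1), below row -N. So each truncated
    minor of [xi] is a product of two N x N determinants. *)
Lemma frame_vectorE N j i : (g <= N)%N -> - N%:Z <= i ->
  xi i j.+1 = \sum_(k < N) std_frame a i k * xi (pos k) j.+1.
Proof.
move=> gN iN; have [Uxi _ _] := xi_frame.
have : U (fun n => xi (n - 1) j.+1).
  rewrite Uxi; exists j.+2, (fun k => (k == j.+1)%:R); apply/funext => n.
  rewrite frame_combE big_ord_recr /= eqxx mul1r big1 ?add0r // => k _.
  by rewrite eqSS ltn_eqF ?ltn_ord ?mul0r.
case/UP=> N1 [c xiE]; have xiE' k : xi k j.+1 = std_comb a N1 c k.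
  by have := xiE (k + 1); rewrite addrK.
have big (M : nat) : (N <= M)%N -> (N1 <= M)%N ->
    xi i j.+1 = \sum_(k < M) std_frame a i k * xi (pos k) j.+1.
  move=> NM N1M; rewrite xiE' /std_comb.
  rewrite (big_ord_widen M (fun k => c k * std_frame a i k)) // big_mkcond.
  apply: eq_bigr => k _; rewrite xiE' std_comb_pos //.
  by case: ltnP => _; rewrite ?mulr0 // mulrC.
rewrite (big (maxn N N1)) ?leq_maxl ?leq_maxr //.
rewrite [RHS](big_ord_widen (maxn N N1) (fun k => std_frame a i k * xi (pos k) j.+1)) ?leq_maxl //.
rewrite [RHS]big_mkcond; apply: eq_bigr => k _; case: ltnP => // Nk.
by rewrite std_frame_ge ?(leq_trans gN) //; case: eqP; rewrite ?mul0r //; lia.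
Qed.

Definition frame_det N : C := detn N (fun k j => xi (pos k) j.+1).

(** The change of frame is unitriangular beyond some index. A kernel vector would give a combination
    of frame vectors that vanishes at all pivots [std_pos], hence vanishes, against independence. *)
Lemma frame_det_stable : exists N0 : nat, [/\ (g <= N0)%N, frame_det N0 != 0 &
  forall N, (N0 <= N)%N -> frame_det N = frame_det N0].
Proof.
have [Uxi free [l low]] := xi_frame; exists (maxn g l).
have low0 k j : (maxn g l <= k)%N -> (j < k)%N -> xi (pos k) j.+1 = 0.
  rewrite geq_max => /andP[gk lk] jk; rewrite std_pos_ge //.
  by have := low j.+1 isT; case: ltnP => [lj [_ h]|jl h]; apply: h; lia.
split; first exact: leq_maxl; last first.
  move=> N NN; apply: detn_stable => // k.
  rewrite geq_max => /andP[gk lk]; rewrite std_pos_ge //.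
  by have := low k.+1 isT; rewrite ltnS lk => -[].
set N := maxn g l; rewrite /frame_det /detn -det_tr; apply/negP => /det0P[v v0].
move=> /rowP vB; pose c j := if insub j.-1 is Some i then v 0 (i : 'I_N) else 0.
have cE (i : 'I_N) : c i.+1 = v 0 i by rewrite /c /= valK.
have : U (frame_comb xi N.+1 c) by rewrite Uxi; exists N.+1, c.
case/UP=> M [d dE]; case/eqP: v0; apply/rowP => i; rewrite mxE -cE.
apply: (free N.+1 c) => [n|]; last by rewrite /= ltnS.
rewrite dE /std_comb big1 // => k _; suff -> : d k = 0 by rewrite mul0r.
have := std_comb_pos a_delta w_gt0 M d k; rewrite ltn_ord => <-.
have := dE (pos k + 1); rewrite addrK => <-; rewrite frame_combE addrK.
have [kN|Nk] := ltnP k N; last first.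
  by rewrite big1 // => j _; rewrite low0 ?mulr0 // (leq_trans (ltn_ord j)).
have := vB (Ordinal kN); rewrite !mxE => {2}<-; apply: eq_bigr => j _.
by rewrite cE !mxE.
Qed.

Definition std_part (la : seq nat) : C :=
  detn g (fun i j => std_frame a ((nth 0%N la i)%:Z - i.+1%:Z) j).

(** With more than g parts, the column of index [size la] - 1 has its only entry at - [size la], a
    row that nonzero parts never select. *)
Lemma std_part_stable la N : 0%N \notin la -> (maxn g (size la) <= N)%N ->
  detn N (fun i j => std_frame a ((nth 0%N la i)%:Z - i.+1%:Z) j) =
  if (size la <= g)%N then std_part la else 0.
Proof.
move=> la0; rewrite geq_max => /andP[gN sN].
have f0 k j : (maxn g (size la) <= k)%N -> (j < k)%N ->
    std_frame a ((nth 0%N la k)%:Z - k.+1%:Z) j = 0.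
  rewrite geq_max => /andP[gk sk] jk; rewrite nth_default // sub0r.
  have [jg|gj] := ltnP j g; first by rewrite std_frame_low // (maxn_idPl _) //; lia.
  by rewrite std_frame_ge //; case: eqP => //; lia.
have f1 k : (maxn g (size la) <= k)%N -> std_frame a ((nth 0%N la k)%:Z - k.+1%:Z) k = 1.
  rewrite geq_max => /andP[gk sk]; rewrite nth_default // sub0r std_frame_ge //.
  by rewrite eqxx.
rewrite (@detn_stable _ (maxn g (size la))) //; last by rewrite geq_max gN.
case: leqP => // sg.
apply: (@detn_col0 _ _ _ (size la).-1) => [|i il]; first by lia.
rewrite std_frame_ge; last by lia.
case: eqP => // e; have := mem_nth 0%N il; case E : (nth 0%N la i) => [|m].
  by rewrite (negPf la0).
by rewrite E in e; lia.
Qed.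

Lemma xi_part_frame : exists2 kappa : C, kappa != 0 & forall la, is_partition la ->
  xi_part xi la = if (size la <= g)%N then kappa * std_part la else 0.
Proof.
have [N0 [gN0 k0 kE]] := frame_det_stable; exists (frame_det N0) => // la [_ la0].
set v := RHS; pose P := [set v : C | exists N1 : nat, forall N : nat, (N1 <= N)%N ->
  \det (\matrix_(i < N, j < N) xi ((nth 0%N la i)%:Z - i.+1%:Z) j.+1) = v].
have Pv : P v.
  exists (maxn N0 (size la)) => N; rewrite geq_max => /andP[NN sN].
  rewrite -[LHS]/(detn N (fun i j => xi ((nth 0%N la i)%:Z - i.+1%:Z) j.+1)).
  have gN := leq_trans gN0 NN.
  transitivity (detn N (fun i j => \sum_(k < N)
      std_frame a ((nth 0%N la i)%:Z - i.+1%:Z) k * xi (pos k) j.+1)).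
    apply: eq_detn => i j iN jN; apply: frame_vectorE => //; by lia.
  rewrite -[LHS]/(detn N (fun i j => \sum_(k < N)
      (fun i k => std_frame a ((nth 0%N la i)%:Z - i.+1%:Z) k) i k *
      (fun k j => xi (pos k) j.+1) k j)) detnM -/(frame_det N) kE //.
  rewrite std_part_stable //; last by rewrite geq_max gN.
  by rewrite /v; case: leqP; rewrite ?mul0r // mulrC.
rewrite /xi_part -/P; apply: xget_subset1 => // u u' [M uM] [M' uM'].
by rewrite -(uM (maxn M M')) ?leq_maxl // uM' ?leq_maxr.
Qed.

End FrameChange.

(** * Partitions and the tau function *)

Section CauchyBinet.
Variables (S : comNzRingType) (g D : nat).
Variables A B : 'I_D -> 'I_g -> S.
Implicit Types (t l : g.-tuple 'I_D) (s : 'S_g).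

Let geD : rel 'I_D := fun x y => (y <= x)%N.

Let geD_total : total geD. Proof. by move=> x y; exact: leq_total. Qed.

Let geD_trans : transitive geD. Proof. by move=> y x z /[swap]; exact: leq_trans. Qed.

Let geD_anti : antisymmetric geD.
Proof. by move=> x y e; apply/val_inj/eqP; rewrite eqn_leq andbC. Qed.

(** Strictly decreasing tuples, the order in which a partition lists its rows. *)
Definition minor_tuple t : bool := uniq t && sorted geD t.

Let permute l s : g.-tuple 'I_D := [tuple tnth l (s i) | i < g].

Let dec t : g.-tuple 'I_D := [tuple of sort geD t].

Lemma minor_tuple_orbit l t : minor_tuple l ->
  uniq t && (dec t == l) = (t \in imset (permute l) (mem (predT : pred 'S_g))).
Proof.
case/andP=> ul sl; apply/andP/imsetP => [[ut /eqP tl]|[s _ ->]].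
  have /tuple_permP[s tE] : perm_eq t l by rewrite -tl perm_sym perm_sort.
  by exists s; rewrite ?inE //; apply: val_inj.
have pl : perm_eq (permute l s) l by apply/tuple_permP; exists s.
split; first by rewrite (perm_uniq pl).
apply/eqP/val_inj => /=; rewrite -[RHS](sorted_sort geD_trans sl).
exact/(perm_sortP geD_total geD_trans geD_anti).
Qed.

Lemma permute_inj l : uniq l -> injective (permute l).
Proof.
move=> ul s s' e; apply/permP => i; have := congr1 (fun t => tnth t i) e.
by rewrite !tnth_mktuple => /(tuple_uniqP _ ul).
Qed.

Let G t := (\prod_j A (tnth t j) j) * \det (\matrix_(j, k) B (tnth t j) k).

Lemma minor_orbit_sum l :
  \sum_s G (permute l s) =
  \det (\matrix_(i, j) A (tnth l i) j) * \det (\matrix_(i, k) B (tnth l i) k).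
Proof.
rewrite -[X in X * _]det_tr [X in X * _]/(\det _) mulr_suml; apply: eq_bigr => s _.
rewrite /G; have -> : \matrix_(j, k) B (tnth (permute l s) j) k =
    row_perm s (\matrix_(i, k) B (tnth l i) k).
  by apply/matrixP => i k; rewrite !mxE tnth_mktuple.
rewrite row_permE det_mulmx det_perm mulrCA mulrA; congr (_ * _ * _).
by apply: eq_bigr => j _; rewrite !mxE tnth_mktuple.
Qed.

(** Expand over all tuples: repeated rows give a zero determinant, and the injective tuples are the
    orbits of the decreasing ones under the symmetric group. *)
Lemma cauchy_binet :
  \det (\matrix_(j, k) \sum_l A l j * B l k) =
  \sum_(l | minor_tuple l)
    \det (\matrix_(i, j) A (tnth l i) j) * \det (\matrix_(i, k) B (tnth l i) k).
Proof.
have -> : \det (\matrix_(j, k) \sum_l A l j * B l k) = \sum_t G t.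
  transitivity (\sum_(s : 'S_g) \sum_(f : {ffun 'I_g -> 'I_D})
      (-1) ^+ s * \prod_j (A (f j) j * B (f j) (s j))).
    apply: eq_bigr => s _; rewrite -mulr_sumr.
    rewrite -(bigA_distr_bigA (fun (j : 'I_g) (x : 'I_D) => A x j * B x (s j))).
    by congr (_ * _); apply: eq_bigr => j _; rewrite mxE.
  rewrite exchange_big (reindex (fun t => [ffun i => tnth t i])) /=; last first.
    exists (fun f => [tuple f i | i < g]) => [t _|f _].
      by apply: eq_from_tnth => i; rewrite tnth_mktuple ffunE.
    by apply/ffunP => i; rewrite ffunE tnth_mktuple.
  apply: eq_bigr => t _; rewrite /G mulr_sumr; apply: eq_bigr => s _.
  rewrite big_split /= mulrCA; congr (_ * (_ * _)).
    by apply: eq_bigr => j _; rewrite ffunE.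
  by apply: eq_bigr => j _; rewrite ffunE mxE.
rewrite (bigID (fun t => uniq t)) /= [X in _ + X]big1 ?addr0 => [|t tu]; last first.
  have [i [j [ij tij]]] : exists i j, i != j /\ tnth t i = tnth t j.
    apply: contrapT => no; case/negP: tu; apply/tuple_uniqP => i j tij.
    by apply: contrapT => /eqP ij; apply: no; exists i, j.
  rewrite /G (determinant_alternate ij) ?mulr0 // => k.
  by rewrite !mxE tij.
rewrite (partition_big dec minor_tuple) /=; last first.
  by move=> t ut; rewrite /minor_tuple sort_uniq ut sort_sorted.
apply: eq_bigr => l lP; rewrite -minor_orbit_sum.
rewrite (eq_bigl (mem (imset (permute l) (mem (predT : pred 'S_g))))); last first.
  by move=> t; exact: minor_tuple_orbit.
rewrite big_imset /=; last first.
  by case/andP: lP => ul _ s s' _ _; exact: permute_inj.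
by apply: eq_bigl => s; rewrite inE.
Qed.

End CauchyBinet.

Lemma geq_trans : transitive geq.
Proof. by move=> y x z yx zy; exact: leq_trans zy yx. Qed.

Section PartitionsOfTuples.
Variables (n D : nat).
Local Notation g := n.+1.
Implicit Types (t : g.-tuple 'I_D.+1) (la : seq nat).

(** The classical bijection between partitions with at most g parts and decreasing tuples, t_i =
    la_i + n - i. *)
Definition part_shift t (i : nat) : nat := (tnth t (inord i) - (n - i))%N.

Definition part_of_tuple t : seq nat := [seq x <- mkseq (part_shift t) g | x != 0%N].

(** In a decreasing list the zeros come last, and the default value 0 replaces them. *)
Lemma nth_filter_neq0 la i : sorted geq la -> nth 0%N [seq x <- la | x != 0%N] i = nth 0%N la i.
Proof.
elim: la i => //= x la IH i pla; case: eqP => [x0|_] /=.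
  have la0 : all (pred1 0%N) la.
    have := order_path_min geq_trans pla.
    by apply: sub_all => y /=; rewrite x0 /= leqn0.
  have -> : [seq y <- la | y != 0%N] = [::].
    apply/eqP; rewrite -size_eq0 size_filter -leqn0 leqNgt -has_count -all_predC.
    by apply/allP => y /(allP la0) /= /eqP ->.
  rewrite nth_nil; case: i => //= i; have [il|li] := ltnP i (size la).
    by have /eqP := allP la0 _ (mem_nth 0%N il).
  by rewrite nth_default.
by case: i => //= i; rewrite IH // (path_sorted pla).
Qed.

Lemma minor_tuple_step t i : minor_tuple t -> (i < n)%N ->
  (tnth t (inord i.+1) < tnth t (inord i))%N.
Proof.
case/andP=> ut st ii; have iS : (i.+1 < size t)%N by rewrite size_tuple.
have := sorted_ltn_nth (fun y x z => @geq_trans (val y) (val x) (val z)) ord0 st.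
move=> /(_ i i.+1); rewrite !inE iS (ltn_trans _ iS) // => /(_ isT isT (ltnSn i)) le.
rewrite !(tnth_nth ord0) !inordK //; last exact: ltnW.
rewrite ltn_neqAle [X in _ && X]le andbT; apply/negP => /eqP/val_inj/eqP.
by rewrite nth_uniq // ?(ltnW iS) // gtn_eqF.
Qed.

Lemma minor_tuple_ge t i : minor_tuple t -> (i < g)%N -> (n - i <= tnth t (inord i))%N.
Proof.
move=> mt; have [d dE] : exists d, (n - i)%N = d by eexists.
elim: d i dE => [|d IH] i dE ig; first by rewrite dE.
have lt : (i < n)%N by lia.
have := minor_tuple_step mt lt; have := IH i.+1; rewrite ltnS => /(_ _ lt); lia.
Qed.

Lemma part_shift_sorted t : minor_tuple t -> sorted geq (mkseq (part_shift t) g).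
Proof.
move=> mt; apply/(sortedP 0%N) => i; rewrite size_mkseq => ig.
rewrite !nth_mkseq //; last exact: ltnW.
have := minor_tuple_step mt ig; rewrite /part_shift /=.
have := minor_tuple_ge mt (ltnW ig); lia.
Qed.

Lemma part_of_tupleP t : minor_tuple t -> is_partition (part_of_tuple t).
Proof.
move=> mt; split; last by rewrite mem_filter.
by exact: (sorted_filter geq_trans) (part_shift_sorted mt).
Qed.

Lemma size_part_of_tuple t : (size (part_of_tuple t) <= g)%N.
Proof. by rewrite size_filter (leq_trans (count_size _ _)) // size_mkseq. Qed.

Lemma nth_part_of_tuple t (i : 'I_g) : minor_tuple t ->
  (nth 0%N (part_of_tuple t) i + (n - i))%N = tnth t i.
Proof.
move=> mt; rewrite nth_filter_neq0 ?part_shift_sorted // nth_mkseq //.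
by have := minor_tuple_ge mt (ltn_ord i); rewrite /part_shift inord_val; lia.
Qed.

Lemma part_of_tuple_inj : {in @minor_tuple g D.+1 &, injective part_of_tuple}.
Proof.
move=> t t' mt mt' e; apply: eq_from_tnth => i; apply: val_inj.
by rewrite /= -!nth_part_of_tuple // e.
Qed.

Lemma part_of_tuple_surj la : is_partition la -> (size la <= g)%N ->
  (nth 0 la 0 + n <= D)%N -> exists2 t, minor_tuple t & la = part_of_tuple t.
Proof.
case=> sla la0 sg laD.
have dec i j : (i <= j)%N -> (nth 0 la j <= nth 0 la i)%N.
  move=> ij; have [jl|lj] := ltnP j (size la); last by rewrite nth_default.
  apply: (sorted_leq_nth geq_trans leqnn 0%N sla) => //.
  by rewrite inE (leq_ltn_trans ij).
pose v i := (nth 0 la i + (n - i))%N.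
have vD i : (v i < D.+1)%N by have := dec 0%N i isT; rewrite /v; lia.
pose t : g.-tuple 'I_D.+1 := [tuple inord (v i) | i < g].
have tE (i : 'I_g) : tnth t i = v i :> nat by rewrite tnth_mktuple inordK.
have vdec i j : (i < j)%N -> (j < g)%N -> (v j < v i)%N.
  by move=> ij jg; have := dec i j (ltnW ij); rewrite /v; lia.
have mt : minor_tuple t.
  apply/andP; split.
    apply/tuple_uniqP => i j /(congr1 val); rewrite /= !tE => e; apply/val_inj/eqP.
    by case: (ltngtP i j) => // ij; have := vdec _ _ ij (ltn_ord _); rewrite e ltnn.
  apply/(sortedP ord0) => i; rewrite size_tuple => ig.
  have ig' := ltnW ig; rewrite -(tnth_nth _ t (Ordinal ig)) -(tnth_nth _ t (Ordinal ig')).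
  by rewrite !tE /= ltnW // vdec.
exists t => //; rewrite /part_of_tuple.
have -> : mkseq (part_shift t) g = la ++ nseq (g - size la) 0%N.
  apply: (@eq_from_nth _ 0%N) => [|i]; rewrite size_mkseq.
    by rewrite size_cat size_nseq subnKC.
  move=> ig; rewrite nth_mkseq // /part_shift tE inordK // /v addnK nth_cat.
  by case: ltnP => // li; rewrite nth_nseq if_same nth_default.
rewrite filter_cat; have -> : [seq x <- nseq (g - size la) 0%N | x != 0%N] = [::].
  by elim: (_ - _)%N.
rewrite cats0; apply/esym/all_filterP/allP => x xl /=.
by apply: contraNneq la0 => <-.
Qed.

Lemma sum_partitions (V : nmodType) (F : seq nat -> V) :
  (forall la, is_partition la -> (g < size la)%N || (D < nth 0 la 0 + n)%N -> F la = 0) ->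
  \sum_(la \in [set la | is_partition la]) F la =
  \sum_(t : g.-tuple 'I_D.+1 | minor_tuple t) F (part_of_tuple t).
Proof.
move=> F0; pose r := [seq part_of_tuple t | t <- enum (@minor_tuple g D.+1)].
rewrite (@fsbigE _ _ _ _ _ r).
- rewrite big_map [RHS]big_mkcond big_enum_cond /= big_mkcond; apply: eq_bigr => t _.
  rewrite -[t \in _]/(minor_tuple t); have [mt|/negPf mt] := boolP (minor_tuple t) => //.
  by rewrite ifT //; apply/mem_set/part_of_tupleP.
- rewrite map_inj_in_uniq ?enum_uniq // => t t'; rewrite !mem_enum => mt mt'.
  exact: part_of_tuple_inj.
- by move=> la /= /mapP[t]; rewrite mem_enum => mt ->; exact: part_of_tupleP.
move=> la laP lar; apply: F0 => //; apply: contraNT lar.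
rewrite negb_or -!leqNgt => /andP[sg lD].
have [t mt ->] := part_of_tuple_surj laP sg lD.
by apply: map_f; rewrite mem_enum.
Qed.

End PartitionsOfTuples.

(** * The tau function as a determinant *)

Section TauTheta.
Variables (R : realType) (n : nat).
Local Notation C := R[i].
Local Notation g := n.+1.
Local Notation P := (mpoly_ring C g).
Local Notation mC := (@mpoly.mpolyC g C : C -> P).

Lemma detn_matrix (S : comNzRingType) N (f : nat -> nat -> S) (M : 'M[S]_N) :
  (forall i j : 'I_N, f i j = M i j) -> detn N f = \det M.
Proof. by move=> e; congr (\det _); apply/matrixP => i j; rewrite !mxE e. Qed.

Section SchurWeierstrass.
Variable x : nat -> P.
Hypothesis sigma0 : sigma x 0 = 1.

Lemma schur_weierstrass_detn la N : (size la <= N)%N ->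
  schur_weierstrass x la = detn N (fun i j => sigma x ((nth 0%N la i)%:Z + j%:Z - i%:Z)).
Proof.
move=> sN; apply/esym; apply: (detn_stable sN) => [k j sk jk|k sk]; rewrite nth_default //.
  by have : 0%:Z + j%:Z - k%:Z < 0; [lia|case: (0%:Z + j%:Z - k%:Z)].
by rewrite add0r subrr.
Qed.

End SchurWeierstrass.

Variables (w : 'I_g -> nat) (a : 'I_g -> nat -> C).
Hypothesis gapS : gap_system w a.
Let a_top := gap_top gapS.
Let a_delta := gap_delta gapS.
Hypothesis w_gt0 : forall j, (0 < w j)%N.
Local Notation D := (w ord_max).
Variable x : nat -> P.
Hypothesis sigma0 : sigma x 0 = 1.
Local Notation T := (theta_poly w a (fun k => sigma x k%:Z)).

Lemma std_part_tuple (t : g.-tuple 'I_D.+1) : minor_tuple t ->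
  std_part a (part_of_tuple t) = \det (\matrix_(i, j) a j (tnth t i)).
Proof.
move=> mt; apply: detn_matrix => i j; rewrite mxE std_frame_gap.
have := nth_part_of_tuple i mt; have := ltn_ord i; set l := nth _ _ _ => ig e.
by have -> : l%:Z - i.+1%:Z + g%:Z = (tnth t i : nat)%:Z by lia.
Qed.

Lemma std_part_large la : (D < nth 0 la 0 + n)%N -> std_part a la = 0.
Proof.
move=> Dl; rewrite /std_part /detn (expand_det_row _ ord0) big1 // => j _.
rewrite mxE std_frame_gap.
have -> : (nth 0%N la (ord0 : 'I_g))%:Z - (ord0 : 'I_g).+1%:Z + g%:Z = (nth 0%N la 0 + n)%N%:Z.
  by rewrite /=; lia.
rewrite a_top ?mul0r //; apply: leq_ltn_trans Dl.
have [->//|jm] := eqVneq j ord_max; apply/ltnW/(gap_ltn gapS).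
by rewrite ltn_neqAle -ltnS ltn_ord andbT; apply: contra jm => /eqP e; apply/eqP/val_inj.
Qed.

Lemma schur_weierstrass_tuple (t : g.-tuple 'I_D.+1) : minor_tuple t ->
  schur_weierstrass x (part_of_tuple t) =
  \det (\matrix_(i, k < g) sigma x ((tnth t i : nat)%:Z - (n - k)%N%:Z)).
Proof.
move=> mt; rewrite (schur_weierstrass_detn sigma0 (size_part_of_tuple t)).
apply: detn_matrix => i k; rewrite mxE.
have := nth_part_of_tuple i mt; have := ltn_ord i; have := ltn_ord k.
set l := nth _ _ _ => kg ig e; congr (sigma x _); lia.
Qed.

(** The Schur determinant has shift n - k in column k and T has shift k; reversing the columns
    produces the sign in [sum_schur_theta]. *)
Lemma theta_mx_sigma (j k : 'I_g) :
  theta_mx w a (fun k => sigma x k%:Z) j (rev_ord k) =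
  \sum_(l < D.+1) mC (a j l) * sigma x (l%:Z - (n - k)%N%:Z).
Proof.
have rk : rev_ord k = (n - k)%N :> nat by rewrite /= subSS.
rewrite mxE /gapf.
have wD : ((w j).+1 <= D.+1)%N.
  have [->//|jm] := eqVneq j ord_max; apply/ltnW/(gap_ltn gapS).
  by rewrite ltn_neqAle -ltnS ltn_ord andbT; apply: contra jm => /eqP e; apply/eqP/val_inj.
set E := _ * _; rewrite (big_ord_widen D.+1 (fun l => mC (a j l) * E`_l) wD).
rewrite big_mkcond; apply: eq_bigr => l _; rewrite /E coefMXn coef_poly rk.
case: ltnP => [_|lw]; last by rewrite a_top // mpoly.mpolyC0 mul0r.
congr (_ * _); case: ltnP => lk.
  by have : l%:Z - (n - k)%N%:Z < 0; [lia|case: (l%:Z - (n - k)%N%:Z)].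
rewrite ifT; last by rewrite ltnS (leq_trans (leq_subr _ _)) // -ltnS.
by apply: (congr1 (sigma x)); lia.
Qed.

Lemma sum_schur_theta :
  \sum_(t : g.-tuple 'I_D.+1 | minor_tuple t)
    mC (\det (\matrix_(i, j) a j (tnth t i))) * schur_weierstrass x (part_of_tuple t) =
  mC ((-1) ^+ (perm (@rev_ord_inj g))) * T.
Proof.
transitivity (\sum_(t : g.-tuple 'I_D.+1 | minor_tuple t)
    \det (\matrix_(i, j) mC (a j (tnth t i))) *
    \det (\matrix_(i, k < g) sigma x ((tnth t i : nat)%:Z - (n - k)%N%:Z))).
  apply: eq_bigr => t mt; rewrite (schur_weierstrass_tuple mt); congr (_ * _).
  rewrite -det_map_mx; congr (\det _).
  by apply/matrixP => i j; rewrite !mxE.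
rewrite -(cauchy_binet (fun (l : 'I_D.+1) (j : 'I_g) => mC (a j l))
  (fun (l : 'I_D.+1) (k : 'I_g) => sigma x (l%:Z - (n - k)%N%:Z))).
transitivity (\det (col_perm (perm (@rev_ord_inj g)) (theta_mx w a (fun k => sigma x k%:Z)))).
  by congr (\det _); apply/matrixP => j k; rewrite [RHS]mxE permE theta_mx_sigma mxE.
rewrite col_permE det_mulmx det_perm odd_permV mulrC; congr (_ * _).
by rewrite rmorph_sign.
Qed.

Variables (U : set (int -> C)) (xi : int -> nat -> C).
Hypothesis UP : forall s, U s <-> exists N c, s =1 (fun n => std_comb a N c (n - 1)).
Hypothesis xi_frame : is_frame U xi.

Lemma tau_theta : exists2 kappa : C, kappa != 0 &
  forall m, tau xi x m = kappa * mpoly.mcoeff m T.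
Proof.
have [kappa k0 xiE] := xi_part_frame a_delta w_gt0 UP xi_frame.
exists (kappa * (-1) ^+ (perm (@rev_ord_inj g))); first by rewrite mulf_neq0 ?signr_eq0.
move=> m; rewrite /tau (@sum_partitions n D) => [|la laP]; last first.
  rewrite xiE //; case/orP=> [sg|Dl]; first by rewrite leqNgt sg mul0r.
  by rewrite std_part_large // mulr0 if_same mul0r.
rewrite -mulrA -mpoly.mcoeffCM -sum_schur_theta raddf_sum mulr_sumr.
apply: eq_bigr => t mt; rewrite xiE; last exact: part_of_tupleP.
by rewrite size_part_of_tuple std_part_tuple // -mulrA /= mpoly.mcoeffCM.
Qed.

End TauTheta.

(** * Abel integrals *)

Section Primitive.
Variable F : numFieldType.

Definition primitive (p : {poly F}) : {poly F} :=
  \poly_(k < (size p).+1) (p`_k.-1 / k%:R).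

Lemma primitive_coef (p : {poly F}) k : (primitive p)`_k = p`_k.-1 / k%:R.
Proof.
rewrite coef_poly; case: ltnP => //; case: k => // k; rewrite ltnS => pk.
by rewrite nth_default ?mul0r.
Qed.

Lemma deriv_primitive p : (primitive p)^`() = p.
Proof.
by apply/polyP => k; rewrite coef_deriv primitive_coef -[LHS]mulr_natr divfK ?pnatr_eq0.
Qed.

Lemma primitive0 p : (primitive p).[0] = 0.
Proof. by rewrite horner_coef0 primitive_coef invr0 mulr0. Qed.

Lemma primitiveE (p : {poly F}) a N : (size p <= N)%N ->
  (primitive p).[a] = \sum_(k < N.+1) p`_k.-1 / k%:R * a ^+ k.
Proof.
move=> pN; rewrite (@horner_coef_wide _ N.+1); last first.
  by rewrite (leq_trans (size_poly _ _)).
by apply: eq_bigr => k _; rewrite primitive_coef.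
Qed.

End Primitive.

Section AbelIntegral.
Import numFieldNormedType.Exports.
Variable R : realType.
Local Notation C := R[i].
Local Notation tf := (@tofrac {poly C}).

Lemma horner_continuous (q : {poly R}) : continuous (horner q : R -> R).
Proof.
move=> x; apply: differentiable_continuous.
by apply/derivable1_diffP; exact: derivable_horner.
Qed.

Lemma Rintegral_deriv (q : {poly R}) :
  Rintegral (@lebesgue_measure R) `[0, 1] (fun s => q^`().[s]) = q.[1] - q.[0].
Proof.
rewrite /Rintegral (@continuous_FTC2 _ _ (horner q)) //.
- exact/continuous_subspaceT/horner_continuous.
- split; first by move=> x _; exact: derivable_horner.
  + by apply: cvg_at_right_filter; exact: horner_continuous.
  + by apply: cvg_at_left_filter; exact: horner_continuous.
- by move=> x _; rewrite derivE.
Qed.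

Section Part.
Variable part : C -> R.
Hypothesis partD : forall x y, part (x + y) = part x + part y.
Hypothesis partZ : forall x s, part (x * s%:C) = part x * s.

Definition part_poly (Q : {poly C}) : {poly R} := \poly_(k < size Q) part Q`_k.

Lemma part0 : part 0 = 0.
Proof. by rewrite -(mulr0 (0 : C)) partZ mulr0. Qed.

Lemma part_poly_coef Q k : (part_poly Q)`_k = part Q`_k.
Proof. by rewrite coef_poly; case: ltnP => // Qk; rewrite nth_default ?part0. Qed.

Lemma part_horner Q s : part Q.[s%:C] = (part_poly Q).[s].
Proof.
rewrite horner_coef horner_poly (big_morph part partD part0).
by apply: eq_bigr => k _; rewrite -rmorphXn partZ.
Qed.

Lemma part_deriv Q : part_poly Q^`() = (part_poly Q)^`().
Proof.
apply/polyP => k; rewrite coef_deriv !part_poly_coef coef_deriv.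
by move: Q`_k.+1 => y; elim: k.+1 => [|m IH]; rewrite ?mulr0n ?part0 // !mulrS partD IH.
Qed.

(** [part] is the real or the imaginary part. At a real argument it acts on coefficients, so the
    real fundamental theorem of calculus applies to Q(s) = [primitive p] at s a. *)
Lemma Rintegral_part (p : {poly C}) a :
  Rintegral (@lebesgue_measure R) `[0, 1]
    (fun s => part (rval (Some (s%:C * a)) (tf p) * a)) = part (primitive p).[a].
Proof.
pose Q := primitive p \Po (a *: 'X).
have QE z : Q.[z] = (primitive p).[z * a].
  by rewrite horner_comp hornerZ hornerX mulrC.
have Q'E s : part (rval (Some (s%:C * a)) (tf p) * a) = (part_poly Q)^`().[s].
  rewrite -part_deriv -part_horner rval_poly; congr part.
  rewrite /Q deriv_comp derivZ derivX deriv_primitive hornerM horner_comp.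
  by rewrite !hornerZ hornerX hornerC mulr1 [a * _]mulrC.
rewrite (_ : (fun s => _) = (fun s => (part_poly Q)^`().[s])); last exact/funext/Q'E.
rewrite Rintegral_deriv -!part_horner !QE rmorph1 mul1r rmorph0 mul0r primitive0.
by rewrite part0 subr0.
Qed.

End Part.

Lemma abel_integral_poly (p : {poly C}) a : abel_integral (tf p) a = (primitive p).[a].
Proof.
rewrite /abel_integral (Rintegral_part (part := @complex.Re R)).
- rewrite (Rintegral_part (part := @complex.Im R)); first by case: (_.[a]).
  + by move=> [x y] [x' y'].
  + by move=> [x y] s; rewrite /= mulr0 add0r.
- by move=> [x y] [x' y'].
- by move=> [x y] s; rewrite /= mulr0 subr0.
Qed.

End AbelIntegral.

(** * The complex exponential *)

Section ComplexExponential.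
Variable R : realType.
Local Notation C := R[i].

Lemma unit_circle (x y : R) : x ^+ 2 + y ^+ 2 = 1 ->
  exists th, cos th = x /\ sin th = y.
Proof.
move=> xy; have x1 : -1 <= x <= 1.
  rewrite -ler_norml -(ler_pXn2r (n := 2)) ?nnegrE // expr1n real_normK ?num_real //.
  by rewrite -xy lerDl sqr_ge0.
have cx : cos (acos x) = x by apply: acosK; rewrite in_itv.
have sx : sin (acos x) = `|y|.
  by rewrite sin_acos // -xy addrAC subrr add0r sqrtr_sqr.
have [y0|y0] := leP 0 y; first by exists (acos x); rewrite sx ger0_norm.
by exists (- acos x); rewrite cosN sinN sx ltr0_norm // opprK.
Qed.

Lemma cexp_surj (z : C) : z != 0 -> exists2 c0 : C, c0 != 0 & cexp c0 = z.
Proof.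
case: z => a b z0; pose r := Num.sqrt (a ^+ 2 + b ^+ 2).
have r2 : 0 < a ^+ 2 + b ^+ 2.
  rewrite lt_neqAle addr_ge0 ?sqr_ge0 // andbT eq_sym.
  rewrite paddr_eq0 ?sqr_ge0 // !sqrf_eq0; apply: contra z0 => /andP[/eqP-> /eqP->].
  exact: eqxx.
have r0 : 0 < r by rewrite sqrtr_gt0.
have rr : r ^+ 2 = a ^+ 2 + b ^+ 2 by rewrite sqr_sqrtr ?ltW.
have [|th [cth sth]] := @unit_circle (a / r) (b / r).
  by rewrite !expr_div_n -mulrDl rr divff ?gt_eqF.
have main t : cos t = cos th -> sin t = sin th -> cexp (ln r +i* t) = a +i* b.
  move=> ct st; rewrite /cexp /= lnK // ct st cth sth.
  by congr (_ +i* _); rewrite mulrC divfK ?gt_eqF.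
(* With argument 0 the logarithm could be 0, as for z = 1; adding 2 pi to the argument keeps c0
   nonzero. *)
have [th0|th0] := eqVneq th 0; last first.
  by exists (ln r +i* th); [apply: contra th0 => /eqP[_ ->]|exact: main].
exists (ln r +i* (th + pi *+ 2)); last by apply: main; rewrite ?cosD2pi ?sinD2pi.
rewrite th0 add0r; apply/eqP => -[_ /eqP].
by rewrite mulrn_eq0 /= gt_eqF ?pi_gt0.
Qed.

End ComplexExponential.

(** * The theta function *)

Section ThetaFunction.
Variables (R : realType) (Cv : rational_curve R) (Pinf : curve_point Cv).
Local Notation C := R[i].
Hypothesis C_sing : forall P : curve_point Cv, ~ smooth P <-> P = Pinf.
Hypothesis Pinf_unibranch : unibranch Pinf.
Hypothesis Pinf_coord : nu Cv None = Pinf.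
Variables (n : nat) (w : 'I_n.+1 -> nat) (a : 'I_n.+1 -> nat -> C).
Hypothesis gapS : gap_system w a.
Local Notation P := (mpoly_ring C n.+1).
Local Notation T := (theta_poly w a (fun k => sigma (gap_vars w) k%:Z)).

Lemma sigma_gap_rec N :
  exp_rec (gap_monomials C w) (fun k => sigma (gap_vars w) k%:Z : P) N.
Proof. exact: sigma_rec. Qed.

Lemma sigma_gap0 : sigma (gap_vars w) 0 = 1 :> P.
Proof. by have [-> _] := sigma_gap_rec 0. Qed.

Lemma abel_integral_gap_diff j c :
  abel_integral (gap_diff w a j) c = \sum_(l < (w j).+1) a j l / l%:R * c ^+ l.
Proof.
rewrite abel_integral_poly (@primitiveE _ _ _ (w j)) ?size_poly //.
apply: eq_bigr => -[[|l] lw] _ /=; first by rewrite invr0 !mulr0 !mul0r.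
by rewrite coef_poly; rewrite ltnS in lw; rewrite lw.
Qed.

(** Every point at finite distance is smooth, so the g - 1 points range over all of C and the Abel
    map is the polynomial map [abel_pt]. *)
Lemma abel_image_gap_diff z : abel_image Cv (gap_diff w a) z <->
  exists c, z =1 abel_pt w a c.
Proof.
rewrite /abel_image /= subn1 /=; split=> [[c _ zE]|[c zE]]; exists c.
- by move=> j; rewrite zE; apply: eq_bigr => k _; exact: abel_integral_gap_diff.
- by move=> k; exact: (finite_smooth C_sing Pinf_unibranch Pinf_coord).
- by move=> j; rewrite zE; apply: eq_bigr => k _; rewrite abel_integral_gap_diff.
Qed.

Lemma theta_divisor_gap_diff :
  theta_divisor Cv (gap_diff w a) = [set z | mpoly.meval z T = 0].
Proof.
have w0 := gap_first gapS; apply/seteqP; split=> z.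
  move=> /(_ T); apply=> y /abel_image_gap_diff[c yE].
  by rewrite (funext yE) (theta_eval_abel gapS w0 sigma_gap_rec).
move=> /= Tz p pS; have [|q ->] := @theta_dvd C n w a _ gapS w0 sigma_gap_rec p.
  by move=> c; apply: pS; apply/abel_image_gap_diff; exists c.
by rewrite rmorphM /= Tz mul0r.
Qed.

Lemma theta_function_theta_poly : theta_function Cv (gap_diff w a) T.
Proof.
split; last by rewrite theta_divisor_gap_diff.
exact: (theta_reduced gapS (gap_first gapS) sigma_gap_rec).
Qed.

Lemma theta_function_unique theta : theta_function Cv (gap_diff w a) theta ->
  exists2 c : C, c != 0 & theta = mpoly.mpolyC n.+1 c * T.
Proof.
rewrite /theta_function theta_divisor_gap_diff => -[red zer].
apply: (theta_unique gapS (gap_first gapS) sigma_gap_rec red) => z.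
by have := congr1 (fun S : set _ => S z) zer => /= ->.
Qed.

End ThetaFunction.
Unset Implicit Arguments.

Theorem corollary4p10 (R : realType) (C : rational_curve R) (g : nat)
    (P0 Pinf : curve_point C) (w : 'I_g -> nat)
    (C_gorenstein : gorenstein C)
    (C_genus : arithmetic_genus C g)
    (C_sing : forall P : curve_point C, ~ smooth P <-> P = Pinf)
    (Pinf_unibranch : unibranch Pinf)
    (P0_smooth : smooth P0)
    (P0_coord : nu C (Some 0) = P0)
    (Pinf_coord : nu C None = Pinf)
    (w_increasing : forall i j : 'I_g, (i < j)%N -> (w i < w j)%N)
    (w_gaps : forall n : nat,
       (exists j, w j = n) <-> ~ value_semigroup C None n) :
  let U := [set iota_diff g f | f in H0L_infty P0 g] in
  (exists xi, is_frame U xi) /\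
  forall xi, is_frame U xi ->
  exists omega : 'I_g -> ratfun R,
    [/\ canonical_basis C omega,
        exists theta, theta_function C omega theta &
        forall theta, theta_function C omega theta ->
        exists c0 : R[i], c0 != 0 /\
          forall m, cexp c0 * tau xi (gap_vars w) m = mpoly.mcoeff m theta].
Proof.
have [a [a_top a_delta a_0 a_stalk]] :=
  gap_coefP Pinf_unibranch Pinf_coord w_increasing w_gaps.
have := gap_number_neq0 C_sing Pinf_coord a_stalk.
case: g w C_genus w_increasing w_gaps a a_top a_delta a_0 a_stalk => // n w _ w_ltn _.
move=> a a_top a_delta a_0 a_stalk _ U.
have w_gt0 := gap_w_gt0 a_delta a_0.
have gapS : gap_system w a by exact: gap_system_of_curve a_stalk.
have UP s : U s <-> exists N c, s =1 (fun n => std_comb a N c (n - 1)).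
  exact: (iota_H0L_infty C_sing Pinf_unibranch P0_coord Pinf_coord a_top a_delta a_0 a_stalk).
split; first by eexists; exact: (std_frame_is_frame a_delta w_gt0 UP).
move=> xi xi_frame; exists (gap_diff w a); split.
- exact: (gap_diff_canonical C_sing Pinf_unibranch Pinf_coord a_top a_delta a_0 a_stalk).
- by eexists; exact: (theta_function_theta_poly C_sing Pinf_unibranch Pinf_coord gapS).
move=> theta /(theta_function_unique C_sing Pinf_unibranch Pinf_coord gapS)[c c_neq0 ->].
have [kappa k0 tauE] := tau_theta gapS w_gt0 (sigma_gap0 R w) UP xi_frame.
(* [kappa] compares tau with T and depends on the frame; [c] compares theta with T. *)
have [|c0 c0_neq0 c0E] := @cexp_surj R (c / kappa).
  by rewrite mulf_neq0 ?invr_eq0.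
exists c0; split=> // m.
by rewrite c0E tauE mulrA divfK // mpoly.mcoeffCM.
Qed.
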